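(* Let $N\ge 2$ be an integer, let $s\in(0,1)$ and let $p\in\left(1,\frac{N+2s}{N-2s}\right)$. Then there exists a (variational) solution $u\in H^s(\mathbb{R}^N)$, $u\not\equiv 0$, of $$(-\Delta)^s u+u=|u|^{p-1}u\quad\text{in }\mathbb{R}^N$$ which is positive and spherically symmetric.
   Context: For $s\in(0,1)$, the fractional Sobolev space is $$H^s(\mathbb{R}^N)=\left\{u\in L^2(\mathbb{R}^N):\ \frac{|u(x)-u(y)|}{|x-y|^{\frac N2+s}}\in L^2(\mathbb{R}^N\times\mathbb{R}^N)\right\}.$$ Functions are real valued. The fractional Laplacian is, omitting a multiplicative constant depending only on $N$ and $s$, $$(-\Delta)^s u(x)=\mathrm{P.V.}\int_{\mathbb{R}^N}\frac{u(x)-u(y)}{|x-y|^{N+2s}}\,dy.$$ The equation is understood in the following variational sense (which fixes the normalization): $u\in H^s(\mathbb{R}^N)$ is a variational solution of $(-\Delta)^s u+u=|u|^{p-1}u$ in $\mathbb{R}^N$ if $$\iint_{\mathbb{R}^N\times\mathbb{R}^N}\frac{(u(x)-u(y))(\varphi(x)-\varphi(y))}{|x-y|^{N+2s}}\,dx\,dy+\int_{\mathbb{R}^N}u(x)\varphi(x)\,dx=\int_{\mathbb{R}^N}|u(x)|^{p-1}u(x)\varphi(x)\,dx$$ for every $\varphi\in C^1_0(\mathbb{R}^N)$ (compactly supported $C^1$ functions). Spherically symmetric means that $u(x)$ depends only on $|x|$. As usual for elements of $H^s(\mathbb{R}^N)$, functions are identified when they agree almost everywhere. *)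

(* Defs.v *)
From HB Require Import structures.
From mathcomp Require Import all_boot all_order all_algebra.
From mathcomp Require Import all_classical all_reals all_analysis.

Set Implicit Arguments.
Unset Strict Implicit.
Unset Printing Implicit Defensive.

Import Order.TTheory GRing.Theory Num.Theory.
Import numFieldNormedType.Exports.

Local Open Scope classical_set_scope.
Local Open Scope ring_scope.

(* R^N is the type 'rV[R]_N of row vectors: it already carries the topology
   (and the derivatives) needed for test functions. The library has neither a
   sigma-algebra nor a measure on it; both are built here. *)

Definition measure_rV_display : measure_display.
Proof. exact. Qed.

(* The product sigma-algebra, generated by the coordinate projections; it is
   the Borel sigma-algebra of R^n. *)
Section measurable_rV.
Context (R : realType) (n : nat).

Let coord (i : 'I_n) (x : 'rV[R]_n) : measurableTypeR R := x ord0 i.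

Let rV_set0 : g_sigma_preimage coord set0.
Proof. exact: sigma_algebra0. Qed.

Let rV_setC A : g_sigma_preimage coord A -> g_sigma_preimage coord (~` A).
Proof. exact: sigma_algebraC. Qed.

Let rV_bigcup (F : (set 'rV[R]_n)^nat) :
  (forall i, g_sigma_preimage coord (F i)) ->
  g_sigma_preimage coord (\bigcup_i F i).
Proof. exact: sigma_algebra_bigcup. Qed.

HB.instance Definition _ := @isMeasurable.Build measure_rV_display
  'rV[R]_n (g_sigma_preimage coord) rV_set0 rV_setC rV_bigcup.

Lemma measurable_coord (i : 'I_n) :
  measurable_fun [set: 'rV[R]_n] (fun x => x ord0 i : measurableTypeR R).
Proof.
move=> _ Y mY; rewrite setTI; apply: sub_sigma_algebra => /=.
rewrite -bigcup_seq/=; exists i => /=; first by rewrite mem_index_enum.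
by exists Y => //; rewrite setTI.
Qed.

Lemma measurable_fun_coord d (T : measurableType d) (f : T -> 'rV[R]_n) :
  (forall i, measurable_fun [set: T] (fun x => f x ord0 i : measurableTypeR R)) ->
  measurable_fun [set: T] f.
Proof.
move=> mf.
apply: (@measurability _ _ _ 'rV[R]_n _ _
  (\big[setU/set0]_(i < n) preimage_set_system setT (coord i) measurable)) => //.
move=> _ [A + <-]; rewrite -bigcup_seq => -[i _ [B mB <-]].
by rewrite setTI; exact: mf.
Qed.

End measurable_rV.

Section lebesgue_rV_step.
Context (R : realType) (n : nat).

Definition consv (z : measurableTypeR R * 'rV[R]_n) : 'rV[R]_n.+1 :=
  row_mx (z.1%:M : 'rV[R]_1) z.2.

Definition unconsv (x : 'rV[R]_n.+1) : measurableTypeR R * 'rV[R]_n :=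
  (x ord0 ord0, \row_i x ord0 (lift ord0 i)).

Lemma consv0 z : consv z ord0 ord0 = z.1.
Proof.
have -> : ord0 = lshift n (ord0 : 'I_1) :> 'I_(1 + n) by exact/val_inj.
by rewrite [LHS]row_mxEl mxE eqxx mulr1n.
Qed.

Lemma consvS z i : consv z ord0 (lift ord0 i) = z.2 ord0 i.
Proof.
have -> : lift ord0 i = rshift 1 i :> 'I_(1 + n) by exact/val_inj.
by rewrite [LHS]row_mxEr.
Qed.

Lemma consvK : cancel consv unconsv.
Proof.
case=> a v; rewrite /unconsv consv0; congr pair.
by apply/rowP => i; rewrite mxE consvS.
Qed.

Lemma unconsvK : cancel unconsv consv.
Proof.
move=> x; apply/rowP => i; have [j|] := unliftP ord0 i.
  by move=> ->; rewrite consvS mxE.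
by move=> ->; rewrite consv0.
Qed.

Lemma measurable_consv : measurable_fun setT consv.
Proof.
apply: measurable_fun_coord => i; have [j|] := unliftP ord0 i.
  move=> ->; under eq_fun do rewrite consvS.
  exact: (measurableT_comp (measurable_coord j)).
move=> ->; under eq_fun do rewrite consv0.
exact: measurable_fst.
Qed.

Lemma measurable_unconsv : measurable_fun setT unconsv.
Proof.
apply/measurable_fun_pairP; split; first exact: measurable_coord.
apply: measurable_fun_coord => i.
under eq_fun do rewrite mxE.
exact: measurable_coord.
Qed.

Variable m : {sigma_finite_measure set 'rV[R]_n -> \bar R}.

Definition lebesgue_rV_step : set 'rV[R]_n.+1 -> \bar R :=
  pushforward (@lebesgue_measure R \x m)%E consv.

Let step0 : lebesgue_rV_step set0 = 0%E.
Proof. by rewrite /lebesgue_rV_step /pushforward preimage_set0 measure0. Qed.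

Let step_ge0 A : (0 <= lebesgue_rV_step A)%E.
Proof. by rewrite /lebesgue_rV_step /pushforward; exact: measure_ge0. Qed.

Let step_sigma_additive : semi_sigma_additive lebesgue_rV_step.
Proof.
move=> F mF tF mUF; rewrite /lebesgue_rV_step /pushforward preimage_bigcup.
have mpre A : measurable A -> measurable (consv @^-1` A).
  by move=> mA; rewrite -[X in measurable X]setTI; exact: measurable_consv.
apply: measure_semi_sigma_additive.
- by move=> k; exact: mpre.
- apply/trivIsetP => /= i j _ _ ij; rewrite -preimage_setI.
  by move/trivIsetP : tF => /(_ _ _ _ _ ij) ->//; rewrite preimage_set0.
- by rewrite -preimage_bigcup; exact: mpre.
Qed.

HB.instance Definition _ := isMeasure.Build _ _ _ lebesgue_rV_step
  step0 step_ge0 step_sigma_additive.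

Let step_sigma_finite : sigma_finite setT lebesgue_rV_step.
Proof.
have /sigma_finiteP[F [TF ndF Foo]] := sigma_finiteT (@lebesgue_measure R).
have /sigma_finiteP[G [TG ndG Goo]] := sigma_finiteT m.
exists (fun k => unconsv @^-1` (F k `*` G k)).
  rewrite -preimage_bigcup (_ : \bigcup_k _ = setT) ?preimage_setT//.
  rewrite -setXTT TF TG predeqE => -[x y]; split.
    by move=> [n1 _ []/= ? ?]; split; exists n1.
  move=> [/= [n1 _ Fn1x] [k _ Gky]]; exists (maxn n1 k) => //; split.
  - by move: x Fn1x; exact/subsetPset/ndF/leq_maxl.
  - by move: y Gky; exact/subsetPset/ndG/leq_maxr.
move=> k; have [mF Fk] := Foo k; have [mG Gk] := Goo k; split.
  rewrite -[X in measurable X]setTI.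
  by apply: measurable_unconsv => //; exact: measurableX.
rewrite /lebesgue_rV_step /pushforward -comp_preimage.
rewrite (_ : unconsv \o consv = id); last by apply/funext => z; exact: consvK.
by rewrite preimage_id product_measure1E// lte_mul_pinfty// ge0_fin_numE.
Qed.

HB.instance Definition _ := Measure_isSigmaFinite.Build _ _ _
  lebesgue_rV_step step_sigma_finite.

End lebesgue_rV_step.

(* Lebesgue measure on R^n: the n-fold product of [lebesgue_measure], R^0 being
   a point of mass 1. *)
Fixpoint lebesgue_rV (R : realType) (n : nat) :
    {sigma_finite_measure set 'rV[R]_n -> \bar R} :=
  match n with
  | 0 => dirac (0 : 'rV[R]_0)
  | n'.+1 => lebesgue_rV_step (lebesgue_rV R n')
  end.

Lemma lebesgue_rV_box (R : realType) (n : nat)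
    (A : 'I_n -> set (measurableTypeR R)) :
  (forall i, measurable (A i)) ->
  lebesgue_rV R n [set x | forall i, A i (x ord0 i)] =
  (\prod_(i < n) lebesgue_measure (A i))%E.
Proof.
elim: n A => [|n IH] A mA.
  rewrite big_ord0 /= diracE mem_set //; by case.
rewrite big_ord_recl -IH //= /lebesgue_rV_step /pushforward.
rewrite -product_measure1E //; last first.
  rewrite [X in measurable X](_ : _ = \bigcap_(i in [set: 'I_n])
      ((fun x : 'rV[R]_n => x ord0 i) @^-1` A (lift ord0 i))); last first.
    by apply/seteqP; split => x /= h i => [_|]; exact: h.
  apply: fin_bigcap_measurable => // i _.
  rewrite -[X in measurable X]setTI.
  exact: (@measurable_coord R n i measurableT _ (mA _)).
congr product_measure1; apply/seteqP; split => -[a v] /=.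
  move=> h; split; first by have := h ord0; rewrite consv0.
  by move=> i; have := h (lift ord0 i); rewrite consvS.
move=> [h0 hS] i; have [j|] := unliftP ord0 i.
  by move=> ->; rewrite consvS.
by move=> ->; rewrite consv0.
Qed.

(* The library norm `|x| on 'rV[R]_N is the sup norm. *)
Definition enorm (R : realType) (N : nat) (x : 'rV[R]_N) : R :=
  Num.sqrt (\sum_(i < N) x ord0 i ^+ 2).

(* [u] stands for its class modulo equality almost everywhere; each class of
   Lebesgue-measurable functions has a Borel representative, so asking for
   Borel measurability (part of [Lfun]) loses nothing. On the diagonal the
   quotient is 0 / 0 = 0, and the diagonal is negligible. *)
Definition fractional_sobolev (R : realType) (N : nat) (s : R)
    (u : 'rV[R]_N -> R) : Prop :=
  u \in Lfun (lebesgue_rV R N) 2%:E /\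
  (fun z : 'rV[R]_N * 'rV[R]_N =>
     `|u z.1 - u z.2| / enorm (z.1 - z.2) `^ (N%:R / 2 + s))
    \in Lfun (lebesgue_rV R N \x lebesgue_rV R N)%E 2%:E.

Definition C1_compact_support (R : realType) (N : nat)
    (phi : 'rV[R]_N -> R) : Prop :=
  [/\ forall x, differentiable phi x,
      forall v, continuous (fun x => 'D_v phi x)
    & compact (closure [set x | phi x != 0])].

(* The integrals are extended-real valued: since the left-hand side is finite
   for u in H^s, the equation also says that |u|^(p-1) u phi is integrable. *)
Definition variational_solution (R : realType) (N : nat) (s p : R)
    (u : 'rV[R]_N -> R) : Prop :=
  fractional_sobolev s u /\
  forall phi : 'rV[R]_N -> R, C1_compact_support phi ->
    (\int[(lebesgue_rV R N \x lebesgue_rV R N)%E]_z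
        ((u z.1 - u z.2) * (phi z.1 - phi z.2)
           / enorm (z.1 - z.2) `^ (N%:R + 2 * s))%:E
     + \int[lebesgue_rV R N]_x (u x * phi x)%:E
     = \int[lebesgue_rV R N]_x (`|u x| `^ (p - 1) * u x * phi x)%:E)%E.

Definition spherically_symmetric (R : realType) (N : nat)
    (u : 'rV[R]_N -> R) : Prop :=
  exists g : R -> R, {ae lebesgue_rV R N, forall x, u x = g (enorm x)}.

(* Main.v *)
(** Put [q := p + 1] and let [Q u] be the squared norm of [H^s]. Averages of
    [u] over dyadic cubes satisfy [|u - E_j u|^2 (x) <= C 2^(-2js) D(x)] with
    [D(x) = \int |u x - u y|^2 / |x - y|^(N+2s) dy]; combined with
    [|E_j u| <= 2^(jN/2) |u|_2] this gives, by Hedberg's two-scale argument, the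
    subcritical Sobolev embedding into [L^q]. A rotation invariant function has
    little mass in a ball of fixed radius far from the origin, because many
    disjoint rotated copies of the ball carry the same mass; hence the embedding
    is compact on rotation invariant functions, and [\int |v|^q] has a
    nonnegative maximiser [v] among those with [Q v <= 1]; let [Lam] be the maximum.

    Put [L phi := \int v^(q-1) phi]. The element [w] of least norm in the
    hyperplane [L = 1] of the whole space [H^s] is unique, hence rotation
    invariant, so by Hoelder and the maximality of [v], [1 = L w <= Lam |w|],
    while [L (v / Lam) = 1] and [|v / Lam| <= 1 / Lam]. Thus [v / Lam] is that
    minimal element and satisfies an Euler-Lagrange equation against every test
    function, radial or not; a multiple [u] of [v] solves the equation.

    Testing with [(c psi - u)^+], where [psi] is a hat function, and letting
    [c -> 0] shows that [u] vanishes almost nowhere. Finally the averages of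
    [u] over balls centred at [x] depend on [|x|] only and converge to [u x]
    wherever [D(x)] is finite. *)

Require Import Defs.
From HB Require Import structures.
From mathcomp Require Import all_boot all_order all_algebra.
From mathcomp Require Import all_classical all_reals all_analysis.
From mathcomp Require Import measurable_realfun ess_sup_inf.
From mathcomp Require Import ring lra.

Set Implicit Arguments.
Unset Strict Implicit.
Unset Printing Implicit Defensive.

Import Order.TTheory GRing.Theory Num.Theory.
Import numFieldNormedType.Exports.

Local Open Scope classical_set_scope.
Local Open Scope ring_scope.

(** * Measure-preserving maps *)

(** The maximality of [v] is known against rotation invariant competitors only, so varying [v]
    directly would give the equation for radial test functions alone. The hyperplane argument plays
    the part of symmetric criticality: [w] is minimal in the whole space, and uniqueness alone makes
    it invariant. It rests on completeness and the parallelogram law, without weak compactness.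

    Rotations are not treated as a group with a Haar measure. Finitely many rotations, each in the
    plane of the first axis and another one, carry any point to the first axis, and this is all that
    radiality requires.

    With beta = 2^(N/2) and tau = 2^(-s), the two-scale argument yields a factor kappa^j, where
    kappa = tau^q beta^(q-2); the inequality kappa < 1 says exactly q(N - 2s) < 2N. One estimate
    then serves twice: at j = 0 it is the embedding, and at large j it makes the part of [u] below
    the scale 2^(-j) uniformly small in L^q, so that compactness reduces to the convergence of
    finitely many cube averages. *)

Definition measure_preserving d1 d2 (T1 : measurableType d1)
    (T2 : measurableType d2) (R : realType) (m1 : set T1 -> \bar R)
    (m2 : set T2 -> \bar R) (f : T1 -> T2) :=
  measurable_fun setT f /\
  forall A, measurable A -> m1 (f @^-1` A) = m2 A.

Section measure_preserving.
Context d1 d2 d3 (T1 : measurableType d1) (T2 : measurableType d2)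
  (T3 : measurableType d3) (R : realType).

Lemma measure_preserving_comp (m1 : set T1 -> \bar R) (m2 : set T2 -> \bar R)
    (m3 : set T3 -> \bar R) f g :
  measure_preserving m1 m2 f -> measure_preserving m2 m3 g ->
  measure_preserving m1 m3 (g \o f).
Proof.
move=> [mf mpf] [mg mpg]; split; first exact: measurableT_comp.
move=> A mA; rewrite comp_preimage mpf ?mpg//.
by rewrite -[X in measurable X]setTI; exact: mg.
Qed.

Lemma measure_preserving_integral (m1 : {measure set T1 -> \bar R})
    (m2 : {measure set T2 -> \bar R}) f (h : T2 -> \bar R) :
  measure_preserving m1 m2 f ->
  measurable_fun setT h -> (forall x, 0 <= h x)%E ->
  (\int[m1]_x h (f x) = \int[m2]_x h x)%E.
Proof.
move=> [mf mpf] mh h0.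
have -> : (\int[m1]_x h (f x) = \int[pushforward m1 f]_x h x)%E.
  rewrite (ge0_integral_pushforward mf m1 (f := h) measurableT)// preimage_setT//.
by apply: eq_measure_integral => A mA _; exact: mpf.
Qed.

Lemma measure_preserving_ae (m1 : {measure set T1 -> \bar R})
    (m2 : {measure set T2 -> \bar R}) f (P : set T2) :
  measure_preserving m1 m2 f ->
  {ae m2, forall x, P x} -> {ae m1, forall x, P (f x)}.
Proof.
move=> [mf mpf] [A [mA A0 PA]]; exists (f @^-1` A); split.
- by rewrite -[X in measurable X]setTI; exact: mf.
- by rewrite mpf.
- by move=> x /= Px; apply: PA.
Qed.

End measure_preserving.

Section measure_preserving_skew.
Context d1 d2 (T1 : measurableType d1) (T2 : measurableType d2) (R : realType)
  (m1 : {sigma_finite_measure set T1 -> \bar R})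
  (m2 : {sigma_finite_measure set T2 -> \bar R}).

(** Fubini: a vertical slice of the preimage is the preimage of a slice under [g x], so equal
    functions of [x] are integrated. *)
Lemma measure_preserving_skewr (g : T1 -> T2 -> T2) :
  measurable_fun setT (fun z : T1 * T2 => g z.1 z.2) ->
  (forall x, measure_preserving m2 m2 (g x)) ->
  measure_preserving (m1 \x m2)%E (m1 \x m2)%E (fun z => (z.1, g z.1 z.2)).
Proof.
move=> mg mpg; split; first by apply/measurable_fun_pairP; split; [exact: measurable_fst|].
move=> A mA /=; rewrite /product_measure1/=; apply: eq_integral => x _.
by rewrite -((mpg x).2 _ (measurable_xsection x mA)).
Qed.

(** Same argument with horizontal slices, after passing to the other iterated form of the product
    measure by uniqueness. *)
Lemma measure_preserving_skewl (g : T2 -> T1 -> T1) :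
  measurable_fun setT (fun z : T1 * T2 => g z.2 z.1) ->
  (forall y, measure_preserving m1 m1 (g y)) ->
  measure_preserving (m1 \x m2)%E (m1 \x m2)%E (fun z => (g z.2 z.1, z.2)).
Proof.
move=> mg mpg.
have mf : measurable_fun setT (fun z : T1 * T2 => (g z.2 z.1, z.2)).
  by apply/measurable_fun_pairP; split; [|exact: measurable_snd].
have E A : measurable A -> (m1 \x m2)%E A = (m1 \x^ m2)%E A.
  by move=> mA; apply: product_measure_unique => //= *; rewrite product_measure2E.
split=> // A mA; rewrite !E//; last first.
  by rewrite -[X in measurable X]setTI; exact: mf.
rewrite /= /product_measure2/=; apply: eq_integral => y _.
by rewrite -((mpg y).2 _ (measurable_ysection y mA)).
Qed.

End measure_preserving_skew.

Section translation.
Context (R : realType).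

(** Lebesgue measure is determined by its values on half-open intervals, so the pushforward is
    computed only there. *)
Lemma measure_preserving_lebesgueD (a : R) :
  measure_preserving (@lebesgue_measure R) lebesgue_measure
    (fun x : measurableTypeR R => x + a : measurableTypeR R).
Proof.
have mf : measurable_fun setT (fun x : measurableTypeR R => x + a : measurableTypeR R).
  exact: measurable_funD.
split => // A mA; apply/esym.
pose f : {mfun measurableTypeR R >-> measurableTypeR R} := HB.pack
  (fun x : measurableTypeR R => x + a : measurableTypeR R) (isMeasurableFun.Build _ _ _ _ _ mf).
have -> : lebesgue_measure ((fun x : measurableTypeR R => x + a) @^-1` A) =
  pushforward lebesgue_measure f A by [].
apply: lebesgue_measure_unique => // _ [[b c] _ <-].
change (lebesgue_measure (`]b, c]%classic : set (measurableTypeR R)) =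
  lebesgue_measure ((fun x : measurableTypeR R => x + a) @^-1` `]b, c]%classic)).
have -> : (fun x : measurableTypeR R => x + a) @^-1` `]b, c]%classic =
    `](b - a)%R, (c - a)%R]%classic.
  by apply/seteqP; split=> x /=; rewrite !in_itv/= lerBrDr ltrBlDr.
rewrite !lebesgue_measure_itv/= !lte_fin ltrD2r; case: ifP => // _.
by rewrite -!EFinB; congr EFin; ring.
Qed.

Lemma consv_unconsv n (x : 'rV[R]_n.+1) : x = consv (unconsv x).
Proof. by rewrite unconsvK. Qed.

Lemma measure_preserving_consv n :
  measure_preserving (@lebesgue_measure R \x lebesgue_rV R n)%E
    (lebesgue_rV R n.+1) (@consv R n).
Proof. by split => //; exact: measurable_consv. Qed.

Lemma measure_preserving_unconsv n :
  measure_preserving (lebesgue_rV R n.+1)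
    (@lebesgue_measure R \x lebesgue_rV R n)%E (@unconsv R n).
Proof.
split; first exact: measurable_unconsv.
move=> A mA /=; rewrite /lebesgue_rV_step /pushforward -comp_preimage.
rewrite (_ : @unconsv R n \o @consv R n = id); last by apply/funext => z; exact: consvK.
by rewrite preimage_id.
Qed.

Lemma consvD n (z t : measurableTypeR R * 'rV[R]_n) :
  consv z + consv t = consv (z.1 + t.1, z.2 + t.2).
Proof.
apply/rowP => i; rewrite mxE; have [j|] := unliftP ord0 i => ->.
  by rewrite !consvS mxE.
by rewrite !consv0.
Qed.

Lemma measurable_rVD n d (T : measurableType d) (f g : T -> 'rV[R]_n) :
  measurable_fun setT f -> measurable_fun setT g ->
  measurable_fun setT (fun x => f x + g x).
Proof.
move=> mf mg; apply: measurable_fun_coord => i; under eq_fun do rewrite mxE.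
by apply: measurable_funD; [exact: (measurableT_comp (measurable_coord i) mf)
  |exact: (measurableT_comp (measurable_coord i) mg)].
Qed.

Lemma measurable_rVN n d (T : measurableType d) (f : T -> 'rV[R]_n) :
  measurable_fun setT f -> measurable_fun setT (fun x => - f x).
Proof.
move=> mf; apply: measurable_fun_coord => i; under eq_fun do rewrite mxE.
by apply: measurableT_comp => //; exact: (measurableT_comp (measurable_coord i) mf).
Qed.

Lemma measurable_rVB n d (T : measurableType d) (f g : T -> 'rV[R]_n) :
  measurable_fun setT f -> measurable_fun setT g ->
  measurable_fun setT (fun x => f x - g x).
Proof. by move=> mf mg; apply: measurable_rVD => //; exact: measurable_rVN. Qed.

Lemma measure_preserving_rVD n (t : 'rV[R]_n) :
  measure_preserving (lebesgue_rV R n) (lebesgue_rV R n) (fun x => x + t).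
Proof.
elim: n t => [|n IH] t.
  split; first exact: measurable_rVD.
  move=> A mA /=; congr (\d_ _ _); apply/seteqP; split => x /=;
    by rewrite (thinmx0 t) addr0.
have -> : (fun x => x + t) = @consv R n \o (((fun z => ((unconsv t).1 + z.1, z.2))
  \o (fun z => (z.1, z.2 + (unconsv t).2))) \o @unconsv R n).
  apply/funext => x/=; rewrite {1}[x]consv_unconsv {1}[t]consv_unconsv consvD.
  by rewrite [in LHS]addrC.
apply: measure_preserving_comp (measure_preserving_consv n).
apply: measure_preserving_comp (measure_preserving_unconsv n) _.
pose M := (@lebesgue_measure R \x lebesgue_rV R n)%E.
have h1 : measure_preserving M M (fun z => (z.1, z.2 + (unconsv t).2)).
  apply: (@measure_preserving_skewr _ _ _ _ R (@lebesgue_measure R)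
    (lebesgue_rV R n) (fun _ y => y + (unconsv t).2)) => //.
  exact: measurable_rVD.
have h2 : measure_preserving M M (fun z => ((unconsv t).1 + z.1, z.2)).
  apply: (@measure_preserving_skewl _ _ _ _ R (@lebesgue_measure R)
    (lebesgue_rV R n) (fun _ x => (unconsv t).1 + x)).
    exact: measurable_funD.
  move=> _; under eq_fun do rewrite addrC.
  exact: measure_preserving_lebesgueD.
exact: measure_preserving_comp h1 h2.
Qed.

End translation.

(** * Euclidean isometries *)

Section enorm.
Context (R : realType).

Lemma enorm_ge0 N (x : 'rV[R]_N) : 0 <= enorm x.
Proof. exact: sqrtr_ge0. Qed.

Lemma sqr_enorm N (x : 'rV[R]_N) : enorm x ^+ 2 = \sum_(i < N) x ord0 i ^+ 2.
Proof. by rewrite sqr_sqrtr// sumr_ge0// => i _; exact: sqr_ge0. Qed.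

Lemma enormN N (x : 'rV[R]_N) : enorm (- x) = enorm x.
Proof.
by rewrite /enorm; congr Num.sqrt; apply: eq_bigr => i _; rewrite mxE sqrrN.
Qed.

Lemma enorm_subC N (x y : 'rV[R]_N) : enorm (x - y) = enorm (y - x).
Proof. by rewrite -enormN opprB. Qed.

Lemma normr_le_enorm N (x : 'rV[R]_N) i : `|x ord0 i| <= enorm x.
Proof.
rewrite -(@ler_pXn2r _ 2)// ?nnegrE ?enorm_ge0// sqr_enorm real_normK ?num_real//.
by rewrite (bigD1 i)//= lerDl sumr_ge0// => j _; exact: sqr_ge0.
Qed.

Lemma enorm_le N (x : 'rV[R]_N) (r : R) : 0 <= r ->
  (forall i, `|x ord0 i| <= r) -> enorm x <= Num.sqrt N%:R * r.
Proof.
move=> r0 xr; rewrite -(ger0_norm r0) -sqrtr_sqr -sqrtrM ?ler0n// ler_wsqrtr//.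
rewrite mulr_natl -[N in X in _ <= X]card_ord -sumr_const ler_sum// => i _.
by rewrite -ler_sqrt ?sqr_ge0// !sqrtr_sqr (ger0_norm r0).
Qed.

Lemma enorm_gt0 N (x : 'rV[R]_N) : x != 0 -> 0 < enorm x.
Proof.
move=> x0; rewrite lt_neqAle enorm_ge0 andbT; apply: contra x0 => /eqP e0.
apply/eqP/rowP => i; rewrite mxE; apply/eqP.
by rewrite -normr_eq0 eq_le normr_ge0 andbT (le_trans (normr_le_enorm x i))// -e0.
Qed.

Lemma enorm_consv n (z : measurableTypeR R * 'rV[R]_n) :
  enorm (consv z) ^+ 2 = z.1 ^+ 2 + enorm z.2 ^+ 2.
Proof.
rewrite !sqr_enorm big_ord_recl consv0; congr (_ + _).
by apply: eq_bigr => i _; rewrite consvS.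
Qed.

Lemma measurable_enorm d (T : measurableType d) N (f : T -> 'rV[R]_N) :
  measurable_fun setT f -> measurable_fun setT (fun x => enorm (f x)).
Proof.
move=> mf; apply: (measurableT_comp (continuous_measurable_fun (@sqrt_continuous R))).
apply: measurable_sum => i; apply: measurable_funX.
exact: (measurableT_comp (measurable_coord i) mf).
Qed.

End enorm.

Definition euclidean_isometry (R : realType) N (T : 'rV[R]_N -> 'rV[R]_N) :=
  [/\ measure_preserving (lebesgue_rV R N) (lebesgue_rV R N) T,
      forall x y, enorm (T x - T y) = enorm (x - y)
    & forall x, enorm (T x) = enorm x].

Section rotations.
Context (R : realType).

Lemma euclidean_isometry_id N : @euclidean_isometry R N id.
Proof. by split. Qed.

Lemma euclidean_isometry_comp N (T S : 'rV[R]_N -> 'rV[R]_N) :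
  euclidean_isometry T -> euclidean_isometry S -> euclidean_isometry (T \o S).
Proof.
move=> [mT T1 T2] [mS S1 S2]; split.
- exact: measure_preserving_comp mS mT.
- by move=> x y /=; rewrite T1.
- by move=> x /=; rewrite T2.
Qed.

Context (n : nat).
Implicit Types (j : 'I_n) (c s : R).
Local Notation V := 'rV[R]_n.+1.
Local Notation mu := (lebesgue_rV R n.+1).

(* A plane rotation is a product of three shears, and shears preserve Lebesgue
   measure by Fubini's theorem. *)
Definition shear1 j c (x : V) : V :=
  consv ((unconsv x).1 + c * (unconsv x).2 ord0 j, (unconsv x).2).

Definition shear2 j c (x : V) : V :=
  consv ((unconsv x).1, (unconsv x).2 + (c * (unconsv x).1) *: delta_mx ord0 j).

Lemma measure_preserving_conj (f : measurableTypeR R * 'rV[R]_n -> measurableTypeR R * 'rV[R]_n) :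
  measure_preserving (@lebesgue_measure R \x lebesgue_rV R n)%E
    (@lebesgue_measure R \x lebesgue_rV R n)%E f ->
  measure_preserving mu mu (@consv R n \o (f \o @unconsv R n)).
Proof.
move=> mf; apply: measure_preserving_comp (measure_preserving_consv R n).
exact: measure_preserving_comp (measure_preserving_unconsv R n) mf.
Qed.

Lemma measure_preserving_shear1 j c : measure_preserving mu mu (shear1 j c).
Proof.
apply: (measure_preserving_conj
  (f := fun z : measurableTypeR R * 'rV[R]_n => (z.1 + c * z.2 ord0 j, z.2))).
apply: (@measure_preserving_skewl _ _ _ _ R (@lebesgue_measure R)
  (lebesgue_rV R n) (fun y x => x + c * y ord0 j)).
  apply: measurable_funD => //; apply: measurable_funM => //.
  exact: (measurableT_comp (measurable_coord j) measurable_snd).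
by move=> y; exact: measure_preserving_lebesgueD.
Qed.

Lemma measure_preserving_shear2 j c : measure_preserving mu mu (shear2 j c).
Proof.
apply: (measure_preserving_conj
  (f := fun z : measurableTypeR R * 'rV[R]_n =>
     (z.1, z.2 + (c * z.1) *: delta_mx ord0 j))).
apply: (@measure_preserving_skewr _ _ _ _ R (@lebesgue_measure R)
  (lebesgue_rV R n) (fun x y => y + (c * x) *: delta_mx ord0 j)).
  apply: measurable_rVD => //; apply: measurable_fun_coord => i.
  under eq_fun do rewrite !mxE.
  by apply: measurable_funM => //; apply: measurable_funM.
by move=> y; exact: measure_preserving_rVD.
Qed.

Definition rot j c s (x : V) : V :=
  consv (c * x ord0 ord0 + s * x ord0 (lift ord0 j),
    \row_i if i == j then - s * x ord0 ord0 + c * x ord0 (lift ord0 j)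
           else x ord0 (lift ord0 i)).

(** For (c, s) = (cos t, sin t) the outer shears have slope (1 - c)/s = tan(t/2); hence the
    restriction to s != 0. *)
Lemma rot_shears j c s : c ^+ 2 + s ^+ 2 = 1 -> s != 0 ->
  rot j c s = shear1 j ((1 - c) / s) \o (shear2 j (- s) \o shear1 j ((1 - c) / s)).
Proof.
move=> cs s0; apply/funext => x /=; rewrite /shear1 /shear2 !consvK /=.
have e : s ^+ 2 = 1 - c ^+ 2 by rewrite -cs; ring.
congr consv; congr pair.
  rewrite !mxE !eqxx/= mulr1n mulr1.
  have -> : s * x ord0 (lift ord0 j) = s ^+ 2 / s * x ord0 (lift ord0 j).
    by field.
  by rewrite e; field.
apply/rowP => i; rewrite !mxE eqxx/=; case: eqP => [->|_].
  by rewrite mulr1n mulr1; field.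
by rewrite mulr0n mulr0 addr0.
Qed.

Lemma enorm_rot j c s x : c ^+ 2 + s ^+ 2 = 1 -> enorm (rot j c s x) = enorm x.
Proof.
move=> cs; apply/eqP; rewrite -(@eqrXn2 _ 2)// ?enorm_ge0//; apply/eqP.
rewrite enorm_consv/= [in RHS](consv_unconsv x) enorm_consv/= !sqr_enorm.
rewrite (bigD1 j)//= [in RHS](bigD1 j)//= !mxE eqxx !addrA; congr (_ + _).
  set a := x ord0 ord0; set b := x ord0 _.
  transitivity ((c ^+ 2 + s ^+ 2) * (a ^+ 2 + b ^+ 2)); first by ring.
  by rewrite cs mul1r.
by apply: eq_bigr => i /negbTE ij; rewrite !mxE ij.
Qed.

Lemma rotB j c s x y : rot j c s x - rot j c s y = rot j c s (x - y).
Proof.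
apply/rowP => i; rewrite /rot [LHS]mxE [X in _ + X]mxE.
have [k|] := unliftP ord0 i => ->.
  by rewrite !consvS !mxE; case: ifP => _ //; ring.
by rewrite !consv0 !mxE /=; ring.
Qed.

Lemma euclidean_isometry_rot j c s : c ^+ 2 + s ^+ 2 = 1 -> s != 0 ->
  euclidean_isometry (rot j c s).
Proof.
move=> cs s0; split.
- rewrite rot_shears//; apply: measure_preserving_comp (measure_preserving_shear1 _ _).
  exact: measure_preserving_comp (measure_preserving_shear1 _ _)
    (measure_preserving_shear2 _ _).
- by move=> x y; rewrite rotB enorm_rot.
- by move=> x; exact: enorm_rot.
Qed.

(** One plane rotation per coordinate. The rotation that kills coordinate [j] changes only the first
    coordinate and that one, so zeros already obtained persist. *)
Lemma isometry_vanish (js : seq 'I_n) (x : V) :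
  exists2 T, euclidean_isometry T & forall j, j \in js -> T x ord0 (lift ord0 j) = 0.
Proof.
elim: js => [|j js [T isoT Tx]]; first by exists id => //; exact: euclidean_isometry_id.
set y := T x in Tx; have [yj|yj] := eqVneq (y ord0 (lift ord0 j)) 0.
  by exists T => // k; rewrite inE => /predU1P[->//|]; exact: Tx.
set a := y ord0 ord0; set b := y ord0 (lift ord0 j) in yj.
pose r := Num.sqrt (a ^+ 2 + b ^+ 2).
have ab0 : 0 < a ^+ 2 + b ^+ 2.
  by rewrite ltr_wpDl ?sqr_ge0// exprn_even_gt0.
have r0 : r != 0 by rewrite gt_eqF// sqrtr_gt0.
have r2 : r ^+ 2 = a ^+ 2 + b ^+ 2 by rewrite sqr_sqrtr// ltW.
have cs : (a / r) ^+ 2 + (b / r) ^+ 2 = 1.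
  by rewrite !expr_div_n -mulrDl -r2 divff// expf_neq0.
exists (rot j (a / r) (b / r) \o T).
  apply: euclidean_isometry_comp => //; apply: euclidean_isometry_rot => //.
  by rewrite mulf_neq0// invr_eq0.
move=> k; rewrite inE /= -/y /rot consvS mxE; case: eqP => [_ _|_ /= kjs].
  by rewrite -/a -/b; field.
exact: Tx.
Qed.

Lemma isometry_axis (x : V) : (0 < n)%N ->
  exists2 T, euclidean_isometry T & T x = consv (enorm x, 0).
Proof.
move=> n0; have [T isoT Tx] := isometry_vanish (enum 'I_n) x.
have Tx0 : T x = consv ((T x) ord0 ord0, 0).
  rewrite {1}[T x]consv_unconsv; congr consv; congr pair.
  by apply/rowP => i; rewrite !mxE Tx// mem_enum.
have : (T x) ord0 ord0 ^+ 2 = enorm x ^+ 2.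
  have [_ _ <-] := isoT; rewrite [in RHS]Tx0 enorm_consv/= sqr_enorm.
  by rewrite big1 ?addr0// => i _; rewrite mxE expr0n.
move/eqP; rewrite eqf_sqr => /orP[/eqP <-|/eqP e]; first by exists T.
(* If the surviving coordinate is -|x|, a half turn corrects the sign. It is made of two quarter
   turns because [euclidean_isometry_rot] excludes s = 0. *)
have isoR : euclidean_isometry (rot (Ordinal n0) 0 1).
  by apply: euclidean_isometry_rot; rewrite ?oner_neq0// expr0n expr1n add0r.
exists (rot (Ordinal n0) 0 1 \o (rot (Ordinal n0) 0 1 \o T)).
  by do 2 apply: euclidean_isometry_comp => //.
rewrite /= Tx0 e /rot !consv0 !consvS !mxE eqxx; congr consv; congr pair.
  by rewrite /=; ring.
apply/rowP => i; rewrite [LHS]mxE [RHS]mxE; case: (i =P _) => [_ /=|]; first by ring.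
by move=> /eqP/negbTE i0; rewrite consvS /= mxE i0 consvS mxE.
Qed.

End rotations.

(** Both points are carried to the same point of the first axis. The codomain is arbitrary so that
    [h] can be a mass in the extended reals or a whole sequence of averages. *)
Lemma isometry_invariant_radial (R : realType) N (A : Type) (h : 'rV[R]_N -> A) :
  (2 <= N)%N ->
  (forall T, euclidean_isometry T -> forall x, h (T x) = h x) ->
  forall x y, enorm x = enorm y -> h x = h y.
Proof.
case: N h => [//|n] h n0 hT x y xy.
have [S iS Sx] := isometry_axis x n0; have [T iT Ty] := isometry_axis y n0.
by rewrite -(hT S iS x) -(hT T iT y) Sx Ty xy.
Qed.

(** * Dyadic cubes *)

Section boxes.
Context (R : realType) (N : nat).
Local Notation V := 'rV[R]_N.
Local Notation mu := (lebesgue_rV R N).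

Lemma measurable_box (A : 'I_N -> set (measurableTypeR R)) :
  (forall i, measurable (A i)) ->
  measurable [set x : V | forall i, A i (x ord0 i)].
Proof.
move=> mA; rewrite [X in measurable X](_ : _ = \bigcap_(i in [set: 'I_N])
    ((fun x : V => x ord0 i) @^-1` A i)); last first.
  by apply/seteqP; split => x /= h i => [_|]; exact: h.
apply: fin_bigcap_measurable => // i _.
rewrite -[X in measurable X]setTI.
exact: (@measurable_coord R N i measurableT _ (mA i)).
Qed.

Definition cube (x : V) (r : R) : set V :=
  [set y | forall i, `|y ord0 i - x ord0 i| < r].

Lemma cubeE x r : cube x r =
  [set y | forall i, `]x ord0 i - r, x ord0 i + r[%classic (y ord0 i)].
Proof.
by apply/seteqP; split => y h i; have := h i; rewrite /= in_itv/= ltr_distl.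
Qed.

Lemma measurable_cube x r : measurable (cube x r).
Proof. rewrite cubeE; apply: (@measurable_box (fun i => `]x ord0 i - r, x ord0 i + r[%classic)) => i.
exact: measurable_itv. Qed.

Lemma lebesgue_rV_cube x r : 0 <= r -> mu (cube x r) = ((2 * r) ^+ N)%:E.
Proof.
move=> r0; rewrite cubeE (@lebesgue_rV_box R N (fun i => `]x ord0 i - r, x ord0 i + r[%classic));
  last by move=> i; exact: measurable_itv.
rewrite (eq_bigr (fun=> (2 * r)%:E)) => [|i _].
  by rewrite prodEFin prodr_const card_ord.
rewrite lebesgue_measure_itv/= lte_fin; case: ltP => [_|h].
  by rewrite -EFinB; congr EFin; ring.
by congr EFin; lra.
Qed.

Lemma lebesgue_rV_set1 x : (0 < N)%N -> mu [set x] = 0%E.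
Proof.
move=> N0; have -> : [set x] = [set y : V | forall i, [set x ord0 i] (y ord0 i)].
  apply/seteqP; split => [y -> //|y h]; apply/rowP => i; exact: h.
rewrite (@lebesgue_rV_box R N (fun i => [set x ord0 i]));
  last by move=> i; exact: measurable_set1.
by rewrite (bigD1 (Ordinal N0))//= lebesgue_measure_set1 mul0e.
Qed.

Lemma measurable_rV_set1 (x : V) : measurable [set x].
Proof.
have -> : [set x] = [set y : V | forall i, [set x ord0 i] (y ord0 i)].
  apply/seteqP; split => [y -> //|y h]; apply/rowP => i; exact: h.
by apply: (@measurable_box (fun i => [set x ord0 i])) => i; exact: measurable_set1.
Qed.

Definition dindex (j : nat) (x : V) : 'rV[int]_N :=
  \row_i Num.floor (2 ^+ j * x ord0 i).

(** Half-open dyadic cube of side 2^(-j). As a fibre of [dindex], it comes with the partition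
    property built in. *)
Definition dcube (j : nat) (z : 'rV[int]_N) : set V := [set x | dindex j x = z].

Lemma dcubeE j z : dcube j z = [set x | forall i,
  `[(z ord0 i)%:~R / 2 ^+ j, ((z ord0 i) + 1)%:~R / 2 ^+ j[%classic (x ord0 i)].
Proof.
have p2 : 0 < 2 ^+ j :> R by rewrite exprn_gt0.
apply/seteqP; split => x; rewrite /dcube /=.
  move=> <- i; rewrite in_itv/= mxE ler_pdivrMr// ltr_pdivlMr//.
  by rewrite mulrC floor_itv.
move=> h; apply/rowP => i; rewrite mxE; apply: floor_def; have := h i.
by rewrite in_itv/= ler_pdivrMr// ltr_pdivlMr// mulrC.
Qed.

Lemma measurable_dcube j z : measurable (dcube j z).
Proof. rewrite dcubeE; apply: (@measurable_box (fun i => `[(z ord0 i)%:~R / 2 ^+ j,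
  (z ord0 i + 1)%:~R / 2 ^+ j[%classic)) => i.
exact: measurable_itv. Qed.

Lemma lebesgue_rV_dcube j z : mu (dcube j z) = ((2 ^+ j)^-1 ^+ N)%:E.
Proof.
have p2 : 0 < 2 ^+ j :> R by rewrite exprn_gt0.
rewrite dcubeE (@lebesgue_rV_box R N (fun i => `[(z ord0 i)%:~R / 2 ^+ j,
  (z ord0 i + 1)%:~R / 2 ^+ j[%classic)); last by move=> i; exact: measurable_itv.
rewrite (eq_bigr (fun=> (2 ^+ j)^-1%:E)) => [|i _].
  by rewrite prodEFin prodr_const card_ord.
rewrite lebesgue_measure_itv/= lte_fin ltr_pM2r ?invr_gt0// ltr_int.
rewrite ltrDl ltr01 -EFinB; congr EFin.
by rewrite -mulrBl intrD addrAC subrr add0r mul1r.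
Qed.

Lemma dindex_dist j x y : dindex j x = dindex j y ->
  forall i, `|x ord0 i - y ord0 i| <= (2 ^+ j)^-1.
Proof.
have p2 : 0 < 2 ^+ j :> R by rewrite exprn_gt0.
move=> /rowP xy i; have := xy i; rewrite !mxE => e.
have /andP[h1 h2] := floor_itv (2 ^+ j * x ord0 i).
have /andP[h3 h4] := floor_itv (2 ^+ j * y ord0 i).
rewrite e in h1 h2; rewrite -(ler_pM2l p2) mulfV ?gt_eqF//.
rewrite -[X in X * _](gtr0_norm p2) -normrM mulrBr ler_norml.
rewrite intrD in h2 h4.
by apply/andP; split; lra.
Qed.

Lemma dindex_enorm j x y : dindex j x = dindex j y ->
  enorm (x - y) <= Num.sqrt N%:R / 2 ^+ j.
Proof.
move=> xy; apply: enorm_le => [|i]; first by rewrite invr_ge0 exprn_ge0.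
by rewrite !mxE; exact: dindex_dist.
Qed.

(** Nesting of the cubes: an integer k lies below 2^j a exactly when 2k lies below 2^(j+1) a, so the
    finer floor determines the coarser one. *)
Lemma dindexS j x y : dindex j.+1 x = dindex j.+1 y -> dindex j x = dindex j y.
Proof.
move=> /rowP xy; apply/rowP => i; have := xy i; rewrite !mxE => e.
have key (k : int) (a : R) :
    (k <= Num.floor (2 ^+ j * a)) = (2 * k <= Num.floor (2 ^+ j.+1 * a)).
  by rewrite !floor_ge_int intrM exprS -mulrA ler_pM2l.
by apply/eqP; rewrite eq_le key -e -key lexx /= key e -key lexx.
Qed.

Lemma measurable_dindex d (T : measurableType d) j (h : 'rV[int]_N -> T) :
  measurable_fun setT (fun x : V => h (dindex j x)).
Proof.
move=> _ Y mY; rewrite setTI.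
have -> : (fun x : V => h (dindex j x)) @^-1` Y =
    \bigcup_(z : 'rV[int]_N) (if `[< Y (h z) >] then dcube j z else set0).
  apply/seteqP; split => [x Yx|x [z _]].
    by exists (dindex j x) => //; rewrite asboolT.
  by case: asboolP => // Yz; rewrite /dcube /= => ->.
apply: countable_bigcupT_measurable => [|z]; first exact: countableP.
by case: asboolP => _; [exact: measurable_dcube|exact: measurable0].
Qed.

End boxes.

(** * Integration *)

Section integration.
Context d (T : measurableType d) (R : realType) (mu : {measure set T -> \bar R}).
Implicit Types (f g u : T -> R).

Lemma le_intR f g : measurable_fun setT f -> measurable_fun setT g ->
  (forall x, 0 <= f x) -> (forall x, f x <= g x) ->
  (\int[mu]_x (f x)%:E <= \int[mu]_x (g x)%:E)%E.
Proof.
move=> mf mg f0 fg; apply: ge0_le_integral => //.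
- by move=> x _; rewrite lee_fin.
- exact/measurable_EFinP.
- exact/measurable_EFinP.
- by move=> x _; rewrite lee_fin.
Qed.

Lemma ge0_intRD f g : measurable_fun setT f -> measurable_fun setT g ->
  (forall x, 0 <= f x) -> (forall x, 0 <= g x) ->
  (\int[mu]_x (f x + g x)%:E = \int[mu]_x (f x)%:E + \int[mu]_x (g x)%:E)%E.
Proof.
move=> mf mg f0 g0; under eq_integral do rewrite EFinD.
rewrite ge0_integralD//.
- by move=> x _; rewrite lee_fin.
- exact/measurable_EFinP.
- by move=> x _; rewrite lee_fin.
- exact/measurable_EFinP.
Qed.

Lemma ge0_intRZ (k : R) f : measurable_fun setT f -> (forall x, 0 <= f x) ->
  0 <= k -> (\int[mu]_x (k * f x)%:E = k%:E * \int[mu]_x (f x)%:E)%E.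
Proof.
move=> mf f0 k0; under eq_integral do rewrite EFinM.
rewrite ge0_integralZl//; first exact/measurable_EFinP.
by move=> x _; rewrite lee_fin.
Qed.

Lemma integrable_cst_fin (E : set T) (k : R) : measurable E -> (mu E < +oo)%E ->
  mu.-integrable E (EFin \o cst k).
Proof.
move=> mE muE; apply: measurable_bounded_integrable => //.
by exists `|k|; split; [exact: num_real|move=> y ky x _ /=; exact: ltW].
Qed.

Lemma integrable_sq u (E : set T) : measurable_fun setT u ->
  (\int[mu]_x (u x ^+ 2)%:E < +oo)%E -> measurable E -> (mu E < +oo)%E ->
  mu.-integrable E (EFin \o u).
Proof.
move=> mu_ u2 mE muE.
have mu2 : measurable_fun setT (fun x => u x ^+ 2) by exact: measurable_funX.
have i1 : mu.-integrable E (EFin \o (fun x => 1 + u x ^+ 2)).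
  have -> : EFin \o (fun x => 1 + u x ^+ 2) =
      (fun x => (EFin \o cst 1%R) x + (EFin \o (fun x => (u x ^+ 2)%R)) x)%E by [].
  apply: integrableD => //; first exact: integrable_cst_fin.
  apply: (integrableS measurableT) => //; apply/integrableP; split.
    exact/measurable_EFinP.
  by under eq_integral do rewrite gee0_abs ?lee_fin ?sqr_ge0//.
apply: le_integrable i1 => //.
  by apply/measurable_EFinP; exact: measurable_funTS.
move=> x _ /=; rewrite lee_fin [leRHS]ger0_norm ?addr_ge0 ?sqr_ge0//.
by rewrite -[u x ^+ 2]real_normK ?num_real//; have := sqr_ge0 (`|u x| - 1); nra.
Qed.

Definition avg (E : set T) u : R :=
  fine (\int[mu]_(y in E) (u y)%:E) / fine (mu E).

Lemma integrable_intE u (E : set T) : measurable E -> mu.-integrable E (EFin \o u) ->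
  (\int[mu]_(y in E) (u y)%:E = (fine (\int[mu]_(y in E) (u y)%:E))%:E)%E.
Proof. by move=> mE iu; rewrite fineK//; exact: integrable_fin_num. Qed.

(** Jensen for the square, by integrating the tangent line of t^2 at b = a - avg: 2b(a - u) - b^2 <=
    (a - u)^2. *)
Lemma avg_sq_le u (E : set T) (a m : R) : measurable_fun setT u ->
  measurable E -> mu E = m%:E -> 0 < m -> mu.-integrable E (EFin \o u) ->
  (((a - avg E u) ^+ 2 * m)%:E <= \int[mu]_(y in E) ((a - u y) ^+ 2)%:E)%E.
Proof.
move=> mu_ mE muE m0 iu.
have mg : measurable_fun setT (fun y => (a - u y) ^+ 2).
  by apply: measurable_funX; exact: measurable_funB.
have [->|fin] := eqVneq (\int[mu]_(y in E) ((a - u y) ^+ 2)%:E)%E +oo%E.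
  by rewrite leey.
have ig : mu.-integrable E (EFin \o (fun y => (a - u y) ^+ 2)).
  apply/integrableP; split; first by apply/measurable_EFinP; exact: measurable_funTS.
  under eq_integral do rewrite gee0_abs ?lee_fin ?sqr_ge0//.
  by rewrite ltey.
set b := a - avg E u.
have ia : mu.-integrable E (EFin \o cst (2 * b * a - b ^+ 2)).
  by apply: integrable_cst_fin => //; rewrite muE ltry.
have iu2 : mu.-integrable E (fun y => (2 * b)%:E * (EFin \o u) y)%E.
  exact: integrableZl.
have -> : ((b ^+ 2 * m)%:E =
    \int[mu]_(y in E) ((EFin \o cst (2 * b * a - b ^+ 2)%R) y - (2 * b)%:E * (EFin \o u) y))%E.
  rewrite integralB// integralZl// (integrable_intE mE iu).
  have -> : (\int[mu]_(y in E) (EFin \o cst (2 * b * a - b ^+ 2)%R) y =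
      ((2 * b * a - b ^+ 2) * m)%:E)%E.
    by rewrite EFinM -muE -integral_cst.
  rewrite -!EFinM -EFinB; congr EFin; rewrite /b /avg muE /=.
  by field; rewrite gt_eqF.
apply: le_integral => //; first exact: integrableB.
move=> y _; change ((2 * b * a - b ^+ 2 - 2 * b * u y)%:E <= ((a - u y) ^+ 2)%:E)%E.
rewrite lee_fin.
by have := sqr_ge0 (a - u y - b); nra.
Qed.

Lemma fatou_cvg (g_ : nat -> T -> R) g :
  (forall n, measurable_fun setT (g_ n)) -> measurable_fun setT g ->
  (forall n x, 0 <= g_ n x) -> (forall x, 0 <= g x) ->
  {ae mu, forall x, g_ ^~ x @ \oo --> g x} ->
  (\int[mu]_x (g x)%:E <= limn_einf (fun n => \int[mu]_x (g_ n x)%:E))%E.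
Proof.
move=> mg_ mg g_0 g0 cvg_g.
have mE n : measurable_fun setT (EFin \o g_ n) by exact/measurable_EFinP.
have mli : measurable_fun setT (fun x => limn_einf (fun n => (g_ n x)%:E)).
  have -> : (fun x => limn_einf (fun n => (g_ n x)%:E)) =
      (fun x => - limn_esup (fun n => - (g_ n x)%:E))%E.
    apply/funext => x; rewrite -limn_einfN; congr limn_einf.
    by apply/funext => n; rewrite /comp oppeK.
  apply: measurableT_comp => //.
  apply: (@measurable_fun_limn_esup _ _ _ setT (fun n x => - (g_ n x)%:E)%E) => n.
  exact: (measurableT_comp (@oppe_measurable R setT) (mE n)).
have li0 x : (0 <= limn_einf (fun n => (g_ n x)%:E))%E.
  rewrite limn_einf_lim; apply: lime_ge; first exact: is_cvg_einfs.
  by apply: nearW => n; apply: le_ereal_inf_tmp => _ [k _ <-]; rewrite lee_fin.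
have -> : (\int[mu]_x (g x)%:E = \int[mu]_x limn_einf (fun n => (g_ n x)%:E))%E.
  apply: ge0_ae_eq_integral => //.
  - exact/measurable_EFinP.
  - by move=> x _; rewrite lee_fin.
  - apply: filterS cvg_g => x gx _.
    have h : (fun n => (g_ n x)%:E) @ \oo --> (g x)%:E.
      by apply: cvg_EFin; [exact: nearW|exact: gx].
    by rewrite is_cvg_limn_einfE; [exact/esym/cvg_lim|exact: (cvgP _ h)].
by apply: (fatou mu measurableT mE _) => n x _; rewrite lee_fin.
Qed.

Lemma fatou_le (g_ : nat -> T -> R) g (c : \bar R) :
  (forall n, measurable_fun setT (g_ n)) -> measurable_fun setT g ->
  (forall n x, 0 <= g_ n x) -> (forall x, 0 <= g x) ->
  {ae mu, forall x, g_ ^~ x @ \oo --> g x} ->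
  (\forall n \near \oo, \int[mu]_x (g_ n x)%:E <= c)%E ->
  (\int[mu]_x (g x)%:E <= c)%E.
Proof.
move=> mg_ mg g_0 g0 cvg_g [K _ le_c].
apply: (le_trans (fatou_cvg mg_ mg g_0 g0 cvg_g)).
rewrite limn_einf_lim; apply: lime_le; first exact: is_cvg_einfs.
apply: nearW => n; apply: le_trans (le_c (maxn K n) (leq_maxl _ _)).
by apply: ereal_inf_lbound; exists (maxn K n) => //=; exact: leq_maxr.
Qed.

(** Applied both to functions and to their difference quotients, so that the two halves of Q expand
    by one computation. The product is integrable because |fg| <= f^2 + g^2. *)
Lemma sq_expand f g (t : R) : measurable_fun setT f -> measurable_fun setT g ->
  (\int[mu]_x (f x ^+ 2)%:E < +oo)%E -> (\int[mu]_x (g x ^+ 2)%:E < +oo)%E ->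
  mu.-integrable setT (EFin \o (fun x => f x * g x)) /\
  (\int[mu]_x ((f x + t * g x) ^+ 2)%:E =
    \int[mu]_x (f x ^+ 2)%:E + (2 * t)%:E * \int[mu]_x (f x * g x)%:E +
    (t ^+ 2)%:E * \int[mu]_x (g x ^+ 2)%:E)%E.
Proof.
move=> mf mg f2 g2.
have sqi (h : T -> R) : measurable_fun setT h -> (\int[mu]_x (h x ^+ 2)%:E < +oo)%E ->
    mu.-integrable setT (EFin \o (fun x => h x ^+ 2)).
  move=> mh h2; apply/integrableP; split.
    by apply/measurable_EFinP; exact: measurable_funX.
  by under eq_integral do rewrite gee0_abs ?lee_fin ?sqr_ge0//.
have if2 := sqi _ mf f2; have ig2 := sqi _ mg g2.
have ifg : mu.-integrable setT (EFin \o (fun x => f x * g x)).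
  apply: (@le_integrable _ _ _ mu setT measurableT _
    (fun x => (EFin \o (fun x => (f x ^+ 2)%R)) x + (EFin \o (fun x => (g x ^+ 2)%R)) x)%E).
  - by apply/measurable_EFinP; exact: measurable_funM.
  - move=> x _ /=; rewrite lee_fin [leRHS]ger0_norm ?addr_ge0 ?sqr_ge0//.
    by rewrite ler_norml; apply/andP; split;
      have := sqr_ge0 (f x - g x); have := sqr_ge0 (f x + g x);
      have := sqr_ge0 (f x); have := sqr_ge0 (g x); nra.
  - exact: integrableD.
split=> //.
have i1 : mu.-integrable setT (fun x => (2 * t)%:E * (EFin \o (fun x => (f x * g x)%R)) x)%E.
  exact: integrableZl.
have i2 : mu.-integrable setT (fun x => (t ^+ 2)%:E * (EFin \o (fun x => (g x ^+ 2)%R)) x)%E.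
  exact: integrableZl.
transitivity (\int[mu]_x (((f x ^+ 2)%:E + (2 * t)%:E * (f x * g x)%:E) +
    (t ^+ 2)%:E * (g x ^+ 2)%:E))%E.
  by apply: eq_integral => x _; rewrite -!EFinM -!EFinD; congr EFin; ring.
rewrite integralD//; last exact: integrableD.
rewrite integralD//; congr (_ + _ + _)%E.
- exact: (integralZl measurableT ifg).
- exact: (integralZl measurableT ig2).
Qed.

End integration.

(** * Almost everywhere limits of Cauchy sequences in L^q *)

Section Lq_completeness.
Context d (T : measurableType d) (R : realType) (mu : {measure set T -> \bar R}).

Lemma geometric_increments_cvg (a : nat -> R) (b : R) :
  (forall n, `|a n.+1 - a n| <= b / 2 ^+ n) -> cvgn a.
Proof.
move=> ab; have b0 : 0 <= b.
  by have := le_trans (normr_ge0 _) (ab 0%N); rewrite expr0 divr1.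
have -> : a = (fun n => a 0%N + series (telescope a) n).
  by apply/funext => n; rewrite -eq_sum_telescope.
apply: is_cvgD; first exact: is_cvg_cst.
apply: normed_cvg; apply: (@series_le_cvg _ _ (geometric b (2^-1))) => //.
- by move=> n /=.
- by move=> n; rewrite /geometric /= mulr_ge0 ?exprn_ge0 ?invr_ge0.
- by move=> n; rewrite /= /telescope exprVn; exact: ab.
- by apply: is_cvg_geometric_series; rewrite ger0_norm ?invr_ge0// invf_lt1// ltr1n.
Qed.

(** Weight the q-th power of the n-th increment by 2^(qn): the hypothesis makes the sum [g]
    integrable, hence finite almost everywhere, and there the n-th increment is at most g^(1/q)
    2^(-n). No triangle inequality in L^q enters, so every q > 0 is allowed. *)
Lemma fast_Lq_cauchy_ae_cvg (q : R) (f_ : nat -> T -> R) : 0 < q ->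
  (forall n, measurable_fun setT (f_ n)) ->
  (forall n, \int[mu]_x (`|f_ n.+1 x - f_ n x| `^ q)%:E <=
     ((2 `^ q) ^- n / (2 ^ n.+1)%:R)%:E)%E ->
  exists2 f : T -> R, measurable_fun setT f & {ae mu, forall x, f_ ^~ x @ \oo --> f x}.
Proof.
move=> q0 mf_ df_; pose r : R := 2 `^ q.
have r0 : 0 < r by rewrite powR_gt0.
pose t n x := r ^+ n * `|f_ n.+1 x - f_ n x| `^ q.
have mt n : measurable_fun setT (t n).
  apply: measurable_funM => //; apply: (measurableT_comp (measurable_powR _)).
  by apply: measurableT_comp => //; exact: measurable_funB.
have t0 n x : 0 <= t n x by rewrite mulr_ge0 ?powR_ge0// exprn_ge0// ltW.
pose g x := (\sum_(n <oo) (t n x)%:E)%E.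
have g0 x : (0 <= g x)%E by apply: nneseries_ge0 => n _ _; rewrite lee_fin.
have mg : measurable_fun setT g.
  apply: ge0_emeasurable_sum => [n x _ _|n _]; first by rewrite lee_fin.
  exact/measurable_EFinP.
have ig : mu.-integrable setT g.
  apply/integrableP; split => //.
  under eq_integral do rewrite gee0_abs//.
  rewrite /g integral_nneseries//; last 2 first.
  - by move=> n; exact/measurable_EFinP.
  - by move=> n x _; rewrite lee_fin.
  apply: (@le_lt_trans _ _ (\sum_(n <oo) (1 / (2 ^ n.+1)%:R)%:E)%E); last first.
    by apply: (le_lt_trans (epsilon_trick0 xpredT ler01)); rewrite ltry.
  apply: lee_nneseries => [n _ _|n _]; first by apply: integral_ge0 => x _; rewrite lee_fin.
  rewrite /t ge0_intRZ//; last 2 first.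
  - apply: (measurableT_comp (measurable_powR _)).
    by apply: measurableT_comp => //; exact: measurable_funB.
  - by rewrite exprn_ge0// ltW.
  apply: (@le_trans _ _ ((r ^+ n)%:E * (r ^- n / (2 ^ n.+1)%:R)%:E)%E).
    by apply: lee_wpmul2l; rewrite ?lee_fin ?exprn_ge0// ltW.
  by rewrite -EFinM lee_fin mulrA mulfV// gt_eqF// exprn_gt0.
have aecvg : {ae mu, forall x, cvgn (f_ ^~ x)}.
  apply: filterS (integrable_ae measurableT ig) => x /(_ I) gx.
  apply: (@geometric_increments_cvg _ ((fine (g x)) `^ q^-1)) => n.
  have tB : t n x <= fine (g x).
    rewrite -lee_fin fineK//.
    have := @nneseries_lim_ge R (fun n => (t n x)%:E) xpredT 0 n.+1.
    move=> /(_ (fun n _ _ => t0 n x)); apply: le_trans.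
    rewrite big_mkord big_ord_recr/= leeDr// sume_ge0// => i _.
    by rewrite lee_fin.
  rewrite ler_pdivlMr ?exprn_gt0//.
  have -> : `|f_ n.+1 x - f_ n x| * 2 ^+ n = (t n x) `^ q^-1.
    rewrite /t powRM ?exprn_ge0 ?(ltW r0)// ?powR_ge0//.
    rewrite -powRrM mulfV ?gt_eqF// powRr1// mulrC; congr (_ * _).
    rewrite -[r ^+ n]powR_mulrn ?(ltW r0)// /r -!powRrM mulrCA mulfV ?gt_eqF//.
    by rewrite mulr1 powR_mulrn.
  by apply: ge0_ler_powR; rewrite ?nnegrE ?invr_ge0 ?(ltW q0)// (le_trans (t0 n x)).
(* The upper limit is measurable without restriction; where it is infinite, on a null set, [fine]
   supplies a value. *)
pose f x := fine (limn_esup (fun n => (f_ n x)%:E)).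
exists f.
  apply: measurableT_comp => //.
  apply: (@measurable_fun_limn_esup _ _ _ setT (fun n x => (f_ n x)%:E)) => n.
  exact/measurable_EFinP.
apply: filterS aecvg => x cx.
have h : (fun n => (f_ n x)%:E) @ \oo --> (limn (f_ ^~ x))%:E.
  by apply: cvg_EFin; [exact: nearW|exact: cx].
rewrite /f is_cvg_limn_esupE ?(cvg_lim _ h)//; exact: (cvgP _ h).
Qed.

Lemma Lq_cauchy_ae_subseq (q : R) (f_ : nat -> T -> R) : 0 < q ->
  (forall n, measurable_fun setT (f_ n)) ->
  (forall e : R, 0 < e -> exists K, forall n m, (K <= n)%N -> (K <= m)%N ->
     (\int[mu]_x (`|f_ n x - f_ m x| `^ q)%:E <= e%:E)%E) ->
  exists (phi : nat -> nat) (f : T -> R), [/\ forall k, (k <= phi k)%N,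
    measurable_fun setT f & {ae mu, forall x, (fun k => f_ (phi k) x) @ \oo --> f x}].
Proof.
move=> q0 mf_ cauchy.
have e0 n : 0 < (2 `^ q) ^- n / (2 ^ n.+1)%:R :> R.
  by rewrite divr_gt0// invr_gt0 exprn_gt0// powR_gt0.
have [K KP] := choice (fun n => cauchy _ (e0 n)).
(* The partial sum makes [phi] nondecreasing and at least [K n], so consecutive terms meet the n-th
   tolerance; the summand [n] gives n <= phi n. *)
pose phi n := (\sum_(i < n.+1) K i + n)%N.
have Kphi n : (K n <= phi n)%N.
  by rewrite /phi big_ord_recr/= -addnA addnCA leq_addr.
have phiS n : (phi n <= phi n.+1)%N.
  by rewrite /phi [X in (_ <= X + _)%N]big_ord_recr/= leq_add// leq_addr.
have [f mf cf] := fast_Lq_cauchy_ae_cvg q0 (fun n => mf_ (phi n))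
  (fun n => KP n _ _ (leq_trans (Kphi n) (phiS n)) (Kphi n)).
by exists phi, f; split => // k; exact: leq_addl.
Qed.

End Lq_completeness.

(** * The Gagliardo energy *)

Section gagliardo.
Context (R : realType) (N : nat) (s : R).
Local Notation V := 'rV[R]_N.
Local Notation mu := (lebesgue_rV R N).
Local Notation alpha := (N%:R + 2 * s).
Implicit Types (u : V -> R).

Definition gag u (x y : V) : R := (u x - u y) ^+ 2 / enorm (x - y) `^ alpha.

(** The squared fractional derivative D(x); it may be infinite on a null set even for [u] in H^s. *)
Definition gagx u (x : V) : \bar R := (\int[mu]_y (gag u x y)%:E)%E.

Definition energy u : \bar R := (\int[(mu \x mu)%E]_z (gag u z.1 z.2)%:E)%E.

Definition sqn u : \bar R := (\int[mu]_x (u x ^+ 2)%:E)%E.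

Definition hs2 u : \bar R := (energy u + sqn u)%E.

Lemma gag_ge0 u x y : 0 <= gag u x y.
Proof. by rewrite divr_ge0 ?sqr_ge0 ?powR_ge0. Qed.

Lemma measurable_enorm_powR d (T : measurableType d) (a : R) (f g : T -> V) :
  measurable_fun setT f -> measurable_fun setT g ->
  measurable_fun setT (fun x => (enorm (f x - g x) `^ a)^-1).
Proof.
move=> mf mg; under eq_fun do rewrite -powRN.
apply: (measurableT_comp (measurable_powR _)).
by apply: measurable_enorm; exact: measurable_rVB.
Qed.

Lemma measurable_gag u : measurable_fun setT u ->
  measurable_fun setT (fun z : V * V => gag u z.1 z.2).
Proof.
move=> m_u; apply: measurable_funM.
  apply: measurable_funX; apply: measurable_funB.
    exact: (measurableT_comp m_u measurable_fst).
  exact: (measurableT_comp m_u measurable_snd).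
by apply: measurable_enorm_powR; [exact: measurable_fst|exact: measurable_snd].
Qed.

Lemma measurable_gag2 u x : measurable_fun setT u ->
  measurable_fun setT (fun y : V => gag u x y).
Proof.
move=> m_u; apply: measurable_funM; last exact: measurable_enorm_powR.
by apply: measurable_funX; exact: measurable_funB.
Qed.

Lemma energyE u : measurable_fun setT u ->
  energy u = (\int[mu]_x gagx u x)%E.
Proof.
move=> m_u; rewrite /energy fubini_tonelli1//.
  by apply/measurable_EFinP; exact: measurable_gag.
by move=> z; rewrite lee_fin gag_ge0.
Qed.

Lemma measurable_gagx u : measurable_fun setT u -> measurable_fun setT (gagx u).
Proof.
move=> m_u.
apply: (@measurable_fun_fubini_tonelli_F _ _ V V R mu (fun z => (gag u z.1 z.2)%:E)).
  by apply/measurable_EFinP; exact: measurable_gag.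
by move=> z; rewrite lee_fin gag_ge0.
Qed.

Lemma gagx_ge0 u x : (0 <= gagx u x)%E.
Proof. by apply: integral_ge0 => y _; rewrite lee_fin gag_ge0. Qed.

Lemma energy_ge0 u : (0 <= energy u)%E.
Proof. by apply: integral_ge0 => y _; rewrite lee_fin gag_ge0. Qed.

Lemma sqn_ge0 u : (0 <= sqn u)%E.
Proof. by apply: integral_ge0 => y _; rewrite lee_fin sqr_ge0. Qed.

Lemma hs2_ge0 u : (0 <= hs2 u)%E.
Proof. by rewrite adde_ge0 ?energy_ge0 ?sqn_ge0. Qed.

Context (alpha0 : 0 <= alpha).

Lemma sqrB_le_gag u (d : R) x y : enorm (x - y) <= d ->
  (u x - u y) ^+ 2 <= d `^ alpha * gag u x y.
Proof.
move=> xyd; have [->|xy] := eqVneq x y.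
  by rewrite subrr expr0n mulr_ge0 ?powR_ge0 ?gag_ge0.
have e0 : 0 < enorm (x - y) by rewrite enorm_gt0 ?subr_eq0.
rewrite /gag mulrCA ler_peMr ?sqr_ge0// ler_pdivlMr ?powR_gt0// mul1r.
by apply: ge0_ler_powR; rewrite ?nnegrE ?(ltW e0)// (le_trans (ltW e0)).
Qed.

Lemma integral_sqrB_le_gagx u (d : R) x (E : set V) : measurable_fun setT u ->
  measurable E -> (forall y, E y -> enorm (x - y) <= d) ->
  (\int[mu]_(y in E) ((u x - u y) ^+ 2)%:E <= (d `^ alpha)%:E * gagx u x)%E.
Proof.
move=> m_u mE dE; rewrite /gagx -ge0_intRZ ?powR_ge0//; last 2 first.
- exact: measurable_gag2.
- by move=> y; exact: gag_ge0.
have m1 : measurable_fun setT (fun y => (d `^ alpha * gag u x y)%:E).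
  by apply/measurable_EFinP; apply: measurable_funM => //; exact: measurable_gag2.
apply: (@le_trans _ _ (\int[mu]_(y in E) (d `^ alpha * gag u x y)%:E)%E).
  apply: ge0_le_integral => //.
  - by move=> y _; rewrite lee_fin sqr_ge0.
  - apply/measurable_EFinP; apply: measurable_funTS.
    by apply: measurable_funX; exact: measurable_funB.
  - exact: measurable_funTS.
  - by move=> y Ey; rewrite lee_fin; apply: sqrB_le_gag; exact: dE.
apply: ge0_subset_integral => //.
by move=> y _; rewrite lee_fin mulr_ge0 ?powR_ge0 ?gag_ge0.
Qed.

Lemma sub_avg_le u (d m : R) x (E : set V) : measurable_fun setT u ->
  (sqn u < +oo)%E -> measurable E -> mu E = m%:E -> 0 < m ->
  (forall y, E y -> enorm (x - y) <= d) ->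
  (((u x - avg mu E u) ^+ 2)%:E <= (d `^ alpha / m)%:E * gagx u x)%E.
Proof.
move=> m_u u2 mE muE m0 dE.
have iu : mu.-integrable E (EFin \o u).
  have muEoo : (mu E < +oo)%E by rewrite muE ltry.
  exact: (integrable_sq m_u u2 mE muEoo).
have := le_trans (avg_sq_le (u x) m_u mE muE m0 iu)
  (integral_sqrB_le_gagx m_u mE dE).
rewrite EFinM -lee_pdivlMr// => /le_trans; apply.
by rewrite muleAC -EFinM.
Qed.

(** Jensen on [E'] against the constant avg over [E], then [sub_avg_le] at each point of [E'];
    integrating D turns it into the energy. *)
Lemma avg_sub_avg_le u (d m m' : R) (E E' : set V) : measurable_fun setT u ->
  (sqn u < +oo)%E -> measurable E -> measurable E' ->
  mu E = m%:E -> mu E' = m'%:E -> 0 < m -> 0 < m' ->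
  (forall x y, E' x -> E y -> enorm (x - y) <= d) ->
  (((avg mu E' u - avg mu E u) ^+ 2)%:E <= (d `^ alpha / m / m')%:E * energy u)%E.
Proof.
move=> m_u u2 mE mE' muE muE' m0 m'0 dE; set a := avg mu E u.
have iu : mu.-integrable E' (EFin \o u).
  have muEoo : (mu E' < +oo)%E by rewrite muE' ltry.
  exact: (integrable_sq m_u u2 mE' muEoo).
rewrite -[(_ - a) ^+ 2]sqrrN opprB.
have h := avg_sq_le a m_u mE' muE' m'0 iu.
rewrite EFinM -lee_pdivlMr// in h; apply: (le_trans h).
rewrite [leRHS](_ : _ = ((d `^ alpha / m)%:E * energy u * (m'^-1)%:E)%E); last first.
  by rewrite EFinM muleAC.
apply: lee_wpmul2r; first by rewrite lee_fin invr_ge0 ltW.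
rewrite energyE// -ge0_integralZl ?lee_fin ?divr_ge0 ?powR_ge0 ?(ltW m0)//; last 2 first.
- exact: measurable_gagx.
- by move=> x _; exact: gagx_ge0.
have m1 : measurable_fun setT (fun x => (d `^ alpha / m)%:E * gagx u x)%E.
  by apply: measurable_funeM; exact: measurable_gagx.
apply: (@le_trans _ _ (\int[mu]_(x in E') ((d `^ alpha / m)%:E * gagx u x))%E).
  apply: ge0_le_integral => //.
  - by move=> y _; rewrite lee_fin sqr_ge0.
  - apply/measurable_EFinP; apply: measurable_funTS.
    by apply: measurable_funX; exact: measurable_funB.
  - exact: measurable_funTS.
  - move=> x Ex; rewrite -[(a - u x) ^+ 2]sqrrN opprB; apply: sub_avg_le => //.
    by move=> y; exact: dE.
apply: ge0_subset_integral => //.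
by move=> y _; rewrite mule_ge0 ?gagx_ge0// lee_fin divr_ge0 ?powR_ge0 ?ltW.
Qed.

End gagliardo.

(** * Real powers and interpolation between two scales *)

Section real_lemmas.
Context (R : realType).

Lemma powR_exprn (a x : R) n : 0 <= a -> (a ^+ n) `^ x = (a `^ x) ^+ n.
Proof.
by move=> a0; rewrite -powR_mulrn// -powRrM mulrC powRrM powR_mulrn ?powR_ge0.
Qed.

Lemma ler_powR2r (a b x : R) : 0 <= x -> 0 <= a -> a <= b -> a `^ x <= b `^ x.
Proof.
by move=> x0 a0 ab; apply: ge0_ler_powR; rewrite ?nnegrE// (le_trans a0).
Qed.

Lemma powR_sub2 (a q : R) : 2 < q -> 0 <= a -> a `^ q = a ^+ 2 * a `^ (q - 2).
Proof.
move=> q2 a0; rewrite -powR_mulrn// -powRD; first by congr powR; ring.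
by apply/implyP => /eqP h; exfalso; move: h; lra.
Qed.

(* The two-scale argument of Hedberg: interpolate between the bounds
   [c * D * tau^k] (coming from a fractional derivative) and [C * M * rho^k]
   (coming from a norm), and optimise over the scale [k >= j]. *)
Lemma hedberg_interpolation (tau beta c C M D g q : R) (j : nat) :
  0 < tau -> 2 <= beta -> 0 <= c -> 0 <= C -> 0 < M -> 0 <= D -> 0 <= g ->
  2 < q -> tau `^ q * beta `^ (q - 2) <= 1 ->
  g <= c * D * tau ^+ j ->
  (forall k, (j <= k)%N -> g <= c * D * tau ^+ k + C * M * (beta * tau) ^+ k) ->
  g `^ q <= (c * beta + C) `^ q * D ^+ 2 * M `^ (q - 2) *
            (tau `^ q * beta `^ (q - 2)) ^+ j.
Proof.
move=> tau0 beta2 c0 C0 M0 D0 g0 q2; set kappa := tau `^ q * _ => k1 gj gk.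
have q0 : 0 <= q by lra.
have beta0 : 0 < beta by lra.
have kap0 : 0 <= kappa by rewrite mulr_ge0 ?powR_ge0.
have cb : c <= c * beta + C by nra.
(* If D <= beta^j M, the bound at scale [j] suffices: D^(q-2) is traded for (beta^j M)^(q-2). *)
have [Dle|Dgt] := leP D (beta ^+ j * M).
  apply: (@le_trans _ _ ((c * D * tau ^+ j) `^ q)); first exact: ler_powR2r.
  rewrite !powRM ?mulr_ge0 ?exprn_ge0 ?(ltW tau0)// (powR_sub2 q2 D0).
  rewrite (powR_exprn _ _ (ltW tau0)) /kappa exprMn.
  apply: (@le_trans _ _ (c `^ q * (D ^+ 2 * (beta ^+ j * M) `^ (q - 2)) * (tau `^ q) ^+ j)).
    rewrite ler_wpM2r ?exprn_ge0 ?powR_ge0// ler_wpM2l ?powR_ge0//.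
    by rewrite ler_wpM2l ?sqr_ge0//; apply: ler_powR2r => //; lra.
  rewrite powRM ?exprn_ge0 ?(ltW beta0) ?(ltW M0)// (powR_exprn _ _ (ltW beta0)).
  set X := D ^+ 2; set Y := M `^ _; set Z := (beta `^ _) ^+ j; set W := (tau `^ _) ^+ j.
  have -> : c `^ q * (X * (Z * Y)) * W = c `^ q * (X * Y * (W * Z)) by ring.
  rewrite [leRHS](_ : _ = (c * beta + C) `^ q * (X * Y * (W * Z))); last by ring.
  rewrite ler_wpM2r ?ler_powR2r// !mulr_ge0 ?exprn_ge0 ?powR_ge0//.
have [n Dn] : exists n, D <= beta ^+ n * M.
  exists (Num.bound (D / M)); rewrite -ler_pdivrMr//.
  have /ltW := archi_boundP (divr_ge0 D0 (ltW M0)); move/le_trans; apply.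
  apply: (@le_trans _ _ (2 ^+ Num.bound (D / M))).
    by rewrite -natrX ler_nat ltnW// ltn_expl.
  by rewrite lerXn2r// nnegrE; lra.
(* The least m = k+1 with D <= beta^m M exceeds [j]. Then beta^k M < D <= beta^(k+1) M, so at scale
   [k] both terms are at most a constant times M (beta tau)^k. *)
case: (@ex_minnP (fun n => D <= beta ^+ n * M)) => [|m Dm mmin]; first by exists n.
have jm : (j < m)%N.
  rewrite ltnNge; apply/negP => mj; move: Dgt; rewrite ltNge => /negP; apply.
  apply: (le_trans Dm); rewrite ler_wpM2r ?(ltW M0)// ler_weXn2l//; lra.
case: m => [//|k] in Dm mmin jm *.
have Dk : beta ^+ k * M < D.
  by rewrite ltNge; apply/negP => /mmin; rewrite ltnn.
have {gk} gk : g <= (c * beta + C) * (M * (beta * tau) ^+ k).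
  apply: (le_trans (gk _ jm)); rewrite mulrDl -!mulrA lerD2r ler_wpM2l//.
  rewrite exprMn !mulrA ler_wpM2r ?exprn_ge0 ?(ltW tau0)//.
  by rewrite -mulrA [M * _]mulrC mulrA -exprS.
apply: (@le_trans _ _ (((c * beta + C) * (M * (beta * tau) ^+ k)) `^ q)).
  exact: ler_powR2r.
have bk0 : 0 <= beta ^+ k by rewrite exprn_ge0// ltW.
have tk0 : 0 <= tau ^+ k by rewrite exprn_ge0// ltW.
rewrite powRM; last 2 first.
- by nra.
- by rewrite exprMn mulr_ge0 ?mulr_ge0// ltW.
rewrite [leRHS](_ : _ = (c * beta + C) `^ q * (D ^+ 2 * (M `^ (q - 2) * kappa ^+ j)));
  last by ring.
rewrite ler_wpM2l ?powR_ge0//.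
(* Of the q powers of beta^k M two are traded for D^2; the others, with tau^(kq), give M^(q-2)
   kappa^k, and kappa <= 1 lowers [k] to [j]. *)
apply: (@le_trans _ _ ((beta ^+ k * M) ^+ 2 * (M `^ (q - 2) * kappa ^+ k))).
  have -> : M * (beta * tau) ^+ k = beta ^+ k * M * tau ^+ k by rewrite exprMn; ring.
  have bM0 := mulr_ge0 bk0 (ltW M0).
  rewrite (powRM _ bM0 tk0) (powR_sub2 q2 bM0) (powRM _ bk0 (ltW M0)).
  rewrite !powR_exprn ?(ltW beta0) ?(ltW tau0)// /kappa [X in _ <= _ * (_ * X)]exprMn.
  by rewrite le_eqVlt; apply/orP; left; apply/eqP; ring.
apply: ler_pM.
- exact: sqr_ge0.
- by rewrite mulr_ge0 ?powR_ge0 ?exprn_ge0.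
- by rewrite lerXn2r ?nnegrE ?mulr_ge0 ?(ltW M0)// ltW.
- by rewrite ler_wpM2l ?powR_ge0// ler_wiXn2l// ltnW.
Qed.

End real_lemmas.

Lemma gt1_ltr_powR (R : realType) (a x y : R) : 1 < a -> x < y -> a `^ x < a `^ y.
Proof.
move=> a1 xy; have a0 : a != 0 by rewrite gt_eqF// (lt_trans ltr01).
by rewrite /powR (negbTE a0) ltr_expR ltr_pM2r// ln_gt0.
Qed.

(** * The fractional Sobolev embedding *)

Section dyadic.
Context (R : realType) (N : nat) (s q : R).
Local Notation V := 'rV[R]_N.
Local Notation mu := (lebesgue_rV R N).
Local Notation alpha := (N%:R + 2 * s).
Context (N2 : (2 <= N)%N) (s01 : 0 < s < 1)
  (q2 : 2 < q) (qN : q * (N%:R - 2 * s) < 2 * N%:R).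
Implicit Types (u v : V -> R).

Definition dproj j u (x : V) : R := avg mu (dcube j (dindex j x)) u.

Lemma measurable_dproj j u : measurable_fun setT (dproj j u).
Proof. exact: (measurable_dindex j (fun z => avg mu (dcube j z) u)). Qed.

Let s0 : 0 < s. Proof. by case/andP: s01. Qed.
Let s1 : s < 1. Proof. by case/andP: s01. Qed.
Let Nge2 : 2 <= N%:R :> R. Proof. by rewrite ler_nat. Qed.
Let alpha0 : 0 <= alpha. Proof. by rewrite addr_ge0// mulr_ge0// ltW. Qed.

Let tau : R := 2 `^ (- s).
Let beta : R := 2 `^ (N%:R / 2).
Let c0 : R := Num.sqrt N%:R `^ alpha.
Let kappa : R := tau `^ q * beta `^ (q - 2).

Let tau0 : 0 < tau. Proof. by rewrite powR_gt0. Qed.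
Let beta0 : 0 < beta. Proof. by rewrite powR_gt0. Qed.
Let c00 : 0 <= c0. Proof. exact: powR_ge0. Qed.

Let beta2 : 2 <= beta.
Proof.
rewrite /beta -[leLHS]powRr1//; apply: ler_powR; first by rewrite ler1n.
by rewrite ler_pdivlMr// mul1r.
Qed.

Let sqr_beta : beta ^+ 2 = 2 ^+ N.
Proof.
rewrite /beta -powR_mulrn ?powR_ge0// -powRrM -powR_mulrn//; congr powR.
by rewrite divfK.
Qed.

(** The exponent of 2 is N(q-2)/2 - sq, which is negative exactly when q is subcritical. *)
Let kappa_lt1 : kappa < 1.
Proof.
rewrite /kappa /tau /beta -!powRrM -powRD; last by rewrite pnatr_eq0 implybT.
rewrite -[ltRHS](powRr0 2); apply: gt1_ltr_powR; first by rewrite ltr1n.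
by move: qN; lra.
Qed.

(** Since N >= 2 > 2s, the increments of the averages may grow with the scale, and their sum is of
    the size of the last one. *)
Let rho1 : 1 < beta * tau.
Proof.
rewrite /beta /tau -powRD; last by rewrite pnatr_eq0 implybT.
rewrite -[ltLHS](powRr0 2); apply: gt1_ltr_powR; first by rewrite ltr1n.
by move: Nge2 s1; lra.
Qed.

Let cube_const j : (Num.sqrt N%:R / 2 ^+ j) `^ alpha / (2 ^+ j)^-1 ^+ N =
  c0 * (tau ^+ 2) ^+ j.
Proof.
have p2 : 0 < 2 ^+ j :> R by rewrite exprn_gt0.
rewrite powRM ?invr_ge0 ?(ltW p2)// -/c0 -mulrA; congr (_ * _).
rewrite exprVn invrK -powR_inv1 ?(ltW p2)// -powRrM -(powR_mulrn N (ltW p2)).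
rewrite -powRD; last by rewrite (gt_eqF p2) implybT.
rewrite powR_exprn// -[tau ^+ 2]powR_mulrn ?powR_ge0// /tau -powRrM.
by congr ((2 `^ _) ^+ j); ring.
Qed.

Lemma sub_dproj_sq_le j u x : measurable_fun setT u -> (sqn u < +oo)%E ->
  (((u x - dproj j u x) ^+ 2)%:E <= (c0 * (tau ^+ 2) ^+ j)%:E * gagx s u x)%E.
Proof.
move=> m_u u2; rewrite -cube_const; apply: sub_avg_le => //.
- exact: measurable_dcube.
- exact: lebesgue_rV_dcube.
- by move=> y /esym; exact: dindex_enorm.
Qed.

(** Both cubes lie in the coarser one, so the bound does not depend on [x]; the two volumes produce
    the growth rate beta tau. *)
Lemma dprojS_sq_le j u x : measurable_fun setT u -> (sqn u < +oo)%E ->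
  (((dproj j.+1 u x - dproj j u x) ^+ 2)%:E <=
     (c0 * beta ^+ 2 * ((beta * tau) ^+ j) ^+ 2)%:E * energy s u)%E.
Proof.
move=> m_u u2.
have -> : c0 * beta ^+ 2 * ((beta * tau) ^+ j) ^+ 2 =
    (Num.sqrt N%:R / 2 ^+ j) `^ alpha / (2 ^+ j)^-1 ^+ N / (2 ^+ j.+1)^-1 ^+ N.
  rewrite cube_const -[RHS]mulrA -[LHS]mulrA; congr (_ * _).
  have e : (2 ^+ j.+1) ^+ N = beta ^+ 2 * (beta ^+ 2) ^+ j.
    by rewrite sqr_beta -exprS -!exprM mulnC.
  by rewrite exprVn invrK e exprAC !exprMn; ring.
apply: avg_sub_avg_le => //; rewrite ?exprn_gt0 ?invr_gt0 ?exprn_gt0//.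
- exact: measurable_dcube.
- exact: measurable_dcube.
- exact: lebesgue_rV_dcube.
- exact: lebesgue_rV_dcube.
- by move=> a b /dindexS xa xb; apply: dindex_enorm; rewrite xa.
Qed.

Let C1 : R := Num.sqrt c0 * beta.
(** The solution of C1 + C2 = C2 beta tau, for which the induction on the scale closes. *)
Let C2 : R := C1 / (beta * tau - 1).

Let C20 : 0 <= C2.
Proof.
by rewrite divr_ge0 ?subr_ge0 ?(ltW rho1)// mulr_ge0 ?sqrtr_ge0// ltW.
Qed.

(** Source of the second bound in [hedberg_interpolation]. The increments are controlled by the
    energy instead of the L^2 norm, so that only the energy is tied to [M]. *)
Let dproj_telescope (M : R) j k u x : measurable_fun setT u -> (sqn u < +oo)%E ->
  0 < M -> (energy s u <= (M ^+ 2)%:E)%E -> (j <= k)%N ->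
  `|dproj k u x - dproj j u x| <= C2 * M * (beta * tau) ^+ k.
Proof.
move=> m_u u2 M0 uM.
have r0 n : 0 <= (beta * tau) ^+ n by apply: exprn_ge0; rewrite mulr_ge0// ltW.
have C2M n : 0 <= C2 * M * (beta * tau) ^+ n by rewrite mulr_ge0// mulr_ge0// ltW.
elim: k => [|k IH].
  by rewrite leqn0 => /eqP ->; rewrite subrr normr0.
rewrite leq_eqVlt => /predU1P[->|]; last rewrite ltnS => /IH {}IH.
  by rewrite subrr normr0.
have step : `|dproj k.+1 u x - dproj k u x| <= C1 * M * (beta * tau) ^+ k.
  rewrite -(@ler_pXn2r _ 2)// ?nnegrE//; last first.
    by rewrite mulr_ge0// mulr_ge0 ?(ltW M0)// mulr_ge0 ?sqrtr_ge0 ?(ltW beta0).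
  rewrite real_normK ?num_real// -lee_fin; apply: (le_trans (dprojS_sq_le k x m_u u2)).
  apply: (@le_trans _ _ ((c0 * beta ^+ 2 * ((beta * tau) ^+ k) ^+ 2)%:E * (M ^+ 2)%:E)%E).
    by apply: lee_wpmul2l => //; rewrite lee_fin mulr_ge0 ?sqr_ge0// mulr_ge0 ?sqr_ge0.
  rewrite -EFinM lee_fin le_eqVlt; apply/orP; left; apply/eqP.
  by rewrite !exprMn sqr_sqrtr//; ring.
rewrite -(subrKA (dproj k u x)); apply: (le_trans (ler_normD _ _)).
apply: (le_trans (lerD step IH)).
rewrite le_eqVlt; apply/orP; left; apply/eqP; rewrite /C2 exprS.
by field; rewrite gt_eqF// subr_gt0.
Qed.

Let A : R := (Num.sqrt c0 * beta + C2) `^ q.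

Let A0 : 0 < A.
Proof.
apply: powR_gt0; apply: ltr_wpDr => //; apply: mulr_gt0 => //.
rewrite sqrtr_gt0; apply: powR_gt0; rewrite sqrtr_gt0 ltr0n.
exact: leq_trans N2.
Qed.

Lemma sub_dproj_powR_le (M : R) j u x : measurable_fun setT u ->
  (sqn u < +oo)%E -> 0 < M -> (energy s u <= (M ^+ 2)%:E)%E ->
  ((`|u x - dproj j u x| `^ q)%:E <=
     (A * M `^ (q - 2) * kappa ^+ j)%:E * gagx s u x)%E.
Proof.
move=> m_u u2 M0 uM.
have kappa0 : 0 < kappa by rewrite mulr_gt0 ?powR_gt0.
have [->|fin] := eqVneq (gagx s u x) +oo%E.
  rewrite gt0_muley ?leey// lte_fin; apply: mulr_gt0; last exact: exprn_gt0.
  by apply: mulr_gt0 => //; exact: powR_gt0.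
have gx0 := gagx_ge0 s u x.
have gE : gagx s u x = (Num.sqrt (fine (gagx s u x)) ^+ 2)%:E.
  have gfin : gagx s u x \is a fin_num by rewrite ge0_fin_numE// ltey.
  by rewrite sqr_sqrtr ?fine_ge0// fineK.
set D := Num.sqrt (fine (gagx s u x)) in gE.
have D0 : 0 <= D by exact: sqrtr_ge0.
have close k : `|u x - dproj k u x| <= Num.sqrt c0 * D * tau ^+ k.
  rewrite -(@ler_pXn2r _ 2)// ?nnegrE//; last first.
    by rewrite !mulr_ge0 ?sqrtr_ge0 ?exprn_ge0 ?(ltW tau0).
  rewrite real_normK ?num_real// -lee_fin.
  apply: (le_trans (sub_dproj_sq_le k x m_u u2)).
  rewrite gE -EFinM lee_fin le_eqVlt; apply/orP; left; apply/eqP.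
  by rewrite (exprAC tau) -[in LHS](sqr_sqrtr c00); ring.
rewrite gE -EFinM lee_fin.
rewrite (_ : A * _ * _ * _ = A * D ^+ 2 * M `^ (q - 2) * kappa ^+ j); last by ring.
apply: hedberg_interpolation => //; rewrite ?sqrtr_ge0//; first exact: ltW.
move=> k jk; rewrite -(subrKA (dproj k u x)).
apply: (le_trans (ler_normD _ _)); apply: lerD; first exact: close.
exact: dproj_telescope.
Qed.

(** The factor k^j makes the approximation by averages uniform in L^q over bounded sets of H^s; this
    is what later yields compactness. *)
Lemma sub_dproj_int_le : exists A k : R, [/\ 0 < A, 0 < k < 1 &
  forall (M : R) j u, measurable_fun setT u -> (sqn u < +oo)%E -> 0 < M ->
    (energy s u <= (M ^+ 2)%:E)%E ->
    (\int[mu]_x (`|u x - dproj j u x| `^ q)%:E <= (A * M `^ q * k ^+ j)%:E)%E].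
Proof.
have kappa0 : 0 < kappa by rewrite mulr_gt0 ?powR_gt0.
exists A, kappa; split => //; first by rewrite kappa0 kappa_lt1.
move=> M j u m_u u2 M0 uM.
have c1 : 0 <= A * M `^ (q - 2) * kappa ^+ j.
  by rewrite !mulr_ge0 ?powR_ge0 ?exprn_ge0 ?(ltW A0) ?(ltW kappa0).
apply: (@le_trans _ _ (\int[mu]_x ((A * M `^ (q - 2) * kappa ^+ j)%:E * gagx s u x))%E).
  apply: ge0_le_integral => //.
  - apply/measurable_EFinP; apply: (measurableT_comp (measurable_powR _)).
    apply: measurableT_comp => //; apply: measurable_funB => //.
    exact: measurable_dproj.
  - by apply: measurable_funeM; exact: measurable_gagx.
  - by move=> x _; exact: sub_dproj_powR_le.
rewrite ge0_integralZl//; last 2 first.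
- exact: measurable_gagx.
- by move=> x _; exact: gagx_ge0.
rewrite -energyE//.
apply: (@le_trans _ _ ((A * M `^ (q - 2) * kappa ^+ j)%:E * (M ^+ 2)%:E)%E).
  exact: lee_wpmul2l.
rewrite -EFinM lee_fin le_eqVlt; apply/orP; left; apply/eqP.
by rewrite (powR_sub2 q2 (ltW M0)); ring.
Qed.

(** Pointwise |E_j u|^2 <= 2 u^2 + 2 |u - E_j u|^2, and D controls the last term uniformly in [j];
    this avoids a summation over the cubes. *)
Lemma dproj_sqn_le : exists2 C : R, 0 < C & forall j u,
  measurable_fun setT u -> (sqn (dproj j u) <= C%:E * hs2 s u)%E.
Proof.
exists (2 + 2 * c0); first by rewrite ltr_wpDr// mulr_ge0.
move=> j u m_u; have C0 : 0 < 2 + 2 * c0 by rewrite ltr_wpDr// mulr_ge0.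
have [u2|] := ltP (sqn u) +oo%E; last first.
  rewrite leye_eq => /eqP uoo; rewrite /hs2 uoo addeC addye ?gt0_muley ?leey//.
  by rewrite -ltNye (lt_le_trans _ (energy_ge0 s u)).
have t1 : (tau ^+ 2) ^+ j <= 1.
  have tau1 : tau <= 1.
    by rewrite -(powRr0 2) /tau; apply: ler_powR; rewrite ?ler1n// oppr_le0 ltW.
  by rewrite -exprM exprn_ile1// ltW.
have mE : measurable_fun setT (fun x => (2 * u x ^+ 2)%:E).
  by apply/measurable_EFinP; apply: measurable_funM => //; exact: measurable_funX.
apply: (@le_trans _ _ (\int[mu]_x ((2 * u x ^+ 2)%:E + (2 * c0)%:E * gagx s u x))%E).
  apply: ge0_le_integral => //.
  - by move=> x _; rewrite lee_fin sqr_ge0.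
  - by apply/measurable_EFinP; apply: measurable_funX; exact: measurable_dproj.
  - by apply: emeasurable_funD => //; apply: measurable_funeM; exact: measurable_gagx.
  - move=> x _.
    apply: (@le_trans _ _ ((2 * u x ^+ 2)%:E + 2%:E * ((u x - dproj j u x) ^+ 2)%:E)%E).
      rewrite -EFinM -EFinD lee_fin.
      by have := sqr_ge0 (2 * u x - dproj j u x); nra.
    apply: leeD2l; rewrite [(2 * c0)%:E]EFinM -muleA; apply: lee_wpmul2l => //.
    apply: (le_trans (sub_dproj_sq_le j x m_u u2)).
    apply: lee_wpmul2r; first exact: gagx_ge0.
    by rewrite lee_fin ler_piMr.
rewrite ge0_integralD//; last 3 first.
- by move=> x _; rewrite lee_fin mulr_ge0 ?sqr_ge0.
- by move=> x _; rewrite mule_ge0 ?gagx_ge0// lee_fin mulr_ge0.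
- by apply: measurable_funeM; exact: measurable_gagx.
rewrite ge0_integralZl ?lee_fin ?mulr_ge0//; last 2 first.
- exact: measurable_gagx.
- by move=> x _; exact: gagx_ge0.
rewrite -energyE// ge0_intRZ//; last 2 first.
- exact: measurable_funX.
- by move=> x; exact: sqr_ge0.
have -> : ((2 + 2 * c0)%:E * hs2 s u =
    (2 + 2 * c0)%:E * sqn u + (2 + 2 * c0)%:E * energy s u)%E.
  rewrite addeC; apply: ge0_muleDr; [exact: energy_ge0|exact: sqn_ge0].
rewrite -/(sqn u).
apply: leeD; apply: lee_wpmul2r.
- exact: sqn_ge0.
- by rewrite lee_fin lerDl mulr_ge0.
- exact: energy_ge0.
- by rewrite lee_fin lerDr.
Qed.

End dyadic.

(** * The quadratic form of H^s and its lower semicontinuity *)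

Lemma limn_einfD_le (R : realType) (a b : nat -> \bar R) :
  (forall n, 0 <= a n)%E -> (forall n, 0 <= b n)%E ->
  (limn_einf a + limn_einf b <= limn_einf (fun n => a n + b n))%E.
Proof.
move=> a0 b0; rewrite !limn_einf_lim.
have e0 (c : nat -> \bar R) n : (forall n, 0 <= c n)%E -> (0 <= einfs c n)%E.
  by move=> c0; apply: le_ereal_inf_tmp => _ [k _ <-].
rewrite -limeD; try exact: is_cvg_einfs; last first.
  apply: ge0_adde_def; rewrite inE; apply: lime_ge; try exact: is_cvg_einfs;
    by apply: nearW => n; exact: e0.
apply: lee_lim; [|exact: is_cvg_einfs|].
  apply: is_cvgeD; try exact: is_cvg_einfs.
  apply: ge0_adde_def; rewrite inE; apply: lime_ge; try exact: is_cvg_einfs;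
    by apply: nearW => n; exact: e0.
apply: nearW => n; apply: le_ereal_inf_tmp => _ [k /= nk <-].
by apply: leeD; apply: ereal_inf_lbound; exists k.
Qed.

Section ae_product.
Context d1 d2 (T1 : measurableType d1) (T2 : measurableType d2) (R : realType)
  (m1 : {sigma_finite_measure set T1 -> \bar R})
  (m2 : {sigma_finite_measure set T2 -> \bar R}).

Lemma ae_fst (P : set T1) : {ae m1, forall x, P x} ->
  {ae (m1 \x m2)%E, forall z, P z.1}.
Proof.
move=> [A [mA A0 AP]]; exists (A `*` setT); split.
- exact: measurableX.
- transitivity (m1 A * m2 setT)%E; first exact: product_measure1E.
  by rewrite A0 mul0e.
- by move=> z /= /AP.
Qed.

Lemma ae_snd (P : set T2) : {ae m2, forall x, P x} ->
  {ae (m1 \x m2)%E, forall z, P z.2}.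
Proof.
move=> [A [mA A0 AP]]; exists (setT `*` A); split.
- exact: measurableX.
- transitivity (m1 setT * m2 A)%E; first exact: product_measure1E.
  by rewrite A0 mule0.
- by move=> z /= /AP.
Qed.

End ae_product.

Section hilbert.
Context (R : realType) (N : nat) (s : R).
Local Notation V := 'rV[R]_N.
Local Notation mu := (lebesgue_rV R N).
Local Notation alpha := (N%:R + 2 * s).
Implicit Types (u v : V -> R).

(** Signed square root of [gag]; with it the energy is an L^2 norm on the product and can be
    polarised. *)
Definition quot u (z : V * V) : R :=
  (u z.1 - u z.2) / enorm (z.1 - z.2) `^ (N%:R / 2 + s).

Definition in_hs u := measurable_fun setT u /\ (hs2 s u < +oo)%E.

Definition qf u : R := fine (hs2 s u).

(** Polar form of [qf]. For elements of H^s both integrals converge absolutely, and [fine] is meant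
    for that case. *)
Definition bf u v : R :=
  fine (\int[(mu \x mu)%E]_z (quot u z * quot v z)%:E) +
  fine (\int[mu]_x (u x * v x)%:E).

Lemma enorm_powR_half (x : V) :
  (enorm x `^ (N%:R / 2 + s)) ^+ 2 = enorm x `^ alpha.
Proof.
rewrite -powR_mulrn ?powR_ge0// -powRrM; congr powR.
by field.
Qed.

Lemma quot_sq u z : quot u z ^+ 2 = gag s u z.1 z.2.
Proof. by rewrite /quot /gag expr_div_n enorm_powR_half. Qed.

Lemma energy_quot u : energy s u = (\int[(mu \x mu)%E]_z (quot u z ^+ 2)%:E)%E.
Proof. by rewrite /energy; apply: eq_integral => z _; rewrite quot_sq. Qed.

Lemma measurable_quot u : measurable_fun setT u -> measurable_fun setT (quot u).
Proof.
move=> m_u; apply: measurable_funM.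
  apply: measurable_funB.
    exact: (measurableT_comp m_u measurable_fst).
  exact: (measurableT_comp m_u measurable_snd).
by apply: measurable_enorm_powR; [exact: measurable_fst|exact: measurable_snd].
Qed.

Lemma in_hs_lty u : in_hs u -> (energy s u < +oo)%E /\ (sqn u < +oo)%E.
Proof.
move=> [_ h]; split; apply: le_lt_trans h.
  by rewrite /hs2 leeDl// sqn_ge0.
by rewrite /hs2 leeDr// energy_ge0.
Qed.

Lemma hs2E u : in_hs u -> hs2 s u = (qf u)%:E.
Proof. by move=> [_ h]; rewrite /qf fineK// ge0_fin_numE// hs2_ge0. Qed.

Lemma qf_ge0 u : 0 <= qf u.
Proof. by rewrite fine_ge0// hs2_ge0. Qed.

Lemma energy_le_hs2 u : (energy s u <= hs2 s u)%E.
Proof. by rewrite /hs2 leeDl// sqn_ge0. Qed.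

Lemma sqn_le_hs2 u : (sqn u <= hs2 s u)%E.
Proof. by rewrite /hs2 leeDr// energy_ge0. Qed.

Lemma hs2_expand u v (t : R) : in_hs u -> in_hs v ->
  hs2 s (fun x => u x + t * v x) = (qf u + 2 * t * bf u v + t ^+ 2 * qf v)%:E.
Proof.
move=> hu hv; have [mu_ _] := hu; have [mv _] := hv.
have [eu nu] := in_hs_lty hu; have [ev nv] := in_hs_lty hv.
rewrite energy_quot in eu; rewrite energy_quot in ev.
have [iq] := sq_expand t (measurable_quot mu_) (measurable_quot mv) eu ev.
have [i2] := sq_expand t mu_ mv nu nv.
rewrite -!energy_quot => e1 e2.
have E1 : energy s (fun x => u x + t * v x) =
    (\int[(mu \x mu)%E]_z ((quot u z + t * quot v z) ^+ 2)%:E)%E.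
  by rewrite energy_quot; apply: eq_integral => z _; congr ((_ ^+ 2)%:E);
    rewrite /quot; ring.
rewrite /hs2 E1 e2 /sqn e1.
have fq : (\int[(mu \x mu)%E]_z (quot u z * quot v z)%:E)%E \is a fin_num.
  exact: integrable_fin_num iq.
have f2 : (\int[mu]_z (u z * v z)%:E)%E \is a fin_num by exact: integrable_fin_num i2.
rewrite -/(sqn u) -/(sqn v) /bf /qf /hs2.
have fE w : in_hs w -> energy s w \is a fin_num /\ sqn w \is a fin_num.
  by move=> /in_hs_lty[? ?]; rewrite !ge0_fin_numE ?energy_ge0 ?sqn_ge0.
have [a1 a2] := fE _ hu; have [b1 b2] := fE _ hv.
rewrite -(fineK fq) -(fineK f2) -(fineK a1) -(fineK a2) -(fineK b1) -(fineK b2) /=.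
by rewrite -!EFinM -!EFinD; congr EFin; ring.
Qed.

Lemma in_hs_lin u v (t : R) : in_hs u -> in_hs v -> in_hs (fun x => u x + t * v x).
Proof.
move=> hu hv; split; last by rewrite hs2_expand// ltry.
by apply: measurable_funD; [exact: hu.1|apply: measurable_funM => //; exact: hv.1].
Qed.

Lemma qf_expand u v (t : R) : in_hs u -> in_hs v ->
  qf (fun x => u x + t * v x) = qf u + 2 * t * bf u v + t ^+ 2 * qf v.
Proof. by move=> hu hv; rewrite /qf hs2_expand. Qed.

Lemma hs2Z (c : R) u : measurable_fun setT u ->
  hs2 s (fun x => c * u x) = ((c ^+ 2)%:E * hs2 s u)%E.
Proof.
move=> m_u; rewrite /hs2 ge0_muleDr ?energy_ge0 ?sqn_ge0//; congr (_ + _)%E.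
  rewrite /energy -ge0_intRZ ?sqr_ge0//.
  - by apply: eq_integral => z _; congr EFin; rewrite /gag; ring.
  - exact: measurable_gag.
  - by move=> z; exact: gag_ge0.
rewrite /sqn -ge0_intRZ ?sqr_ge0//.
- by apply: eq_integral => z _; rewrite exprMn.
- exact: measurable_funX.
- by move=> z; exact: sqr_ge0.
Qed.

Lemma in_hsZ (c : R) u : in_hs u -> in_hs (fun x => c * u x).
Proof.
move=> hu; have [m_u _] := hu; split; first exact: measurable_funM.
by rewrite hs2Z// hs2E// ltry.
Qed.

Lemma qfZ (c : R) u : in_hs u -> qf (fun x => c * u x) = c ^+ 2 * qf u.
Proof. by move=> hu; have [m_u _] := hu; rewrite /qf hs2Z// hs2E. Qed.

(** Markov property of the form: normal contractions do not increase it. It serves for the absolute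
    value and for the positive part. *)
Lemma hs2_contraction (f : R -> R) u : measurable_fun setT u ->
  measurable_fun setT f ->
  (forall a b, `|f a - f b| <= `|a - b|) -> f 0 = 0 ->
  (hs2 s (f \o u) <= hs2 s u)%E.
Proof.
move=> m_u mf fl f0.
have fl2 a b : (f a - f b) ^+ 2 <= (a - b) ^+ 2.
  rewrite -[leLHS]real_normK ?num_real// -[leRHS]real_normK ?num_real//.
  by rewrite ler_pXn2r ?nnegrE//; exact: fl.
have mfu : measurable_fun setT (f \o u) by exact: measurableT_comp.
apply: leeD.
  apply: le_intR; [exact: measurable_gag|exact: measurable_gag| |] => z.
    exact: gag_ge0.
  by apply: ler_wpM2r; [rewrite invr_ge0 powR_ge0|exact: fl2].
apply: le_intR; [exact: measurable_funX|exact: measurable_funX| |] => z.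
  exact: sqr_ge0.
by have := fl2 (u z) 0; rewrite f0 !subr0.
Qed.

Lemma hs2_comp_isometry T u : measurable_fun setT u -> euclidean_isometry T ->
  hs2 s (u \o T) = hs2 s u.
Proof.
move=> m_u [mT dT _]; have muT : measurable_fun setT (u \o T).
  by apply: measurableT_comp => //; exact: mT.1.
congr (_ + _)%E; last first.
  apply: (measure_preserving_integral (h := fun x => (u x ^+ 2)%:E) mT).
    by apply/measurable_EFinP; exact: measurable_funX.
  by move=> x; rewrite lee_fin sqr_ge0.
rewrite (energyE s m_u) (energyE s muT).
have -> : gagx s (u \o T) = gagx s u \o T.
  apply/funext => x.
  transitivity (\int[mu]_y (gag s u (T x) (T y))%:E)%E.
    by apply: eq_integral => y _; rewrite /gag/= dT.
  apply: (measure_preserving_integral (h := fun y => (gag s u (T x) y)%:E) mT).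
  - by apply/measurable_EFinP; exact: measurable_gag2.
  - by move=> y; rewrite lee_fin gag_ge0.
apply: (measure_preserving_integral (h := gagx s u) mT).
- exact: measurable_gagx.
- by move=> y; exact: gagx_ge0.
Qed.

(** Takes the place of weak lower semicontinuity: Fatou on each of the two integrals, then
    superadditivity of the lower limit. *)
Lemma hs2_fatou (u_ : nat -> V -> R) u (c : \bar R) :
  (forall n, measurable_fun setT (u_ n)) -> measurable_fun setT u ->
  {ae mu, forall x, u_ ^~ x @ \oo --> u x} ->
  (\forall n \near \oo, hs2 s (u_ n) <= c)%E -> (hs2 s u <= c)%E.
Proof.
move=> mu_ m_u cvg_u [K _ le_c].
have e1 : (energy s u <= limn_einf (fun n => energy s (u_ n)))%E.
  apply: (@fatou_cvg _ _ _ _ (fun n z => gag s (u_ n) z.1 z.2)).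
  - by move=> n; exact: measurable_gag.
  - exact: measurable_gag.
  - by move=> n z; exact: gag_ge0.
  - by move=> z; exact: gag_ge0.
  - apply: filterS2 (@ae_fst _ _ _ _ _ mu mu _ cvg_u) (@ae_snd _ _ _ _ _ mu mu _ cvg_u).
    move=> z h1 h2.
    rewrite /gag; apply: cvgMl; rewrite expr2; under eq_fun do rewrite expr2.
    by apply: cvgM; apply: cvgB.
have e2 : (sqn u <= limn_einf (fun n => sqn (u_ n)))%E.
  apply: (@fatou_cvg _ _ _ _ (fun n x => u_ n x ^+ 2)).
  - by move=> n; exact: measurable_funX.
  - exact: measurable_funX.
  - by move=> n z; exact: sqr_ge0.
  - by move=> z; exact: sqr_ge0.
  - apply: filterS cvg_u => x ux; rewrite expr2; under eq_fun do rewrite expr2.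
    exact: cvgM.
rewrite /hs2 (le_trans (leeD e1 e2))//.
apply: (le_trans (limn_einfD_le _ _)) => [n|n|].
- exact: energy_ge0.
- exact: sqn_ge0.
rewrite limn_einf_lim; apply: lime_le; first exact: is_cvg_einfs.
apply: nearW => n; apply: le_trans (le_c (maxn K n) (leq_maxl _ _)).
by apply: ereal_inf_lbound; exists (maxn K n) => //=; exact: leq_maxr.
Qed.

End hilbert.

(** Instead of nested extractions, Tychonoff gives a cluster point [l] in the product of the
    intervals [-B k, B k]; [phi j] is an index past [j] whose first j+1 coordinates are within
    1/(j+1) of [l]. *)
Lemma diagonal_subsequence (R : realType) (a : nat -> nat -> R) (B : nat -> R) :
  (forall n k, `|a n k| <= B k) ->
  exists phi : nat -> nat, (forall j, (j <= phi j)%N) /\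
    forall k (e : R), 0 < e -> exists K, forall n m, (K <= n)%N -> (K <= m)%N ->
      `|a (phi n) k - a (phi m) k| <= e.
Proof.
move=> aB.
pose T : topologicalType := prod_topology (fun _ : nat => R : topologicalType).
have cK : compact ([set f | forall k, `[- B k, B k]%classic (f k)] : set T).
  by apply: (@tychonoff nat (fun=> R : topologicalType) (fun k => `[- B k, B k]%classic)) => k; exact: segment_compact.
have [l [_ cl]] : ([set f | forall k, `[- B k, B k]%classic (f k)] : set T) `&`
    cluster ((a : nat -> T) @ \oo) !=set0.
  by apply: cK; exists 0%N => // n _ k /=; rewrite in_itv/= -ler_norml.
have ex j : exists n, (j <= n)%N /\ forall k : 'I_j.+1, `|a n k - l k| < j.+1%:R^-1.
  have nl : nbhs (l : T) ([set f | forall k : 'I_j.+1, `|f k - l k| < j.+1%:R^-1] : set T).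
    apply: (@filter_forall T 'I_j.+1 (fun k f => `|f k - l k| < j.+1%:R^-1) (nbhs l)) => k.
    have j0 : 0 < j.+1%:R^-1 :> R by rewrite invr_gt0.
    have pc : (fun f : T => f k) @ (l : T) --> (l k : R).
      exact: (@proj_continuous nat (fun=> R : topologicalType) k l).
    have nb : nbhs (l k : R) (ball (l k : R) j.+1%:R^-1) by exact: nbhsx_ballx.
    have h : nbhs (l : T) [set f : T | ball (l k : R) j.+1%:R^-1 (f k)] by exact: pc _ nb.
    have : [set f : T | ball (l k : R) j.+1%:R^-1 (f k)] `<=` [set f : T | `|f k - l k| < j.+1%:R^-1].
      by move=> f; rewrite /ball /= distrC.
    by move=> /filterS; apply.
  have al : ((a : nat -> T) @ \oo) [set f | exists2 n, (j <= n)%N & f = a n].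
    by exists j => // n /= jn; exists n.
  by have [f [[n jn ->] fl]] := cl _ _ al nl; exists n.
have [phi phiP] := choice ex; exists phi; split; first by move=> j; case: (phiP j).
move=> k e e0; have e20 : 0 < e / 2 by rewrite divr_gt0.
pose K := maxn k (Num.bound (2 / e)).
have close n : (K <= n)%N -> `|a (phi n) k - l k| <= e / 2.
  move=> Kn; have kn : (k < n.+1)%N by rewrite ltnS (leq_trans (leq_maxl _ _) Kn).
  have [_ /(_ (Ordinal kn)) /= h] := phiP n; apply: (le_trans (ltW h)).
  rewrite -[leRHS]invrK lef_pV2 ?posrE ?invr_gt0// invf_div.
  have := archi_boundP (ltW (divr_gt0 (ltr0n R 2) e0)) => /ltW/le_trans; apply.
  by rewrite ler_nat (leq_trans (leq_maxr k _))// (leq_trans Kn).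
exists K => n m Kn Km; rewrite -(subrKA (l k)) [e]splitr.
by rewrite (le_trans (ler_normD _ _))// lerD ?close// distrC close.
Qed.

Lemma powR_addle (R : realType) (a b q : R) : 0 <= a -> 0 <= b -> 0 <= q ->
  (a + b) `^ q <= 2 `^ q * (a `^ q + b `^ q).
Proof.
move=> a0 b0 q0; have m0 : 0 <= Num.max a b by rewrite le_max a0.
apply: (@le_trans _ _ ((2 * Num.max a b) `^ q)).
  apply: ler_powR2r => //; first exact: addr_ge0.
  by rewrite mulr_natl mulr2n lerD// le_max lexx ?orbT.
rewrite powRM// ler_wpM2l ?powR_ge0//.
by case: (leP a b) => _; rewrite ?lerDl ?lerDr powR_ge0.
Qed.

(** * From dyadic averages to the embedding in L^q *)

Section embedding.
Context (R : realType) (N : nat) (s q : R).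
Local Notation V := 'rV[R]_N.
Local Notation mu := (lebesgue_rV R N).
Context (N2 : (2 <= N)%N) (s01 : 0 < s < 1)
  (q2 : 2 < q) (qN : q * (N%:R - 2 * s) < 2 * N%:R).
Implicit Types (u v : V -> R).

Let q0 : 0 <= q. Proof. by apply: ltW; exact: lt_trans q2. Qed.

Lemma measurable_norm_powR d (T : measurableType d) (u : T -> R) (r : R) :
  measurable_fun setT u -> measurable_fun setT (fun x => `|u x| `^ r).
Proof.
move=> m_u; apply: (measurableT_comp (measurable_powR _)).
exact: measurableT_comp.
Qed.

Lemma dproj_sq_le_local j u x : measurable_fun setT u -> (sqn u < +oo)%E ->
  ((dproj j u x ^+ 2)%:E <= (2 ^+ j ^+ N)%:E *
     \int[mu]_(y in dcube j (dindex j x)) (u y ^+ 2)%:E)%E.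
Proof.
move=> m_u u2; have mE := @measurable_dcube R N j (dindex j x).
have muE := @lebesgue_rV_dcube R N j (dindex j x).
have muEoo : (mu (dcube j (dindex j x)) < +oo)%E by rewrite muE ltry.
have m0 : 0 < (2 ^+ j)^-1 ^+ N :> R by rewrite exprn_gt0.
have iu := integrable_sq m_u u2 mE muEoo.
have := avg_sq_le 0 m_u mE muE m0 iu.
rewrite EFinM -lee_pdivlMr// sub0r sqrrN => /le_trans; apply.
rewrite muleC exprVn invrK lee_wpmul2l ?lee_fin ?exprn_ge0//.
rewrite le_eqVlt; apply/orP; left; apply/eqP.
by apply: eq_integral => y _; rewrite sub0r sqrrN.
Qed.

Lemma dproj_sq_le j u x : measurable_fun setT u -> (sqn u < +oo)%E ->
  ((dproj j u x ^+ 2)%:E <= (2 ^+ j ^+ N)%:E * sqn u)%E.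
Proof.
move=> m_u u2; apply: (le_trans (dproj_sq_le_local j x m_u u2)).
apply: lee_wpmul2l; first by rewrite lee_fin exprn_ge0// exprn_ge0.
apply: ge0_subset_integral => //; first exact: measurable_dcube.
  by apply/measurable_EFinP; exact: measurable_funX.
by move=> y _; rewrite lee_fin sqr_ge0.
Qed.

(** Write u = (u - E_j u) + E_j u. The first part has the factor k^j; the second is bounded by
    delta, so its q-th power is at most delta^(q-2) |E_j u|^2. *)
Lemma Lq_split_le : exists A C k : R, [/\ 0 < A, 0 < C, 0 < k < 1 &
  forall (M delta : R) j u, measurable_fun setT u -> 0 < M ->
    (hs2 s u <= (M ^+ 2)%:E)%E -> 0 <= delta ->
    (forall x, `|dproj j u x| <= delta) ->
    (\int[mu]_x (`|u x| `^ q)%:E <=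
      (A * M `^ q * k ^+ j + C * delta `^ (q - 2) * M ^+ 2)%:E)%E].
Proof.
have [A [k [A0 k01 HA]]] := sub_dproj_int_le N2 s01 q2 qN.
have [C C0 HC] := @dproj_sqn_le R N s s01.
exists (2 `^ q * A), (2 `^ q * C), k; split => //; try by rewrite mulr_gt0 ?powR_gt0.
move=> M delta j u m_u M0 uM d0 ud.
have uoo : (hs2 s u < +oo)%E by apply: le_lt_trans uM _; rewrite ltry.
have [eM sM] := (le_trans (energy_le_hs2 s u) uM, le_trans (sqn_le_hs2 s u) uM).
have u2 : (sqn u < +oo)%E by apply: le_lt_trans sM _; rewrite ltry.
have mp := @measurable_dproj R N j u.
have m1 : measurable_fun setT (fun x => `|u x - dproj j u x| `^ q).
  by apply: measurable_norm_powR; exact: measurable_funB.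
have m2 := measurable_norm_powR q mp.
apply: (@le_trans _ _ (\int[mu]_x (2 `^ q *
    (`|u x - dproj j u x| `^ q + `|dproj j u x| `^ q))%:E)%E).
  apply: le_intR.
  - exact: measurable_norm_powR.
  - by apply: measurable_funM => //; exact: measurable_funD.
  - by move=> x; exact: powR_ge0.
  - move=> x; apply: le_trans (powR_addle _ _ q0) => //.
    by apply: ler_powR2r => //; rewrite -{1}[u x](subrK (dproj j u x)) ler_normD.
rewrite ge0_intRZ ?powR_ge0//; last exact: measurable_funD.
rewrite ge0_intRD//; try by move=> x; exact: powR_ge0.
rewrite -!mulrA -mulrDr EFinM; apply: lee_wpmul2l; first by rewrite lee_fin powR_ge0.
rewrite !mulrA EFinD; apply: leeD; first exact: HA.
apply: (@le_trans _ _ (\int[mu]_x (delta `^ (q - 2) * dproj j u x ^+ 2)%:E)%E).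
  apply: le_intR => //.
  - by apply: measurable_funM => //; exact: measurable_funX.
  - move=> x; rewrite powR_sub2// real_normK ?num_real// mulrC ler_wpM2r ?sqr_ge0//.
    by apply: ler_powR2r => //; move: q2; lra.
rewrite ge0_intRZ ?powR_ge0//; last 2 first.
- exact: measurable_funX.
- by move=> x; exact: sqr_ge0.
rewrite [C * _]mulrC -!mulrA EFinM; apply: lee_wpmul2l.
  by rewrite lee_fin powR_ge0.
apply: (le_trans (HC j u m_u)); rewrite EFinM; apply: lee_wpmul2l => //.
by rewrite lee_fin ltW.
Qed.

Lemma sobolev_embedding : exists2 C : R, 0 < C & forall (M : R) u,
  measurable_fun setT u -> 0 < M -> (hs2 s u <= (M ^+ 2)%:E)%E ->
  (\int[mu]_x (`|u x| `^ q)%:E <= (C * M `^ q)%:E)%E.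
Proof.
have [A [C [k [A0 C0 k01 H]]]] := Lq_split_le.
exists (A + C); first exact: addr_gt0.
move=> M u m_u M0 uM.
have sM := le_trans (sqn_le_hs2 s u) uM.
have u2 : (sqn u < +oo)%E by apply: le_lt_trans sM _; rewrite ltry.
(* Cubes of level 0 have volume 1, so |E_0 u| <= |u|_2 <= M and delta = M is admissible. *)
apply: (le_trans (H M M 0%N u m_u M0 uM (ltW M0) _)).
  move=> x; rewrite -(@ler_pXn2r _ 2)// ?nnegrE ?(ltW M0)// real_normK ?num_real//.
  rewrite -lee_fin; apply: (le_trans (dproj_sq_le 0 x m_u u2)).
  by rewrite expr0 expr1n mul1e.
rewrite lee_fin expr0 mulr1 (powR_sub2 q2 (ltW M0)) le_eqVlt.
by apply/orP; left; apply/eqP; ring.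
Qed.

End embedding.

(** * Compactness of rotation invariant functions *)

Section radial_decay.
Context (R : realType) (N : nat).
Local Notation V := 'rV[R]_N.
Local Notation mu := (lebesgue_rV R N).
Implicit Types (u v : V -> R).

(* Only almost everywhere, so that the property is stable under [L^q] limits and
   under the choice of a representative. *)
Definition rot_inv u := forall T, euclidean_isometry T ->
  {ae mu, forall x, u (T x) = u x}.

Definition eball (x : V) (r : R) : set V := [set y | enorm (x - y) < r].

Lemma measurable_eball x r : measurable (eball x r).
Proof.
have me : measurable_fun setT (fun y : V => enorm (x - y)).
  by apply: measurable_enorm; exact: measurable_rVB.
have -> : eball x r = (fun y : V => enorm (x - y)) @^-1` `]-oo, r[%classic.
  by apply/seteqP; split => y; rewrite /= in_itv.
by rewrite -[X in measurable X]setTI; apply: me => //; exact: measurable_itv.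
Qed.

Definition ball_mass u r (x : V) : \bar R :=
  (\int[mu]_y (\1_(eball x r) y * u y ^+ 2)%:E)%E.

Lemma measurable_ball_mass u r x : measurable_fun setT u ->
  measurable_fun setT (fun y => \1_(eball x r) y * u y ^+ 2).
Proof.
move=> m_u; apply: measurable_funM; last exact: measurable_funX.
by apply: measurable_indic; exact: measurable_eball.
Qed.

Lemma ball_mass_isometry u r T x : measurable_fun setT u -> rot_inv u ->
  euclidean_isometry T -> ball_mass u r (T x) = ball_mass u r x.
Proof.
move=> m_u ru iT; have [mT dT _] := iT.
have m1 : measurable_fun setT (fun y => (\1_(eball (T x) r) y * u y ^+ 2)%:E).
  by apply/measurable_EFinP; exact: measurable_ball_mass.
have i0 z y : (0 <= (\1_(eball z r) y * u y ^+ 2)%:E)%E.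
  by rewrite lee_fin mulr_ge0 ?sqr_ge0.
have := measure_preserving_integral mT m1 (i0 (T x)).
rewrite /ball_mass => <-; apply: ge0_ae_eq_integral => //.
- exact: (measurableT_comp m1 mT.1).
- by apply/measurable_EFinP; exact: measurable_ball_mass.
- apply: filterS (ru T iT) => y uTy _; rewrite uTy; congr ((_ * _)%:E).
  rewrite !indicE; suff -> : (T y \in eball (T x) r) = (y \in eball x r) by [].
  by apply/idP/idP; rewrite !inE /eball /= dT.
Qed.

(** The second coordinate takes up the remaining length; here a second dimension is required. *)
Lemma sphere_point (r a : R) : (2 <= N)%N -> 0 <= a <= r ->
  exists2 x : V, enorm x = r & forall i : 'I_N, nat_of_ord i = 0%N -> x ord0 i = a.
Proof.
case: N => [|[|n]]// _ /andP[a0 ar].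
pose b := Num.sqrt (r ^+ 2 - a ^+ 2).
exists (\row_(i < n.+2) if nat_of_ord i == 0%N then a else if nat_of_ord i == 1%N then b else 0).
  apply/eqP; rewrite -(@eqrXn2 _ 2)// ?enorm_ge0 ?(le_trans a0)//; apply/eqP.
  rewrite sqr_enorm big_ord_recl big_ord_recl big1 ?addr0 => [|i _].
    rewrite !mxE/= sqr_sqrtr ?subr_ge0 ?lerXn2r ?nnegrE ?(le_trans a0)//.
    by rewrite addrC subrK.
  by rewrite !mxE/= expr0n.
by move=> i i0; rewrite mxE i0.
Qed.

Lemma sum_indic_disjoint_le1 T (I : finType) (A : I -> set T) x :
  (forall i j, A i x -> A j x -> i = j) -> \sum_(i : I) (\1_(A i) x : R) <= 1.
Proof.
move=> dA; have [[i Ai]|nA] := pselect (exists i, A i x).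
  rewrite (bigD1 i)//= big1 ?addr0 => [|j ji].
    by rewrite indicE; case: (_ \in _).
  rewrite indicE memNset//; apply: contra_not (negP ji) => Aj.
  by rewrite (dA _ _ Ai Aj).
rewrite big1 ?ler01// => i _; rewrite indicE memNset// => Ai.
by apply: nA; exists i.
Qed.

Lemma ball_mass_decay u r (K : nat) x : (2 <= N)%N -> measurable_fun setT u ->
  rot_inv u -> 0 <= r -> 2 * r * K%:R <= enorm x ->
  (K%:R%:E * ball_mass u r x <= sqn u)%E.
Proof.
move=> N2 m_u ru r0 Kx.
(* The centres have first coordinates 0, 2r, ..., 2r(K-1), so the open balls of radius [r] are
   disjoint; 2rK <= |x| places them all on the sphere of [x]. *)
have ex (i : 'I_K) : exists y : V, enorm y = enorm x /\
    forall k : 'I_N, nat_of_ord k = 0%N -> y ord0 k = 2 * r * i%:R.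
  have [|y ye yi] := @sphere_point (enorm x) (2 * r * i%:R) N2.
    rewrite !mulr_ge0//= (le_trans _ Kx)// ler_wpM2l ?mulr_ge0// ler_nat.
    exact: ltnW.
  by exists y.
have [y yP] := choice ex.
have hy i : ball_mass u r (y i) = ball_mass u r x.
  apply: (isometry_invariant_radial N2); last by have [] := yP i.
  by move=> T iT z; exact: ball_mass_isometry.
have -> : (K%:R%:E * ball_mass u r x = \sum_(i < K) ball_mass u r (y i))%E.
  rewrite (eq_bigr (fun=> ball_mass u r x)) => [|i _]; last exact: hy.
  rewrite -[in LHS](card_ord K) -sum1_card natr_sum -sumEFin ge0_sume_distrl//.
  by apply: eq_bigr => i _; rewrite mul1e.
rewrite /ball_mass -ge0_integral_sum//; last 2 first.
- by move=> i; apply/measurable_EFinP; exact: measurable_ball_mass.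
- by move=> i z _; rewrite lee_fin mulr_ge0 ?sqr_ge0.
have E z : (\sum_(i < K) (\1_(eball (y i) r) z * u z ^+ 2)%:E)%E =
    ((\sum_(i < K) \1_(eball (y i) r) z) * u z ^+ 2)%:E.
  by rewrite sumEFin mulr_suml.
under eq_integral do rewrite E.
apply: le_intR.
- apply: measurable_funM; last exact: measurable_funX.
  by apply: measurable_sum => i; apply: measurable_indic; exact: measurable_eball.
- exact: measurable_funX.
- by move=> z; rewrite mulr_ge0 ?sqr_ge0// sumr_ge0.
- move=> z; rewrite ler_piMl ?sqr_ge0//; apply: sum_indic_disjoint_le1.
  move=> i j; rewrite /eball /= => zi zj.
  have k0 : (0 < N)%N by exact: leq_trans N2.
  have [_ /(_ (Ordinal k0) erefl) yi] := yP i.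
  have [_ /(_ (Ordinal k0) erefl) yj] := yP j.
  have := le_lt_trans (normr_le_enorm _ (Ordinal k0)) zi.
  have := le_lt_trans (normr_le_enorm _ (Ordinal k0)) zj.
  rewrite !mxE yi yj !ltr_norml => /andP[h1 h2] /andP[h3 h4].
  have rp : 0 < r by lra.
  apply: contrapT => /eqP; rewrite -val_eqE /= neq_ltn => /orP[] ij.
    have : (i%:R + 1 <= j%:R :> R) by rewrite natr1 ler_nat.
    by nra.
  have : (j%:R + 1 <= i%:R :> R) by rewrite natr1 ler_nat.
  by nra.
Qed.

End radial_decay.

Section compactness.
Context (R : realType) (N : nat) (s q : R).
Local Notation V := 'rV[R]_N.
Local Notation mu := (lebesgue_rV R N).
Context (N2 : (2 <= N)%N) (s01 : 0 < s < 1)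
  (q2 : 2 < q) (qN : q * (N%:R - 2 * s) < 2 * N%:R).
Implicit Types (u v : V -> R).

Let q0 : 0 <= q. Proof. by apply: ltW; exact: lt_trans q2. Qed.

Lemma rot_invB u v : rot_inv u -> rot_inv v -> rot_inv (fun x => u x - v x).
Proof.
move=> ru rv T iT; apply: filterS2 (ru T iT) (rv T iT).
by move=> x -> ->.
Qed.

Lemma rot_inv_lim (u_ : nat -> V -> R) u : (forall n, rot_inv (u_ n)) ->
  {ae mu, forall x, u_ ^~ x @ \oo --> u x} -> rot_inv u.
Proof.
move=> ru cu T iT; have [mT _ _] := iT.
have cuT : {ae mu, forall x, u_ ^~ (T x) @ \oo --> u (T x)}.
  exact: (measure_preserving_ae mT cu).
have ruT : {ae mu, forall x, forall n, u_ n (T x) = u_ n x}.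
  by apply/ae_foralln => n; exact: ru.
apply: filterS3 cu cuT ruT => x c1 c2 e.
apply: (@cvg_unique _ _ (u_ ^~ x @ \oo)) => //.
by move: c2; under eq_fun do rewrite e.
Qed.

Lemma dprojB j u v x : in_hs s u -> in_hs s v ->
  dproj j (fun x => u x - v x) x = dproj j u x - dproj j v x.
Proof.
move=> hu hv; have [_ u2] := in_hs_lty hu; have [_ v2] := in_hs_lty hv.
have mE := @measurable_dcube R N j (dindex j x).
have muE := @lebesgue_rV_dcube R N j (dindex j x).
have muEoo : (mu (dcube j (dindex j x)) < +oo)%E by rewrite muE ltry.
have iu := integrable_sq hu.1 u2 mE muEoo.
have iv := integrable_sq hv.1 v2 mE muEoo.
rewrite /dproj /avg -mulrBl; congr (_ / _).
have := integralB_EFin mE iu iv => /= ->.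
by rewrite (integrable_intE mE iu) (integrable_intE mE iv).
Qed.

Lemma dproj_tail_le (M delta : R) j : 0 < M -> 0 < delta -> exists L : R,
  forall v x, measurable_fun setT v -> rot_inv v ->
    (hs2 s v <= (M ^+ 2)%:E)%E -> L <= enorm x -> `|dproj j v x| <= delta.
Proof.
move=> M0 d0.
(* The cube of [x] lies within sqrt N / 2^j of [x]; the extra 1 puts it inside the open ball. *)
pose r : R := Num.sqrt N%:R / 2 ^+ j + 1.
have r0 : 0 < r.
  by rewrite ltr_wpDl// divr_ge0 ?sqrtr_ge0// exprn_ge0.
(* With K > Q copies of the ball its mass is at most M^2 / K, which after division by the cube
   volume 2^(-jN) is below delta^2. *)
pose Q : R := 2 ^+ j ^+ N * M ^+ 2 / delta ^+ 2.
have Q0 : 0 <= Q by rewrite divr_ge0 ?sqr_ge0// mulr_ge0 ?sqr_ge0.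
pose K := Num.bound Q; exists (2 * r * K%:R) => v x mv rv vM Lx.
have sM := le_trans (sqn_le_hs2 s v) vM.
have v2 : (sqn v < +oo)%E by apply: le_lt_trans sM _; rewrite ltry.
have QK : Q < K%:R by exact: archi_boundP.
have K0 : 0 < K%:R :> R by exact: le_lt_trans QK.
have bm : (ball_mass v r x <= (K%:R^-1 * M ^+ 2)%:E)%E.
  have h := le_trans (ball_mass_decay N2 mv rv (ltW r0) Lx) sM.
  by rewrite mulrC EFinM lee_pdivlMr// muleC.
rewrite -(@ler_pXn2r _ 2)// ?nnegrE ?(ltW d0)// real_normK ?num_real// -lee_fin.
apply: (le_trans (dproj_sq_le_local j x mv v2)).
apply: (@le_trans _ _ ((2 ^+ j ^+ N)%:E * (K%:R^-1 * M ^+ 2)%:E)%E); last first.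
  rewrite -EFinM lee_fin [leLHS](_ : _ = (2 ^+ j ^+ N * M ^+ 2) / K%:R); last by ring.
  rewrite ler_pdivrMr// [leRHS]mulrC -ler_pdivrMr ?exprn_gt0//.
  exact: ltW.
apply: lee_wpmul2l; first by rewrite lee_fin exprn_ge0// exprn_ge0.
apply: le_trans bm; rewrite /ball_mass integral_mkcond.
apply: ge0_le_integral => //.
- by move=> y _; rewrite patchE; case: ifP => // _; rewrite lee_fin sqr_ge0.
- apply/(measurable_restrictT _ _).1; first exact: measurable_dcube.
  by apply: measurable_funTS; apply/measurable_EFinP; exact: measurable_funX mv.
- by apply/measurable_EFinP; exact: measurable_ball_mass.
- move=> y _; rewrite patchE; case: ifPn => [|_].
    rewrite inE /dcube /= => /esym /dindex_enorm xy.
    rewrite lee_fin indicE mem_set ?mul1r// /eball /=.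
    by apply: (le_lt_trans xy); rewrite /r ltrDl.
  by rewrite lee_fin mulr_ge0 ?sqr_ge0.
Qed.

Lemma finite_dindex (L : R) j : exists (I : finType) (z : I -> 'rV[int]_N),
  forall x : V, enorm x < L -> exists i, dindex j x = z i.
Proof.
have [L0|L0] := leP L 0.
  exists unit, (fun=> 0) => x xL; exfalso.
  by have := enorm_ge0 x; rewrite leNgt (lt_le_trans xL).
pose B := Num.bound (2 ^+ j * L).
have LB : 2 ^+ j * L < B%:R.
  by apply: archi_boundP; rewrite mulr_ge0 ?exprn_ge0// ltW.
exists {ffun 'I_N -> 'I_(B.*2.+1)}, (fun f : {ffun 'I_N -> 'I_(B.*2.+1)} =>
  \row_i (Posz (f i) - Posz B) : 'rV[int]_N) => x xL.
exists [ffun i => inord (absz (dindex j x ord0 i + Posz B))].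
apply/rowP => i; rewrite [RHS]mxE ffunE.
have xi : `|2 ^+ j * x ord0 i| <= B%:R.
  rewrite normrM ger0_norm ?exprn_ge0// (le_trans _ (ltW LB))//.
  by rewrite ler_wpM2l ?exprn_ge0// (le_trans (normr_le_enorm x i))// ltW.
have d1 : - B%:Z <= dindex j x ord0 i.
  by rewrite mxE floor_ge_int intrN; move: xi; rewrite ler_norml => /andP[].
have d2 : dindex j x ord0 i <= B%:Z.
  rewrite mxE -(ler_int R) (le_trans (floor_le _))//.
  by move: xi; rewrite ler_norml => /andP[].
have d0 : 0 <= dindex j x ord0 i + B%:Z by rewrite -lerBlDr sub0r.
rewrite inordK; first by rewrite gez0_abs// addrK.
by rewrite ltnS -lez_nat gez0_abs// -addnn PoszD lerD2r.
Qed.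

(** Order of the choices: [j], so that k^j disposes of the fine scales; [delta] for the averages;
    the radius [L] beyond which decay keeps the averages below [delta]. Finitely many cubes meet |x|
    < L, and on these the averages are Cauchy along the subsequence. *)
Lemma radial_compactness (u_ : nat -> V -> R) (M : R) : 0 < M ->
  (forall n, measurable_fun setT (u_ n)) -> (forall n, rot_inv (u_ n)) ->
  (forall n, (hs2 s (u_ n) <= (M ^+ 2)%:E)%E) ->
  exists phi : nat -> nat, (forall j, (j <= phi j)%N) /\
    forall e : R, 0 < e -> exists K, forall n m, (K <= n)%N -> (K <= m)%N ->
     (\int[mu]_x (`|u_ (phi n) x - u_ (phi m) x| `^ q)%:E <= e%:E)%E.
Proof.
move=> M0 mu_ ru uM.
have hu n : in_hs s (u_ n) by split => //; apply: le_lt_trans (uM n) _; rewrite ltry.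
have u2 n : (sqn (u_ n) < +oo)%E by have [] := in_hs_lty (hu n).
have un2 n : (sqn (u_ n) <= (M ^+ 2)%:E)%E by exact: le_trans (sqn_le_hs2 s _) (uM n).
(* One natural number encodes level and cube, so one extraction serves all cube averages; numbers
   that encode no pair get a harmless default. *)
pose idx k : nat * 'rV[int]_N := odflt (0%N, 0) (unpickle k).
pose a n k : R := avg mu (dcube (idx k).1 (idx k).2) (u_ n).
have dbound n j x : `|dproj j (u_ n) x| <= Num.sqrt (2 ^+ j ^+ N) * M.
  rewrite -(@ler_pXn2r _ 2)// ?nnegrE ?mulr_ge0 ?sqrtr_ge0 ?(ltW M0)//.
  rewrite real_normK ?num_real// [leRHS]exprMn sqr_sqrtr ?exprn_ge0// -lee_fin.
  apply: (le_trans (dproj_sq_le j x (mu_ n) (u2 n))); rewrite EFinM.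
  by apply: lee_wpmul2l; rewrite ?lee_fin ?exprn_ge0.
have aB n k : `|a n k| <= Num.sqrt (2 ^+ (idx k).1 ^+ N) * M.
  have [[x xk]|nx] := pselect (exists x : V, dindex (idx k).1 x = (idx k).2).
    by rewrite /a -xk; exact: dbound.
  have e0 : dcube (idx k).1 (idx k).2 = set0 :> set V.
    by apply/seteqP; split => x // xk; apply: nx; exists x.
  by rewrite /a /avg e0 measure0 /= invr0 mulr0 normr0 mulr_ge0 ?sqrtr_ge0// ltW.
have [phi [phiP cauchy]] := diagonal_subsequence aB.
exists phi; split => // e e0.
pose v n m x := u_ (phi n) x - u_ (phi m) x.
have mv n m : measurable_fun setT (v n m) by exact: measurable_funB.
have rv n m : rot_inv (v n m) by exact: rot_invB.
(* The cross term is bounded through Q(u_n + u_m) >= 0, whence Q(u_n - u_m) <= 2 Q(u_n) + 2 Q(u_m)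
   <= 4 M^2. *)
have vM n m : (hs2 s (v n m) <= ((2 * M) ^+ 2)%:E)%E.
  have e1 : v n m = (fun x => u_ (phi n) x + (- 1) * u_ (phi m) x).
    by apply/funext => x; rewrite /v mulN1r.
  rewrite e1 hs2_expand// lee_fin.
  have h1 : 0 <= qf s (fun x => u_ (phi n) x + 1 * u_ (phi m) x) by exact: qf_ge0.
  rewrite qf_expand// in h1.
  have qM k : qf s (u_ k) <= M ^+ 2 by rewrite -lee_fin -hs2E.
  by have := qM (phi n); have := qM (phi m); move: h1; nra.
have M20 : 0 < 2 * M by rewrite mulr_gt0.
have [A [C [k [A0 C0 /andP[k0 k1] H]]]] := Lq_split_le N2 s01 q2 qN.
have AM0 : 0 < A * (2 * M) `^ q by rewrite mulr_gt0 ?powR_gt0.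
have CM0 : 0 < C * (2 * M) ^+ 2 by rewrite mulr_gt0// exprn_gt0.
have [j kj] : exists j, A * (2 * M) `^ q * k ^+ j <= e / 2.
  have := @cvg_geometric R (A * (2 * M) `^ q) k; rewrite gtr0_norm// => /(_ k1).
  move=> /cvgrPdist_le/(_ (e / 2)); rewrite divr_gt0// => /(_ isT)[j _ /(_ j)].
  rewrite /= leqnn sub0r normrN => /(_ isT) jk; exists j.
  by rewrite (le_trans (ler_norm _)).
(* Solves C delta^(q-2) (2M)^2 = e/2. *)
pose delta : R := (e / 2 / (C * (2 * M) ^+ 2)) `^ (q - 2)^-1.
have q20 : 0 < q - 2 by rewrite subr_gt0.
have ec0 : 0 < e / 2 / (C * (2 * M) ^+ 2) by rewrite divr_gt0// divr_gt0.
have d0 : 0 < delta by rewrite powR_gt0.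
have dE : C * delta `^ (q - 2) * (2 * M) ^+ 2 = e / 2.
  rewrite /delta -powRrM mulVf ?gt_eqF// powRr1 ?(ltW ec0)//.
  by rewrite mulrAC mulrC divfK// gt_eqF.
have [L LP] := dproj_tail_le j M20 d0.
have [I [z zP]] := finite_dindex L j.
have [Ki KiP] := choice (fun i => cauchy (pickle (j, z i)) delta d0).
exists (\max_i Ki i) => n m Kn Km.
apply: (le_trans (H (2 * M) delta j (v n m) (mv n m) M20 (vM n m) (ltW d0) _)); last first.
  by rewrite dE lee_fin [leRHS]splitr lerD2r.
move=> x; have [xL|xL] := leP L (enorm x); first exact: LP.
have [i xi] := zP x xL; rewrite dprojB// /dproj xi.
have Kin := leq_trans (leq_bigmax i) Kn; have Kim := leq_trans (leq_bigmax i) Km.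
by have := KiP i n m Kin Kim; rewrite /a /idx pickleK.
Qed.

End compactness.

(** * Minimal norm elements of hyperplanes *)

Section minimal_norm.
Context (R : realType) (N : nat) (s : R).
Local Notation V := 'rV[R]_N.
Local Notation mu := (lebesgue_rV R N).
Implicit Types (u v w : V -> R).

Lemma qf_parallelogram u v : in_hs s u -> in_hs s v ->
  qf s (fun x => u x + v x) + qf s (fun x => u x - v x) = 2 * qf s u + 2 * qf s v.
Proof.
move=> hu hv.
have -> : (fun x => u x + v x) = (fun x => u x + 1 * v x).
  by apply/funext => x; rewrite mul1r.
have -> : (fun x => u x - v x) = (fun x => u x + (- 1) * v x).
  by apply/funext => x; rewrite mulN1r.
by rewrite !qf_expand//; ring.
Qed.

Lemma in_hsD u v : in_hs s u -> in_hs s v -> in_hs s (fun x => u x + v x).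
Proof.
move=> hu hv; have -> : (fun x => u x + v x) = (fun x => u x + 1 * v x).
  by apply/funext => x; rewrite mul1r.
exact: in_hs_lin.
Qed.

Lemma in_hsB u v : in_hs s u -> in_hs s v -> in_hs s (fun x => u x - v x).
Proof.
move=> hu hv; have -> : (fun x => u x - v x) = (fun x => u x + (- 1) * v x).
  by apply/funext => x; rewrite mulN1r.
exact: in_hs_lin.
Qed.

(** Read off from two expansions of Q(cu + cv); the comparison divides by [c], hence the separate
    case c = 0. *)
Lemma bfZ (c : R) u v : in_hs s u -> in_hs s v ->
  bf s (fun x => c * u x) v = c * bf s u v.
Proof.
move=> hu hv; have [->|c0] := eqVneq c 0.
  rewrite mul0r /bf [X in fine X + _](_ : _ = 0%E); last first.
    by apply: integral0_eq => z _; rewrite /quot !mul0r subrr !mul0r.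
  rewrite [X in _ + fine X](_ : _ = 0%E) ?addr0//.
  by apply: integral0_eq => z _; rewrite !mul0r.
have hcu := in_hsZ c hu.
have := qf_expand c hcu hv.
have -> : (fun x => c * u x + c * v x) = (fun x => c * (u x + 1 * v x)).
  by apply/funext => x; rewrite mul1r mulrDr.
rewrite !qfZ ?qf_expand//; last exact: in_hs_lin.
move=> h; have : 2 * c * (bf s (fun x => c * u x) v - c * bf s u v) = 0 by lra.
by move/eqP; rewrite !mulf_eq0 pnatr_eq0 (negbTE c0)/= subr_eq0 => /eqP.
Qed.

(** Convergence almost everywhere of a subsequence, obtained in L^2, identifies [w]; Fatou in n for
    w_n - w_m gives convergence in the full norm. The last conclusion passes bounds to the limit
    without a triangle inequality. *)
Lemma hs2_complete (w_ : nat -> V -> R) : (forall n, in_hs s (w_ n)) ->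
  (forall e : R, 0 < e -> exists K, forall n m, (K <= n)%N -> (K <= m)%N ->
     qf s (fun x => w_ n x - w_ m x) <= e) ->
  exists w, [/\ in_hs s w,
    forall e : R, 0 < e -> exists K, forall m, (K <= m)%N ->
      qf s (fun x => w x - w_ m x) <= e
    & forall (c : R) K, (forall m, (K <= m)%N -> qf s (w_ m) <= c) -> qf s w <= c].
Proof.
move=> hw cauchy.
have hnm n m : in_hs s (fun x => w_ n x - w_ m x) by exact: in_hsB.
have [|phi [w [phiP mw cw]]] := @Lq_cauchy_ae_subseq _ _ R mu 2 w_ (ltr0n R 2)
  (fun n => (hw n).1).
  move=> e e0; have [K KP] := cauchy e e0; exists K => n m Kn Km.
  under eq_integral do rewrite powR_mulrn// real_normK ?num_real//.
  apply: (le_trans (sqn_le_hs2 s (fun x => w_ n x - w_ m x))).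
  by rewrite hs2E// lee_fin KP.
have close e : 0 < e -> exists K, forall m, (K <= m)%N ->
    (hs2 s (fun x => (w x - w_ m x)%R) <= e%:E)%E.
  move=> e0; have [K KP] := cauchy e e0; exists K => m Km.
  apply: (@hs2_fatou _ _ _ (fun k x => w_ (phi k) x - w_ m x)).
  - by move=> n; exact: (hnm _ _).1.
  - by apply: measurable_funB => //; exact: (hw m).1.
  - by apply: filterS cw => x cx; apply: cvgB => //; exact: cvg_cst.
  - exists K => // n /= Kn; rewrite hs2E// lee_fin KP//.
    exact: leq_trans (phiP n).
have hwm m e : (hs2 s (fun x => (w x - w_ m x)%R) <= e%:E)%E ->
    in_hs s (fun x => w x - w_ m x).
  move=> h; split; last by apply: le_lt_trans h _; rewrite ltry.
  by apply: measurable_funB => //; exact: (hw m).1.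
have hww : in_hs s w.
  have [K KP] := close 1 ltr01.
  have -> : w = (fun x => (w x - w_ K x) + w_ K x) by apply/funext => x; rewrite subrK.
  by apply: in_hsD => //; apply: hwm (KP K (leqnn K)).
exists w; split => //.
  move=> e e0; have [K KP] := close e e0; exists K => m Km.
  by rewrite -lee_fin -hs2E ?KP//; apply: hwm (KP m Km).
move=> c K cP; rewrite -lee_fin -hs2E//.
apply: (@hs2_fatou _ _ _ (fun k x => w_ (phi k) x)) => //.
- by move=> n; exact: (hw _).1.
- by exists K => // n /= Kn; rewrite hs2E// lee_fin cP//; exact: leq_trans (phiP n).
Qed.

Context (L : (V -> R) -> R).
Context (L_lin : forall u v t, in_hs s u -> in_hs s v ->
  L (fun x => u x + t * v x) = L u + t * L v).
Context (L_bnd : exists2 C : R, 0 < C & forall M u, 0 < M -> in_hs s u ->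
  qf s u <= M ^+ 2 -> `|L u| <= C * M).

Lemma functional0 u : in_hs s u -> L (fun x => 0 * u x) = 0.
Proof.
move=> hu; transitivity (L (fun x => u x + (- 1) * u x)).
  by congr L; apply/funext => x; rewrite mul0r mulN1r subrr.
by rewrite L_lin// mulN1r subrr.
Qed.

Lemma functionalZ c u : in_hs s u -> L (fun x => c * u x) = c * L u.
Proof.
move=> hu; have h0 := in_hsZ 0 hu.
have := L_lin c h0 hu; rewrite functional0// add0r => <-.
by congr L; apply/funext => x; rewrite mul0r add0r.
Qed.

Lemma functionalB u v : in_hs s u -> in_hs s v -> L (fun x => u x - v x) = L u - L v.
Proof.
move=> hu hv; rewrite -mulN1r -L_lin//.
by congr L; apply/funext => x; rewrite mulN1r.
Qed.

(** Midpoints stay in the hyperplane, so by the parallelogram law a minimising sequence is Cauchy;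
    boundedness of [L] keeps the limit in the hyperplane. *)
Lemma minimal_norm_exists u0 : in_hs s u0 -> L u0 = 1 ->
  exists w, [/\ in_hs s w, L w = 1 & forall u, in_hs s u -> L u = 1 -> qf s w <= qf s u].
Proof.
move=> h0 L0; have [C C0 LC] := L_bnd.
pose S := [set qf s u | u in [set u | in_hs s u /\ L u = 1]].
have Slb : lbound S 0 by move=> _ [u _ <-]; exact: qf_ge0.
have Sinf : has_inf S by split; [exists (qf s u0), u0|exists 0].
pose I := inf S.
have IP u : in_hs s u -> L u = 1 -> I <= qf s u.
  by move=> hu Lu; apply: ge_inf; [exists 0|exists u].
have ex n : exists u, [/\ in_hs s u, L u = 1 & qf s u < I + n.+1%:R^-1].
  have n0 : 0 < n.+1%:R^-1 :> R by rewrite invr_gt0.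
  by have [_ [u [hu Lu] <-] ul] := inf_adherent n0 Sinf; exists u.
have [w_ wP] := choice ex.
have hw n : in_hs s (w_ n) by case: (wP n).
have Lw n : L (w_ n) = 1 by case: (wP n).
have diff n m : qf s (fun x => w_ n x - w_ m x) <= 2 * n.+1%:R^-1 + 2 * m.+1%:R^-1.
  have hs := in_hsD (hw n) (hw m).
  have h12 := in_hsZ (2^-1) hs.
  have Ls : L (fun x => 2^-1 * (w_ n x + w_ m x)) = 1.
    rewrite functionalZ//.
    have -> : (fun x => w_ n x + w_ m x) = (fun x => w_ n x + 1 * w_ m x).
      by apply/funext => x; rewrite mul1r.
    by rewrite L_lin// !Lw; field.
  have := IP _ h12 Ls; rewrite qfZ// => h.
  have := qf_parallelogram (hw n) (hw m).
  have [_ _ ln] := wP n; have [_ _ lm] := wP m.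
  move: h; rewrite expr2; move: ln lm; move: (n.+1%:R^-1) (m.+1%:R^-1) => a b.
  by lra.
have [|w [hww cw wc]] := hs2_complete hw.
  move=> e e0; exists (Num.bound (4 / e)) => n m Kn Km.
  have half k : (Num.bound (4 / e) <= k)%N -> 2 * k.+1%:R^-1 <= e / 2.
    move=> Kk; rewrite ler_pdivrMr// mulrAC ler_pdivlMr// -ler_pdivrMl//.
    have := archi_boundP (ltW (divr_gt0 (ltr0n R 4) e0)).
    move=> /ltW/le_trans h; have : 4 / e <= k.+1%:R.
      by apply: h; rewrite ler_nat ltnW.
    by rewrite (_ : e^-1 * (2 * 2) = 4 / e)//; field; rewrite gt_eqF.
  by rewrite (le_trans (diff n m))// [leRHS]splitr lerD// half.
exists w; have Lw1 : L w = 1.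
  apply/eqP; rewrite -subr_eq0 -normr_le0; apply/ler_addgt0Pr => e e0.
  rewrite add0r; have M0 : 0 < e / C by rewrite divr_gt0.
  have [K KP] := cw _ (exprn_gt0 2 M0).
  have := LC _ _ M0 (in_hsB hww (hw K)) (KP K (leqnn K)).
  by rewrite functionalB// Lw mulrC divfK// gt_eqF.
split => // u hu Lu; apply: le_trans (IP u hu Lu).
apply/ler_addgt0Pr => e e0; apply: (wc _ (Num.bound e^-1)) => m Km.
have [_ _ /ltW wm] := wP m; rewrite (le_trans wm)// lerD2l.
rewrite -[leRHS]invrK lef_pV2 ?posrE ?invr_gt0//.
have e1 : 0 <= e^-1 by rewrite invr_ge0 ltW.
by rewrite (le_trans (ltW (archi_boundP e1)))// ler_nat ltnW.
Qed.

Lemma minimal_norm_unique u w : in_hs s u -> in_hs s w -> L u = 1 -> L w = 1 ->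
  (forall v, in_hs s v -> L v = 1 -> qf s w <= qf s v) -> qf s u <= qf s w ->
  {ae mu, forall x, u x = w x}.
Proof.
move=> hu hw Lu Lw wmin uw.
have hD := in_hsD hu hw; have hB := in_hsB hu hw.
have h12 := in_hsZ (2^-1) hD.
have Ls : L (fun x => 2^-1 * (u x + w x)) = 1.
  rewrite functionalZ//.
  have -> : (fun x => u x + w x) = (fun x => u x + 1 * w x).
    by apply/funext => x; rewrite mul1r.
  by rewrite L_lin// Lu Lw; field.
have q0 : qf s (fun x => u x - w x) = 0.
  apply/eqP; rewrite eq_le qf_ge0 andbT.
  have := wmin _ h12 Ls; rewrite qfZ// => h.
  have := qf_parallelogram hu hw.
  by move: h uw; rewrite expr2; lra.
have n0 : (\int[mu]_x ((u x - w x) ^+ 2)%:E = 0)%E.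
  apply/eqP; rewrite eq_le; apply/andP; split; last exact: sqn_ge0.
  by apply: (le_trans (sqn_le_hs2 s (fun x => u x - w x))); rewrite hs2E// q0.
have mB := hB.1.
have := @ae_eq_integral_abs _ _ _ mu setT measurableT (fun x => ((u x - w x) ^+ 2)%:E).
case.
  by apply/measurable_EFinP; exact: measurable_funX.
move=> + _; under eq_integral do rewrite gee0_abs ?lee_fin ?sqr_ge0//.
move=> /(_ n0); apply: filterS => x /(_ I) /= [] /eqP.
by rewrite expf_eq0/= subr_eq0 => /eqP.
Qed.

(** In the homogeneous form I L(v)^2 <= Q(v) of minimality, w + t phi needs no renormalisation; a
    nonnegative quadratic in t that vanishes at 0 has no linear term. *)
Lemma euler_lagrange (w phi : V -> R) (I : R) : in_hs s w -> in_hs s phi ->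
  L w = 1 -> qf s w = I ->
  (forall v, in_hs s v -> I * L v ^+ 2 <= qf s v) -> bf s w phi = I * L phi.
Proof.
move=> hw hp Lw qI Imin; apply/eqP; rewrite -subr_eq0; apply/eqP.
set b := bf s w phi - _.
pose a : R := qf s phi - I * L phi ^+ 2.
have key t : 0 <= 2 * t * b + t ^+ 2 * a.
  have := Imin _ (in_hs_lin t hw hp); rewrite qf_expand// L_lin// Lw qI /b /a.
  by lra.
have a0 : 0 <= a by rewrite subr_ge0; exact: Imin.
(* The denominator is a + 1 because [a] may vanish. *)
have := key (- b / (a + 1)).
have a1 : 0 < a + 1 by lra.
have -> : 2 * (- b / (a + 1)) * b + (- b / (a + 1)) ^+ 2 * a =
    - (b ^+ 2 * (a + 2) / (a + 1) ^+ 2) by field; rewrite gt_eqF.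
rewrite oppr_ge0 => h.
have : b ^+ 2 * (a + 2) <= 0.
  by move: h; rewrite pmulr_lle0// invr_gt0 exprn_gt0.
rewrite pmulr_lle0; last by lra.
by move=> b2; apply/eqP; rewrite -sqrf_eq0 eq_le b2 sqr_ge0.
Qed.

End minimal_norm.

(** * Passing to the limit in the L^q integral *)

(** For small t the factor of a^q is close to 1, unlike the 2^q of [powR_addle], so a strict gap
    survives a small perturbation. The two cases split at b = t a. *)
Lemma powR_addle_weighted (R : realType) (t a b q : R) :
  0 < t -> 0 <= a -> 0 <= b -> 0 <= q ->
  (a + b) `^ q <= (1 + t) `^ q * a `^ q + (1 + t^-1) `^ q * b `^ q.
Proof.
move=> t0 a0 b0 q0; have t10 : 0 <= 1 + t^-1 by rewrite addr_ge0// invr_ge0 ltW.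
have t1 : 0 <= 1 + t by rewrite addr_ge0// ltW.
have [ab|ab] := leP b (t * a).
  apply: (@le_trans _ _ ((1 + t) `^ q * a `^ q)); last by rewrite lerDl mulr_ge0 ?powR_ge0.
  rewrite -powRM//; apply: ler_powR2r => //; first exact: addr_ge0.
  by rewrite mulrDl mul1r lerD2l.
apply: (@le_trans _ _ ((1 + t^-1) `^ q * b `^ q)); last by rewrite lerDr mulr_ge0 ?powR_ge0.
rewrite -powRM//; apply: ler_powR2r => //; first exact: addr_ge0.
by rewrite mulrDl mul1r addrC lerD2l mulrC ler_pdivlMr// mulrC ltW.
Qed.

(* [powR] is constant equal to 1 on negative bases, hence not continuous at 0. *)
Lemma cvg_powR_ge0 (R : realType) (a : nat -> R) (l q : R) : 0 < q ->
  (forall n, 0 <= a n) -> a @ \oo --> l -> (fun n => a n `^ q) @ \oo --> l `^ q.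
Proof.
move=> q0 a0 al; have l0 : 0 <= l.
  rewrite -(cvg_lim (@Rhausdorff R) al); apply: limr_ge; first exact: (cvgP _ al).
  exact: nearW.
move: l0; rewrite le_eqVlt => /predU1P[l0|l0]; last first.
  have dl : derivable (@powR R ^~ q) l 1.
    by apply: derivable_powR; rewrite in_itv/= andbT.
  have cl : (@powR R ^~ q) x @[x --> l] --> l `^ q.
    by move: dl => /derivable1_diffP/differentiable_continuous.
  exact: (cvg_comp _ _ al cl).
rewrite -l0 powR0 ?gt_eqF// in al *.
apply/cvgrPdist_le => e e0.
have d0 : 0 < e `^ q^-1 by rewrite powR_gt0.
move/cvgrPdist_le : al => /(_ _ d0); apply: filterS => n.
rewrite !sub0r !normrN !ger0_norm ?powR_ge0// => ane.
rewrite (le_trans (ler_powR2r (ltW q0) (a0 n) ane))//.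
by rewrite -powRrM mulVf ?gt_eqF// powRr1// ltW.
Qed.

Section Lq_limit.
Context d (T : measurableType d) (R : realType) (mu : {measure set T -> \bar R}).

(** Supplies the direction opposite to Fatou: a maximising sequence cannot converge in L^q to a
    function whose integral stays below the supremum. *)
Lemma Lq_limit_lt (q Lam : R) (u_ : nat -> T -> R) (v : T -> R) : 0 < q -> 0 < Lam ->
  (forall n, measurable_fun setT (u_ n)) -> measurable_fun setT v ->
  (forall e : R, 0 < e -> exists K, forall n, (K <= n)%N ->
     (\int[mu]_x (`|u_ n x - v x| `^ q)%:E <= e%:E)%E) ->
  (\int[mu]_x (`|v x| `^ q)%:E < Lam%:E)%E ->
  exists2 L : R, L < Lam & exists K, forall n, (K <= n)%N ->
     (\int[mu]_x (`|u_ n x| `^ q)%:E <= L%:E)%E.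
Proof.
move=> q0 Lam0 mu_ mv cv.
have i0 : (0 <= \int[mu]_x (`|v x| `^ q)%:E)%E.
  by apply: integral_ge0 => x _; rewrite lee_fin powR_ge0.
move=> vLam; have fv : (\int[mu]_x (`|v x| `^ q)%:E)%E \is a fin_num.
  by rewrite ge0_fin_numE// (lt_trans vLam)// ltry.
move: vLam i0; rewrite -(fineK fv); set F := fine _; rewrite lte_fin lee_fin => FL F0.
(* [f] is a positive majorant of [F], which may be 0. With (1 + t)^q = y/f the main term is at most
   y, and z - y is left for the error. *)
pose f := (F + Lam) / 2; pose y := (f + Lam) / 2; pose z := (y + Lam) / 2.
have Ff : F < f by rewrite /f; lra.
have f0 : 0 < f by lra.
have fy : f < y by rewrite /y /f; lra.
have yz : y < z by rewrite /z /y /f; lra.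
have zL : z < Lam by rewrite /z /y /f; lra.
pose t := (y / f) `^ q^-1 - 1.
have t0 : 0 < t.
  have e1 : 1 `^ q^-1 = 1 :> R by rewrite powR1.
  rewrite subr_gt0 -[ltLHS]e1; apply: gt0_ltr_powR; rewrite ?invr_gt0 ?nnegrE//.
    by rewrite divr_ge0 ?ltW// (lt_trans f0).
  by rewrite ltr_pdivlMr// mul1r.
have tE : (1 + t) `^ q = y / f.
  rewrite /t addrC subrK -powRrM mulVf ?gt_eqF// powRr1// divr_ge0 ?ltW//.
  exact: lt_trans fy.
have c0 : 0 < (1 + t^-1) `^ q by rewrite powR_gt0// addr_gt0// invr_gt0.
exists z => //; have [|K KP] := cv ((z - y) / (1 + t^-1) `^ q).
  by rewrite divr_gt0// subr_gt0.
exists K => n Kn.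
have mn (w : T -> R) : measurable_fun setT w -> measurable_fun setT (fun x => `|w x| `^ q).
  exact: measurable_norm_powR.
have mB : measurable_fun setT (fun x => u_ n x - v x) by exact: measurable_funB.
apply: (@le_trans _ _ (\int[mu]_x ((1 + t) `^ q * `|v x| `^ q +
    (1 + t^-1) `^ q * `|u_ n x - v x| `^ q)%:E)%E).
  apply: le_intR.
  - exact: mn.
  - by apply: measurable_funD; apply: measurable_funM => //; exact: mn.
  - by move=> x; exact: powR_ge0.
  - move=> x; apply: le_trans (powR_addle_weighted t0 _ _ (ltW q0)) => //.
    apply: ler_powR2r => //; first exact: ltW.
    by rewrite -{1}[u_ n x](subrK (v x)) addrC ler_normD.
rewrite ge0_intRD; last 4 first.
- by apply: measurable_funM => //; exact: mn.
- by apply: measurable_funM => //; exact: mn.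
- by move=> x; rewrite mulr_ge0 ?powR_ge0.
- by move=> x; rewrite mulr_ge0 ?powR_ge0.
rewrite !ge0_intRZ ?powR_ge0//; try exact: mn; try by move=> x; exact: powR_ge0.
apply: (@le_trans _ _ ((y / f)%:E * F%:E + ((1 + t^-1) `^ q)%:E *
    ((z - y) / (1 + t^-1) `^ q)%:E)%E).
  apply: leeD; first by rewrite tE -(fineK fv).
  by apply: lee_wpmul2l; [rewrite lee_fin powR_ge0|exact: KP].
rewrite -!EFinM -EFinD lee_fin [X in _ + X]mulrC divfK ?gt_eqF//.
rewrite -lerBrDr opprB addrCA subrr addr0 mulrAC ler_pdivrMr// ler_wpM2l// ltW//.
exact: lt_trans fy.
Qed.

End Lq_limit.

(** * Existence of a ground state *)

Section maximiser.
Context (R : realType) (N : nat) (s q : R).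
Local Notation V := 'rV[R]_N.
Local Notation mu := (lebesgue_rV R N).
Context (N2 : (2 <= N)%N) (s01 : 0 < s < 1)
  (q2 : 2 < q) (qN : q * (N%:R - 2 * s) < 2 * N%:R).
Implicit Types (u v : V -> R).

Let q0 : 0 < q. Proof. exact: lt_trans q2. Qed.

Lemma maximiser_exists u0 : measurable_fun setT u0 -> rot_inv u0 ->
  (hs2 s u0 <= 1)%E -> (0 < \int[mu]_x (`|u0 x| `^ q)%:E)%E ->
  exists (v : V -> R) (Lam : R), [/\ 0 < Lam,
    [/\ measurable_fun setT v, rot_inv v, (hs2 s v <= 1)%E & forall x, 0 <= v x],
    (\int[mu]_x (v x `^ q)%:E = Lam%:E)%E &
    forall u, measurable_fun setT u -> rot_inv u -> (hs2 s u <= 1)%E ->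
      (\int[mu]_x (`|u x| `^ q)%:E <= Lam%:E)%E].
Proof.
move=> m0 r0 h0 F0; have [C C0 HC] := sobolev_embedding N2 s01 q2 qN.
pose X := [set u : V -> R | [/\ measurable_fun setT u, rot_inv u & (hs2 s u <= 1)%E]].
pose F u := fine (\int[mu]_x (`|u x| `^ q)%:E)%E.
have i0 u : (0 <= \int[mu]_x (`|u x| `^ q)%:E)%E.
  by apply: integral_ge0 => x _; rewrite lee_fin powR_ge0.
have FC u : X u -> (\int[mu]_x (`|u x| `^ q)%:E <= C%:E)%E.
  move=> [m_u _ hu]; have := HC 1 u m_u ltr01; rewrite expr1n powR1 mulr1.
  by apply.
have FE u : X u -> (\int[mu]_x (`|u x| `^ q)%:E = (F u)%:E)%E.
  move=> Xu; rewrite fineK// ge0_fin_numE//; apply: le_lt_trans (FC u Xu) _.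
  by rewrite ltry.
have Sub : ubound (F @` X) C.
  by move=> _ [u Xu <-]; rewrite -lee_fin -FE//; exact: FC.
have Ssup : has_sup (F @` X) by split; [exists (F u0), u0|exists C].
pose Lam := sup (F @` X).
have LamP u : X u -> F u <= Lam by move=> Xu; apply: ub_le_sup; [exists C|exists u].
have X0 : X u0 by [].
have Lam0 : 0 < Lam by rewrite (lt_le_trans _ (LamP _ X0))// -lte_fin -FE.
have ex n : exists u, X u /\ Lam - n.+1%:R^-1 < F u.
  have n0 : 0 < n.+1%:R^-1 :> R by rewrite invr_gt0.
  by have [_ [u Xu <-] ul] := sup_adherent n0 Ssup; exists u.
have [u_ uP] := choice ex.
have Xu n : X (u_ n) by case: (uP n).
have mu_ n : measurable_fun setT (u_ n) by case: (Xu n).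
have ru n : rot_inv (u_ n) by case: (Xu n).
have hu n : (hs2 s (u_ n) <= (1 ^+ 2)%:E)%E by rewrite expr1n; case: (Xu n).
have [phi [phiP cauchy]] := radial_compactness N2 s01 q2 qN ltr01 mu_ ru hu.
have [psi [v [psiP mv cv]]] := Lq_cauchy_ae_subseq q0 (fun n => mu_ (phi n)) cauchy.
have hv : (hs2 s v <= 1)%E.
  apply: (hs2_fatou (fun n => mu_ (phi (psi n))) mv cv).
  by apply: nearW => n; have := hu (phi (psi n)); rewrite expr1n.
have rv : rot_inv v by exact: (rot_inv_lim (fun n => ru (phi (psi n))) cv).
(* Fatou along [psi], where convergence holds almost everywhere, upgrades the Cauchy property to L^q
   convergence of the whole sequence u_(phi n). *)
have close e : 0 < e -> exists K, forall n, (K <= n)%N ->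
    (\int[mu]_x (`|u_ (phi n) x - v x| `^ q)%:E <= e%:E)%E.
  move=> e0; have [K KP] := cauchy e e0; exists K => n Kn.
  apply: (@fatou_le _ _ _ _ (fun k x => `|u_ (phi n) x - u_ (phi (psi k)) x| `^ q)).
  - by move=> k; apply: measurable_norm_powR; exact: measurable_funB.
  - by apply: measurable_norm_powR; exact: measurable_funB.
  - by move=> k x; exact: powR_ge0.
  - by move=> x; exact: powR_ge0.
  - apply: filterS cv => x cx.
    have c1 : (fun k => `|u_ (phi n) x - u_ (phi (psi k)) x|) @ \oo --> `|u_ (phi n) x - v x|.
      by apply: cvg_norm; apply: cvgB => //; exact: cvg_cst.
    exact: cvg_powR_ge0.
  - by exists K => // k /= Kk; apply: KP => //; exact: leq_trans (psiP k).
have Xv : X v by [].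
have Fv : F v = Lam.
  apply/eqP; rewrite eq_le LamP//= leNgt; apply/negP => FvL.
  have [|L LL [K KP]] := Lq_limit_lt q0 Lam0 (fun n => mu_ (phi n)) mv close.
    by rewrite FE// lte_fin.
  have LL0 : 0 < Lam - L by rewrite subr_gt0.
  pose m := maxn K (Num.bound (Lam - L)^-1).
  have := KP m (leq_maxl _ _); rewrite FE// lee_fin leNgt => /negP; apply.
  have [_] := uP (phi m); apply: le_lt_trans; rewrite lerBrDr -lerBrDl.
  rewrite -[leRHS]invrK lef_pV2 ?posrE ?invr_gt0//.
  have e1 : 0 <= (Lam - L)^-1 by rewrite invr_ge0 ltW.
  rewrite (le_trans (ltW (archi_boundP e1)))// ler_nat ltnW// ltnS.
  by rewrite (leq_trans (leq_maxr K _))// phiP.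
(* The absolute value leaves the L^q integral unchanged and does not increase Q. *)
exists (fun x => `|v x|), Lam; split => //.
- split => //.
  + exact: measurableT_comp.
  + by move=> T iT; apply: filterS (rv T iT) => x ->.
  + apply: le_trans hv; apply: (@hs2_contraction R N s Num.norm v) => //.
      by move=> a b; exact: ler_dist_dist.
    by rewrite normr0.
- by rewrite FE// Fv.
- by move=> u m_u ru1 hu1; rewrite FE// lee_fin LamP.
Qed.

End maximiser.

Lemma measure_preserving_integral_signed d1 d2 (T1 : measurableType d1)
    (T2 : measurableType d2) (R : realType) (m1 : {measure set T1 -> \bar R})
    (m2 : {measure set T2 -> \bar R}) f (h : T2 -> \bar R) :
  measure_preserving m1 m2 f -> measurable_fun setT h ->
  (\int[m1]_x h (f x) = \int[m2]_x h x)%E.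
Proof.
move=> mf mh; rewrite integralE [RHS]integralE; congr (_ - _)%E.
  rewrite -(measure_preserving_integral mf (measurable_funepos mh) (fun x => funepos_ge0 _ x)).
  by apply: eq_integral => x _; rewrite -[LHS]/((h \o f)^\+%E x) funepos_comp.
rewrite -(measure_preserving_integral mf (measurable_funeneg mh) (fun x => funeneg_ge0 _ x)).
by apply: eq_integral => x _; rewrite -[LHS]/((h \o f)^\-%E x) funeneg_comp.
Qed.

Section powR_products.
Context (R : realType) (q : R).
Context (q1 : 1 < q).

Let q0 : 0 < q. Proof. exact: lt_trans q1. Qed.

Lemma powR_predM (a : R) : 0 <= a -> a `^ (q - 1) * a = a `^ q.
Proof. by move=> a0; rewrite mulrC mulr_powRB1. Qed.

Lemma powR_pred_mul_le (a b : R) : 0 <= a -> 0 <= b ->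
  a `^ (q - 1) * b <= a `^ q + b `^ q.
Proof.
move=> a0 b0; have [ab|/ltW ba] := leP a b.
  rewrite -[b `^ q](powR_predM b0) -[leLHS]add0r; apply: lerD; first exact: powR_ge0.
  by rewrite ler_wpM2r// ler_powR2r// subr_ge0 ltW.
rewrite -[a `^ q](powR_predM a0) -[leLHS]addr0; apply: lerD; last exact: powR_ge0.
by rewrite ler_wpM2l ?powR_ge0.
Qed.

(** Young with exponents q/(q-1) and q. The coefficients add up to 1, which gives the exact bound L
    z <= Lam; the cruder [powR_pred_mul_le] serves integrability and boundedness. *)
Lemma powR_pred_young (a b : R) : 0 <= a -> 0 <= b ->
  a `^ (q - 1) * b <= (1 - q^-1) * a `^ q + q^-1 * b `^ q.
Proof.
move=> a0 b0; have q10 : 0 < q - 1 by rewrite subr_gt0.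
have p0 : 0 < q / (q - 1) by rewrite divr_gt0.
have := @conjugate_powR R (a `^ (q - 1)) b (q / (q - 1)) q (powR_ge0 _ _) b0 p0 q0.
rewrite -powRrM mulrCA divff ?gt_eqF// mulr1 invf_div => h.
apply: le_trans (h _) _; first by field; rewrite !gt_eqF.
by rewrite le_eqVlt; apply/orP; left; apply/eqP; field; rewrite gt_eqF.
Qed.

End powR_products.

(** * From the maximiser to a solution *)

Section ground_state.
Context (R : realType) (N : nat) (s q : R).
Local Notation V := 'rV[R]_N.
Local Notation mu := (lebesgue_rV R N).
Context (N2 : (2 <= N)%N) (s01 : 0 < s < 1)
  (q2 : 2 < q) (qN : q * (N%:R - 2 * s) < 2 * N%:R).
Implicit Types (u v w phi : V -> R).

Let q1 : 1 < q. Proof. by apply: lt_trans q2; rewrite ltr1n. Qed.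
Let q0 : 0 < q. Proof. exact: lt_trans q2. Qed.

Lemma in_hs_Lq phi : in_hs s phi -> (\int[mu]_x (`|phi x| `^ q)%:E < +oo)%E.
Proof.
move=> hp; have [C C0 HC] := sobolev_embedding N2 s01 q2 qN.
have M0 : 0 < Num.sqrt (qf s phi) + 1 by rewrite ltr_wpDl ?sqrtr_ge0.
apply: le_lt_trans (HC _ phi hp.1 M0 _) _; last by rewrite ltry.
rewrite hs2E// lee_fin sqrrD expr1n mulr1 sqr_sqrtr ?qf_ge0// -addrA lerDl.
by rewrite addr_ge0// mulrn_wge0 ?sqrtr_ge0.
Qed.

Lemma integrable_powR_mul v phi : in_hs s v -> (forall x, 0 <= v x) ->
  in_hs s phi -> mu.-integrable setT (EFin \o (fun x => v x `^ (q - 1) * phi x)).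
Proof.
move=> hv v0 hp; have mvq : measurable_fun setT (fun x => v x `^ (q - 1)).
  exact: (measurableT_comp (measurable_powR _) hv.1).
have mf : measurable_fun setT (fun x => v x `^ (q - 1) * phi x).
  by apply: measurable_funM => //; exact: hp.1.
have mb : measurable_fun setT (fun x => `|v x| `^ q + `|phi x| `^ q).
  by apply: measurable_funD; apply: measurable_norm_powR; [exact: hv.1|exact: hp.1].
apply/integrableP; split; first exact/measurable_EFinP.
apply: (@le_lt_trans _ _ (\int[mu]_x (`|v x| `^ q + `|phi x| `^ q)%:E)%E).
  apply: le_intR => //; first exact: measurableT_comp.
  move=> x; rewrite normrM ger0_norm ?powR_ge0// (ger0_norm (v0 x)).
  exact: powR_pred_mul_le.
rewrite ge0_intRD; try by move=> x; exact: powR_ge0.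
- by rewrite lte_add_pinfty// in_hs_Lq.
- by apply: measurable_norm_powR; exact: hv.1.
- by apply: measurable_norm_powR; exact: hp.1.
Qed.

Context (v : V -> R) (Lam : R).
Context (Lam0 : 0 < Lam) (mv : measurable_fun setT v) (rv : rot_inv v)
  (hv1 : (hs2 s v <= 1)%E) (v0 : forall x, 0 <= v x)
  (vLam : (\int[mu]_x (v x `^ q)%:E = Lam%:E)%E)
  (vmax : forall u, measurable_fun setT u -> rot_inv u -> (hs2 s u <= 1)%E ->
    (\int[mu]_x (`|u x| `^ q)%:E <= Lam%:E)%E).

Let hv : in_hs s v. Proof. by split=> //; apply: le_lt_trans hv1 _; rewrite ltry. Qed.

Let L phi : R := fine (\int[mu]_x (v x `^ (q - 1) * phi x)%:E)%E.

Let iL phi : in_hs s phi ->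
  mu.-integrable setT (EFin \o (fun x => v x `^ (q - 1) * phi x)).
Proof. exact: integrable_powR_mul. Qed.

Let LE phi : in_hs s phi -> (\int[mu]_x (v x `^ (q - 1) * phi x)%:E = (L phi)%:E)%E.
Proof.
by move=> hp; rewrite /L fineK//; apply: integrable_fin_num => //; exact: iL.
Qed.

Let L_lin u phi t : in_hs s u -> in_hs s phi ->
  L (fun x => u x + t * phi x) = L u + t * L phi.
Proof.
move=> hu hp; have := LE (in_hs_lin t hu hp).
have -> : (\int[mu]_x (v x `^ (q - 1) * (u x + t * phi x))%:E =
  \int[mu]_x ((EFin \o (fun x => (v x `^ (q - 1) * u x)%R)) x +
    t%:E * (EFin \o (fun x => (v x `^ (q - 1) * phi x)%R)) x))%E.
  by apply: eq_integral => x _; rewrite /= -EFinM -EFinD; congr EFin; ring.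
have it : mu.-integrable setT (fun x => t%:E * (EFin \o (fun x => v x `^ (q - 1) * phi x)%R) x)%E.
  by apply: integrableZl => //; exact: iL.
rewrite (integralD measurableT (iL hu) it) (integralZl measurableT (iL hp)).
by rewrite [X in (X + _)%E](LE hu) [X in (_ * X)%E](LE hp) -EFinM -EFinD => -[].
Qed.

Let L_bnd : exists2 C : R, 0 < C & forall M u, 0 < M -> in_hs s u ->
  qf s u <= M ^+ 2 -> `|L u| <= C * M.
Proof.
have [C C0 HC] := sobolev_embedding N2 s01 q2 qN.
exists (Lam + C); first exact: addr_gt0.
move=> M u M0 hu uM; pose z x := M^-1 * u x.
have hz : in_hs s z by exact: in_hsZ.
have z1 : (hs2 s z <= 1)%E.
  rewrite hs2E// lee_fin qfZ// exprVn mulrC ler_pdivrMr ?exprn_gt0//.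
  by rewrite mul1r.
have uz : u = (fun x => M * z x).
  by apply/funext => x; rewrite /z mulrA divff ?mul1r// gt_eqF.
have -> : L u = M * L z by rewrite {1}uz (functionalZ L_lin).
rewrite normrM (gtr0_norm M0) mulrC ler_pM2r// -lee_fin.
rewrite -abse_EFin -LE//; apply: (le_trans (le_abse_integral _ _ _)) => //.
  by have /integrableP[] := iL hz.
apply: (@le_trans _ _ (\int[mu]_x (v x `^ q + `|z x| `^ q)%:E)%E).
  apply: le_intR => //.
  - by apply: measurableT_comp => //; have /integrableP[/measurable_EFinP] := iL hz.
  - apply: measurable_funD; last by apply: measurable_norm_powR; exact: hz.1.
    exact: (measurableT_comp (measurable_powR _) mv).
  - move=> x; rewrite normrM ger0_norm ?powR_ge0//.
    exact: powR_pred_mul_le.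
rewrite ge0_intRD; try by move=> x; exact: powR_ge0.
- rewrite vLam EFinD leeD2l//.
  by have := HC 1 z hz.1 ltr01; rewrite expr1n powR1 mulr1; apply.
- exact: (measurableT_comp (measurable_powR _) mv).
- by apply: measurable_norm_powR; exact: hz.1.
Qed.

Let Lv : L v = Lam.
Proof.
by rewrite /L; under eq_integral do rewrite powR_predM//; rewrite vLam.
Qed.

Let L_isometry w T : in_hs s w -> euclidean_isometry T -> L (w \o T) = L w.
Proof.
move=> hw iT; have [mT _ _] := iT; have mw := hw.1.
have mf : measurable_fun setT (fun x => (v x `^ (q - 1) * w x)%:E).
  by have /integrableP[] := iL hw.
congr fine; rewrite -(measure_preserving_integral_signed mT mf).
apply: ae_eq_integral => //.
- apply/measurable_EFinP; apply: measurable_funM.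
    exact: (measurableT_comp (measurable_powR _) mv).
  by apply: measurableT_comp => //; exact: mT.1.
- exact: (measurableT_comp mf mT.1).
- by apply: filterS (rv iT) => x e _ /=; rewrite e.
Qed.

(* [I] is the minimum of [qf] on the hyperplane [L = 1]; it is attained at [v / Lam]. *)
Lemma constrained_minimum : exists I : R, [/\ 0 < I, qf s v = I * Lam ^+ 2 &
  forall u, in_hs s u -> I * L u ^+ 2 <= qf s u].
Proof.
have hv' := in_hsZ Lam^-1 hv.
have Lv' : L (fun x => Lam^-1 * v x) = 1.
  by rewrite (functionalZ L_lin)// Lv mulVf// gt_eqF.
have [w [hw Lw wmin]] := minimal_norm_exists L_lin L_bnd hv' Lv'.
have rw : rot_inv w.
  move=> T iT; have mT : measurable_fun setT T by have [[]] := iT.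
  have hwT : hs2 s (w \o T) = hs2 s w by apply: hs2_comp_isometry => //; exact: hw.1.
  have hwT' : in_hs s (w \o T).
    by split; [exact: measurableT_comp hw.1 mT|rewrite hwT; exact: hw.2].
  apply: (minimal_norm_unique L_lin hwT' hw _ Lw wmin).
    by rewrite L_isometry.
  by rewrite /qf hwT.
have w0 : 0 < qf s w.
  rewrite lt_neqAle qf_ge0 andbT; apply/eqP => q00.
  have [C C0 HC] := L_bnd.
  (* If Q w were 0, boundedness of [L] at this scale would give 1 = |L w| <= 1/2. *)
  have M0 : 0 < (2 * C)^-1 by rewrite invr_gt0 mulr_gt0.
  have := HC _ w M0 hw; rewrite -q00 Lw normr1 => /(_ (sqr_ge0 _)).
  rewrite invfM mulrCA divff ?gt_eqF// mulr1 => h.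
  by have : (1 : R) <= 2^-1 := h; lra.
pose M := Num.sqrt (qf s w); have M0 : 0 < M by rewrite sqrtr_gt0.
have M2 : M ^+ 2 = qf s w by rewrite sqr_sqrtr// ltW.
pose z x := M^-1 * w x; have hz : in_hs s z by exact: in_hsZ.
have z1 : (hs2 s z <= 1)%E.
  by rewrite hs2E// lee_fin qfZ// -M2 exprVn mulVf// gt_eqF// exprn_gt0.
have rz : rot_inv z by move=> T iT; apply: filterS (rw T iT) => x e; rewrite /z e.
have zLam := vmax hz.1 rz z1.
have Lz : L z <= Lam.
  have mvq : measurable_fun setT (fun x => v x `^ q).
    exact: (measurableT_comp (measurable_powR _) mv).
  have mzq : measurable_fun setT (fun x => `|z x| `^ q).
    by apply: measurable_norm_powR; exact: hz.1.
  rewrite -lee_fin -LE//; apply: (le_trans (lee_abs _)).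
  apply: (le_trans (le_abse_integral _ _ _)) => //; first by have /integrableP[] := iL hz.
  apply: (@le_trans _ _ (\int[mu]_x ((1 - q^-1) * v x `^ q + q^-1 * `|z x| `^ q)%:E)%E).
    apply: le_intR => //.
    - by apply: measurableT_comp => //; have /integrableP[/measurable_EFinP] := iL hz.
    - by apply: measurable_funD; apply: measurable_funM.
    - move=> x; rewrite normrM ger0_norm ?powR_ge0//.
      exact: powR_pred_young.
  have iq : 0 <= q^-1 by rewrite invr_ge0 ltW.
  have iq1 : 0 <= 1 - q^-1 by rewrite subr_ge0 invf_le1// ltW.
  rewrite ge0_intRD//; last 4 first.
  - exact: measurable_funM.
  - exact: measurable_funM.
  - by move=> x; rewrite mulr_ge0 ?powR_ge0.
  - by move=> x; rewrite mulr_ge0 ?powR_ge0.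
  rewrite !ge0_intRZ//; try by move=> x; exact: powR_ge0.
  rewrite vLam; apply: (@le_trans _ _ ((1 - q^-1)%:E * Lam%:E + q^-1%:E * Lam%:E)%E).
    by rewrite leeD2l//; apply: lee_wpmul2l.
  by rewrite -!EFinM -EFinD lee_fin -mulrDl subrK mul1r.
have LamM : 1 <= Lam * M.
  by move: Lz; rewrite (functionalZ L_lin)// Lw mulr1 -ler_pdivrMr// mul1r.
(* Here Q v <= 1 meets 1 <= Lam |w|, so that v / Lam is no longer than [w]. *)
have Iv : qf s v <= qf s w * Lam ^+ 2.
  have v1 : qf s v <= 1 by rewrite -lee_fin -hs2E.
  apply: (le_trans v1); rewrite -M2 -exprMn mulrC.
  by rewrite -[leLHS](expr1n _ 2) lerXn2r// nnegrE ?ler01// ltW// mulr_gt0.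
exists (qf s w); split => //.
  apply/eqP; rewrite eq_le Iv/=.
  have := wmin _ hv' Lv'; rewrite qfZ// exprVn mulrC ler_pdivlMr ?exprn_gt0//.
move=> u hu; have [L0|L0] := eqVneq (L u) 0.
  by rewrite L0 expr0n mulr0 qf_ge0.
have Lu' : L (fun x => (L u)^-1 * u x) = 1 by rewrite (functionalZ L_lin)// mulVf.
have := wmin _ (in_hsZ (L u)^-1 hu) Lu'.
by rewrite qfZ// exprVn mulrC ler_pdivlMr// exprn_even_gt0.
Qed.

Lemma ground_state_exists : exists u, [/\ in_hs s u, rot_inv u,
  forall x, 0 <= u x, ~ {ae mu, forall x, u x = 0} &
  forall phi, in_hs s phi ->
    bf s u phi = fine (\int[mu]_x (u x `^ (q - 1) * phi x)%:E)%E].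
Proof.
have [I [I0 vI Imin]] := constrained_minimum.
(* The Lagrange multiplier: [v] solves the equation with the factor [k] on the right. *)
pose k : R := I * Lam; have k0 : 0 < k by rewrite mulr_gt0.
have bv phi : in_hs s phi -> bf s v phi = k * L phi.
  move=> hp; have hv' := in_hsZ Lam^-1 hv.
  have Lv' : L (fun x => Lam^-1 * v x) = 1.
    by rewrite (functionalZ L_lin)// Lv mulVf// gt_eqF.
  have qv' : qf s (fun x => Lam^-1 * v x) = I.
    by rewrite qfZ// vI exprVn mulrCA mulVf ?mulr1// gt_eqF// exprn_gt0.
  have := euler_lagrange L_lin hv' hp Lv' qv' Imin.
  rewrite bfZ// => /(congr1 (fun z => Lam * z)).
  by rewrite mulrA divff ?gt_eqF// mul1r /k => ->; ring.
have q20 : 0 < q - 2 by rewrite subr_gt0.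
(* Scaling by c multiplies the left side by c and the right side by c^(q-1); the multiplier is
   absorbed when c^(q-2) = k. *)
pose c := k `^ (q - 2)^-1; have c0 : 0 < c by rewrite powR_gt0.
exists (fun x => c * v x); split.
- exact: in_hsZ.
- by move=> T iT; apply: filterS (rv iT) => x ->.
- by move=> x; rewrite mulr_ge0// ltW.
- move=> ae0; have : (\int[mu]_x (v x `^ q)%:E = \int[mu]_x 0)%E.
    apply: ge0_ae_eq_integral => //.
    + apply/measurable_EFinP; exact: (measurableT_comp (measurable_powR _) mv).
    + by move=> x _; rewrite lee_fin powR_ge0.
    + apply: filterS ae0 => x /eqP; rewrite mulf_eq0 gt_eqF//= => /eqP -> _.
      by rewrite powR0// gt_eqF.
  by rewrite integral0 vLam => -[] /eqP; rewrite gt_eqF.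
- move=> phi hp; rewrite bfZ// bv//.
  have -> : (\int[mu]_x ((c * v x) `^ (q - 1) * phi x)%:E =
      (c `^ (q - 1))%:E * \int[mu]_x (v x `^ (q - 1) * phi x)%:E)%E.
    rewrite -(integralZl measurableT (iL hp)); apply: eq_integral => x _ /=.
    by rewrite -EFinM powRM ?(ltW c0)// mulrA.
  rewrite LE// -EFinM /= mulrA; congr (_ * _).
  have -> : c `^ (q - 1) = c * c `^ (q - 2).
    rewrite -{2}[c](powRr1 (ltW c0)) -powRD; last by rewrite (gt_eqF c0) implybT.
    by congr powR; ring.
  by rewrite /c -[X in _ = _ * X]powRrM mulVf ?gt_eqF// powRr1// ltW.
Qed.

End ground_state.

(** * Test functions *)

Section enorm_triangle.
Context (R : realType) (N : nat).
Implicit Types (x y : 'rV[R]_N).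

Lemma enorm_eq0 x : enorm x = 0 -> x = 0.
Proof.
by move=> x0; apply/eqP; apply/negP => /negP /enorm_gt0; rewrite x0 ltxx.
Qed.

(** Cauchy-Schwarz from 2ab <= a^2 + b^2 on the coordinates of the normalised vectors; zero vectors
    are therefore set aside. *)
Lemma enorm_triangle x y : enorm (x + y) <= enorm x + enorm y.
Proof.
have [/enorm_eq0 -> | x0] := eqVneq (enorm x) 0; first by rewrite add0r lerDr enorm_ge0.
have [/enorm_eq0 -> | y0] := eqVneq (enorm y) 0; first by rewrite addr0 lerDl enorm_ge0.
have xp : 0 < enorm x by rewrite lt_neqAle eq_sym x0 enorm_ge0.
have yp : 0 < enorm y by rewrite lt_neqAle eq_sym y0 enorm_ge0.
rewrite -(@ler_pXn2r _ 2)// ?nnegrE ?addr_ge0 ?enorm_ge0//.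
have -> : enorm (x + y) ^+ 2 = enorm x ^+ 2 + enorm y ^+ 2 +
    2 * \sum_i x ord0 i * y ord0 i.
  rewrite !sqr_enorm mulr_sumr -!big_split/=; apply: eq_bigr => i _.
  by rewrite mxE; ring.
have : \sum_i 2 * ((x ord0 i / enorm x) * (y ord0 i / enorm y)) <=
    \sum_i ((x ord0 i / enorm x) ^+ 2 + (y ord0 i / enorm y) ^+ 2).
  apply: ler_sum => i _; have := sqr_ge0 (x ord0 i / enorm x - y ord0 i / enorm y).
  by nra.
have -> : \sum_i ((x ord0 i / enorm x) ^+ 2 + (y ord0 i / enorm y) ^+ 2) = 2.
  rewrite big_split/=.
  under eq_bigr do rewrite expr_div_n; rewrite -mulr_suml -sqr_enorm.
  under [X in _ + X]eq_bigr do rewrite expr_div_n; rewrite -mulr_suml -sqr_enorm.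
  by rewrite !divff ?expf_neq0//; ring.
have -> : \sum_i 2 * ((x ord0 i / enorm x) * (y ord0 i / enorm y)) =
    2 * (\sum_i x ord0 i * y ord0 i) / (enorm x * enorm y).
  rewrite mulr_sumr mulr_suml; apply: eq_bigr => i _.
  by field; rewrite x0 y0.
by rewrite ler_pdivrMr ?mulr_gt0// sqrrD => h; lra.
Qed.

Lemma enorm_dist x y : `|enorm x - enorm y| <= enorm (x - y).
Proof.
rewrite ler_norml lerBlDr lerNl opprB lerBlDr; apply/andP; split.
  by rewrite (enorm_subC x y) -{1}[y](subrK x) enorm_triangle.
by rewrite -{1}[x](subrK y) enorm_triangle.
Qed.

End enorm_triangle.

Section lipschitz.
Context (R : realType) (N : nat) (s : R).
Local Notation V := 'rV[R]_N.
Local Notation mu := (lebesgue_rV R N).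
Local Notation alpha := (N%:R + 2 * s).
Context (N2 : (2 <= N)%N) (s01 : 0 < s < 1).

Let s0 : 0 < s. Proof. by case/andP: s01. Qed.
Let s1 : s < 1. Proof. by case/andP: s01. Qed.
Let Nge2 : 2 <= N%:R :> R. Proof. by rewrite ler_nat. Qed.

Lemma nneseries_geometric_lty (A k : R) : 0 < k < 1 ->
  (\sum_(j <oo) (A * k ^+ j)%:E < +oo)%E.
Proof.
move=> /andP[k0 k1].
have h : (fun n => (series (geometric A k) n)%:E) @ \oo --> (A * (1 - k)^-1)%:E.
  apply: cvg_EFin; first exact: nearW.
  by apply: cvg_geometric_series; rewrite gtr0_norm.
rewrite (_ : (\sum_(j <oo) (A * k ^+ j)%:E)%E = limn (fun n => (series (geometric A k) n)%:E)).
  by rewrite (cvg_lim _ h)// ltry.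
by congr (limn _); apply/funext => n; rewrite /series/= sumEFin.
Qed.

(** A series of cube indicators used to dominate a singular kernel: its integral is a numerical
    series of coefficients times cube volumes, in place of polar coordinates. *)
Definition shells (c r : nat -> R) (x y : V) : \bar R :=
  (\sum_(j <oo) (c j * \1_(cube x (r j)) y)%:E)%E.

Lemma shells_ge (c r : nat -> R) x y (j : nat) : (forall j, 0 <= c j) ->
  cube x (r j) y -> ((c j)%:E <= shells c r x y)%E.
Proof.
move=> c0 xy; have t0 n : (0 <= (c n * \1_(cube x (r n)) y)%:E)%E.
  by rewrite lee_fin mulr_ge0.
have := @nneseries_lim_ge R (fun n => (c n * \1_(cube x (r n)) y)%:E) xpredT 0 j.+1.
move=> /(_ (fun n _ _ => t0 n)); apply: le_trans.
rewrite big_mkord big_ord_recr/= indicE mem_set// mulr1 leeDr// sume_ge0// => i _.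
Qed.

Lemma measurable_shells (c r : nat -> R) x : (forall j, 0 <= c j) ->
  measurable_fun setT (shells c r x).
Proof.
move=> c0; apply: ge0_emeasurable_sum => [n y _ _|n _]; first by rewrite lee_fin mulr_ge0.
apply/measurable_EFinP; apply: measurable_funM => //.
by apply: measurable_indic; exact: measurable_cube.
Qed.

Lemma integral_shells (c r : nat -> R) x (A k : R) :
  (forall j, 0 <= c j) -> (forall j, 0 <= r j) ->
  (forall j, c j * (2 * r j) ^+ N <= A * k ^+ j) ->
  (\int[mu]_y shells c r x y <= \sum_(j <oo) (A * k ^+ j)%:E)%E.
Proof.
move=> c0 r0 cA; rewrite /shells integral_nneseries//; last 2 first.
- move=> n; apply/measurable_EFinP; apply: measurable_funM => //.
  by apply: measurable_indic; exact: measurable_cube.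
- by move=> n y _; rewrite lee_fin mulr_ge0.
apply: lee_nneseries => [n _ _|n _].
  by apply: integral_ge0 => y _; rewrite lee_fin mulr_ge0.
rewrite ge0_intRZ//; last by apply: measurable_indic; exact: measurable_cube.
rewrite integral_indic//; last exact: measurable_cube.
rewrite setIT [X in (_ * X)%E](_ : _ = ((2 * r n) ^+ N)%:E).
  by rewrite -EFinM lee_fin.
exact: lebesgue_rV_cube.
Qed.

(** Up to a constant, the bound for [gag] of a bounded Lipschitz function. It is integrable in [y]
    near [x] because s < 1 and far from [x] because s > 0. *)
Definition tailk (x y : V) : R :=
  Num.min 1 (enorm (x - y)) ^+ 2 / enorm (x - y) `^ alpha.

Lemma tailk_ge0 x y : 0 <= tailk x y.
Proof. by rewrite divr_ge0 ?sqr_ge0 ?powR_ge0. Qed.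

Lemma tailkC x y : tailk x y = tailk y x.
Proof. by rewrite /tailk (enorm_subC x y). Qed.

Lemma measurable_tailk d (T : measurableType d) (f g : T -> V) :
  measurable_fun setT f -> measurable_fun setT g ->
  measurable_fun setT (fun x => tailk (f x) (g x)).
Proof.
move=> mf mg; apply: measurable_funM; last exact: measurable_enorm_powR.
apply: measurable_funX; apply: measurable_minr => //.
by apply: measurable_enorm; exact: measurable_rVB.
Qed.

Lemma dyadic_small (e : R) : 0 < e < 1 -> exists j, (2 ^+ j.+1)^-1 <= e < (2 ^+ j)^-1.
Proof.
move=> /andP[e0 e1].
have ex : exists n, (2 ^+ n)^-1 <= e.
  exists (Num.bound e^-1); rewrite invf_ple ?posrE ?exprn_gt0//.
  have := archi_boundP (ltW (_ : 0 < e^-1)); rewrite invr_gt0 => /(_ e0) /ltW /le_trans; apply.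
  by rewrite -natrX ler_nat ltnW// ltn_expl.
case: (ex_minnP ex) => -[|j] jP jmin.
  by move: jP; rewrite expr0 invr1 leNgt e1.
exists j; rewrite jP /= ltNge; apply/negP => /jmin.
by rewrite ltnn.
Qed.

Lemma dyadic_large (e : R) : 1 <= e -> exists j, 2 ^+ j <= e < 2 ^+ j.+1.
Proof.
move=> e1; have e0 : 0 <= e by exact: le_trans e1.
have ex : exists n, e < 2 ^+ n.
  exists (Num.bound e); apply: lt_le_trans (archi_boundP e0) _.
  by rewrite -natrX ler_nat ltnW// ltn_expl.
case: (ex_minnP ex) => -[|j] jP jmin.
  by move: jP; rewrite expr0 ltNge e1.
exists j; rewrite jP andbT leNgt; apply/negP => /jmin.
by rewrite ltnn.
Qed.

Lemma sub_enorm_cube (x y : V) (r : R) : enorm (x - y) < r -> cube x r y.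
Proof.
move=> xy i; rewrite distrC; apply: le_lt_trans xy.
by have := normr_le_enorm (x - y) i; rewrite !mxE.
Qed.

(** Largest values of the kernel on dyadic annuli: |x-y|^(2-alpha) at distance 2^(-j-1), inside the
    cube of radius 2^(-j), and |x-y|^(-alpha) at distance 2^j, inside the cube of radius 2^(j+1).
    Since alpha > 2, both powers decrease. *)
Let c1 j : R := (2 ^+ j.+1) `^ (alpha - 2).
Let r1 j : R := (2 ^+ j)^-1.
Let c2 j : R := (2 ^+ j) `^ (- alpha).
Let r2 j : R := 2 ^+ j.+1.

Lemma tailk_le_shells (x y : V) :
  ((tailk x y)%:E <= shells c1 r1 x y + shells c2 r2 x y)%E.
Proof.
have c10 j : 0 <= c1 j by exact: powR_ge0.
have c20 j : 0 <= c2 j by exact: powR_ge0.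
have sh0 c r : (forall j : nat, 0 <= c j) -> (0 <= shells c r x y)%E.
  by move=> c0; apply: nneseries_ge0 => n _ _; rewrite lee_fin mulr_ge0.
rewrite /tailk; set e := enorm (x - y).
have [e0|e0] := eqVneq e 0.
  rewrite e0 (min_idPr _)// expr0n mul0r adde_ge0//; exact: sh0.
have ep : 0 < e by rewrite lt_neqAle eq_sym e0 enorm_ge0.
have [e1|e1] := ltP e 1.
  have [|j /andP[ej1 ej2]] := @dyadic_small e; first by rewrite ep e1.
  apply: le_trans (leeDl _ (sh0 _ _ c20)).
  apply: le_trans (shells_ge c10 (sub_enorm_cube ej2)).
  have a2 : 2 < alpha by move: Nge2 s0; lra.
  rewrite lee_fin /c1 (powR_sub2 a2 (ltW ep)) invfM mulrA divff ?mul1r; last first.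
    by rewrite expf_neq0.
  rewrite -[leLHS]mul1r ler_pdivrMr ?powR_gt0// -powRM ?exprn_ge0 ?(ltW ep)//.
  have e1' : 1 `^ (alpha - 2) = 1 :> R by rewrite powR1.
  rewrite -[leLHS]e1'; apply: ler_powR2r => //; first by rewrite subr_ge0 ltW.
  by rewrite mulrC -ler_pdivrMr ?exprn_gt0// mul1r.
have [j /andP[ej1 ej2]] := dyadic_large e1.
rewrite addeC; apply: le_trans (leeDl _ (sh0 _ _ c10)).
apply: le_trans (@shells_ge c2 r2 x y j c20 (sub_enorm_cube ej2)).
rewrite lee_fin expr1n mul1r /c2 powRN lef_pV2 ?posrE ?powR_gt0 ?exprn_gt0//.
apply: ler_powR2r => //; first by rewrite addr_ge0// mulr_ge0// ltW.
Qed.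

Lemma integral_tailk : exists2 C : R, 0 <= C &
  forall x, (\int[mu]_y (tailk x y)%:E <= C%:E)%E.
Proof.
have c10 j : 0 <= c1 j by exact: powR_ge0.
have c20 j : 0 <= c2 j by exact: powR_ge0.
have r10 j : 0 <= r1 j by rewrite invr_ge0 exprn_ge0.
have r20 j : 0 <= r2 j by exact: exprn_ge0.
pose A1 : R := 2 `^ (alpha - 2) * 2 ^+ N; pose k1 : R := 2 `^ (2 * s - 2).
pose A2 : R := 4 ^+ N; pose k2 : R := 2 `^ (- (2 * s)).
have e1 j : c1 j * (2 * r1 j) ^+ N <= A1 * k1 ^+ j.
  have p0 : 0 < 2 ^+ j :> R by rewrite exprn_gt0.
  rewrite le_eqVlt; apply/orP; left; apply/eqP; rewrite /c1 /r1 /A1 exprS.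
  rewrite powRM ?(ltW p0)// exprMn -!mulrA; congr (_ * _).
  rewrite mulrCA; congr (_ * _).
  rewrite exprVn -[2 ^+ j ^+ N]powR_mulrn ?(ltW p0)// -powRB ?(gt_eqF p0) ?implybT//.
  by rewrite powR_exprn// /k1; congr ((2 `^ _) ^+ j); ring.
have e2 j : c2 j * (2 * r2 j) ^+ N <= A2 * k2 ^+ j.
  have p0 : 0 < 2 ^+ j :> R by rewrite exprn_gt0.
  rewrite le_eqVlt; apply/orP; left; apply/eqP; rewrite /c2 /r2 /A2 exprS.
  rewrite mulrA (_ : 2 * 2 = 4 :> R)//; last by ring.
  rewrite exprMn mulrCA; congr (_ * _).
  rewrite -[2 ^+ j ^+ N]powR_mulrn ?(ltW p0)// -powRD ?(gt_eqF p0) ?implybT//.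
  by rewrite powR_exprn// /k2; congr ((2 `^ _) ^+ j); ring.
have lt1 (a : R) : a < 0 -> 0 < 2 `^ a < 1.
  move=> a0; rewrite powR_gt0//=.
  by rewrite -[ltRHS](powRr0 2); apply: gt1_ltr_powR => //; rewrite ltr1n.
have S1 := nneseries_geometric_lty A1 (lt1 _ (_ : 2 * s - 2 < 0)).
have S2 := nneseries_geometric_lty A2 (lt1 _ (_ : - (2 * s) < 0)).
pose T1 := (\sum_(j <oo) (A1 * k1 ^+ j)%:E)%E.
pose T2 := (\sum_(j <oo) (A2 * k2 ^+ j)%:E)%E.
have T10 : (0 <= T1)%E.
  apply: nneseries_ge0 => n _ _; rewrite lee_fin.
  by rewrite mulr_ge0 ?mulr_ge0 ?powR_ge0 ?exprn_ge0 ?powR_ge0.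
have T20 : (0 <= T2)%E.
  by apply: nneseries_ge0 => n _ _; rewrite lee_fin mulr_ge0 ?exprn_ge0 ?powR_ge0.
have TF : (T1 + T2)%E \is a fin_num.
  rewrite ge0_fin_numE ?adde_ge0// lte_add_pinfty//; [apply: S1|apply: S2].
    by move: s1; lra.
  by move: s0; lra.
exists (fine (T1 + T2)%E); first by rewrite fine_ge0// adde_ge0.
move=> x; rewrite fineK//.
have m1 := measurable_shells r1 x c10; have m2 := measurable_shells r2 x c20.
have sh0 c r y : (forall j : nat, 0 <= c j) -> (0 <= shells c r x y)%E.
  by move=> c0; apply: nneseries_ge0 => n _ _; rewrite lee_fin mulr_ge0.
apply: (@le_trans _ _ (\int[mu]_y (shells c1 r1 x y + shells c2 r2 x y))%E).
  apply: ge0_le_integral => //.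
  - by move=> y _; rewrite lee_fin tailk_ge0.
  - by apply/measurable_EFinP; exact: measurable_tailk.
  - exact: emeasurable_funD.
  - by move=> y _; exact: tailk_le_shells.
rewrite ge0_integralD//; try by move=> y _; exact: sh0.
by apply: leeD; exact: integral_shells.
Qed.

(** The quotient vanishes unless [x] or [y] lies in the cube B, so L^2 (1_B(x) + 1_B(y)) [tailk]
    dominates it. Each summand is integrated first in the variable that it does not localise, hence
    the two orders of Tonelli. *)
Lemma lipschitz_in_hs (phi : V -> R) (L r : R) : measurable_fun setT phi ->
  0 <= L -> 0 <= r ->
  (forall x y, `|phi x - phi y| <= L * Num.min 1 (enorm (x - y))) ->
  (forall x, ~ cube (0 : V) r x -> phi x = 0) -> in_hs s phi.
Proof.
move=> mp L0 r0 lip supp; split => //.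
set B := cube (0 : V) r in supp.
have mB : measurable B by exact: measurable_cube.
have muB : mu B = ((2 * r) ^+ N)%:E by exact: lebesgue_rV_cube.
have mI : measurable_fun setT (\1_B : V -> R) by exact: measurable_indic.
have phiL x : `|phi x| <= L * \1_B x.
  have [Bx|Bx] := pselect (B x); last first.
    by rewrite supp// normr0 mulr_ge0.
  have N0 : (0 < N)%N by exact: leq_trans N2.
  (* Comparison with this point, outside the open cube, turns the Lipschitz bound into |phi| <=
     L. *)
  have e0 : phi (const_mx r) = 0.
    apply: supp => /(_ (Ordinal N0)).
    by rewrite !mxE subr0 ger0_norm// ltxx.
  have := lip x (const_mx r); rewrite e0 subr0 indicE mem_set// mulr1 => /le_trans; apply.
  by rewrite ler_piMr// ge_min lexx.
have sq x : phi x ^+ 2 <= L ^+ 2 * \1_B x.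
  have := phiL x; rewrite indicE; case: (_ \in _) => /=; rewrite ?mulr1 ?mulr0 => h.
    by rewrite -[leLHS]real_normK ?num_real// ler_pXn2r ?nnegrE.
  by have : phi x = 0; [apply/eqP; rewrite -normr_le0|move=> ->; rewrite expr0n].
have [C C0 HC] := integral_tailk.
have n2 : (sqn phi < +oo)%E.
  apply: (@le_lt_trans _ _ (\int[mu]_x (L ^+ 2 * \1_B x)%:E)%E).
    by apply: le_intR => //; [exact: measurable_funX|exact: measurable_funM|
      move=> x; exact: sqr_ge0].
  rewrite ge0_intRZ ?sqr_ge0// integral_indic// setIT [X in (_ * X)%E]muB.
  by rewrite -EFinM ltry.
rewrite /hs2 lte_add_pinfty//.
have gle x y : gag s phi x y <= L ^+ 2 * (\1_B x * tailk x y) + L ^+ 2 * (\1_B y * tailk x y).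
  have k0 := tailk_ge0 x y.
  have [/orP Bxy|] := boolP ((x \in B) || (y \in B)); last first.
    rewrite negb_or => /andP[]; rewrite !notin_setE => Bx By.
    by rewrite /gag !supp// subrr expr0n mul0r addr_ge0// mulr_ge0 ?sqr_ge0// mulr_ge0.
  apply: (@le_trans _ _ (L ^+ 2 * tailk x y)).
    rewrite /gag /tailk mulrA; apply: ler_wpM2r; first by rewrite invr_ge0 powR_ge0.
    rewrite -exprMn -[leLHS]real_normK ?num_real// ler_pXn2r ?nnegrE//.
    by rewrite mulr_ge0// le_min ler01 enorm_ge0.
  rewrite -mulrDr ler_wpM2l ?sqr_ge0// -mulrDl ler_peMl// !indicE.
  by case: Bxy => ->; rewrite ?lerDl ?lerDr.
have mt1 : measurable_fun setT (fun z : V * V => L ^+ 2 * (\1_B z.1 * tailk z.1 z.2)).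
  apply: measurable_funM => //; apply: measurable_funM.
    exact: (measurableT_comp mI measurable_fst).
  exact: measurable_tailk measurable_fst measurable_snd.
have mt2 : measurable_fun setT (fun z : V * V => L ^+ 2 * (\1_B z.2 * tailk z.1 z.2)).
  apply: measurable_funM => //; apply: measurable_funM.
    exact: (measurableT_comp mI measurable_snd).
  exact: measurable_tailk measurable_fst measurable_snd.
have t10 (z : V * V) : 0 <= L ^+ 2 * (\1_B z.1 * tailk z.1 z.2).
  by rewrite mulr_ge0 ?sqr_ge0// mulr_ge0// tailk_ge0.
have t20 (z : V * V) : 0 <= L ^+ 2 * (\1_B z.2 * tailk z.1 z.2).
  by rewrite mulr_ge0 ?sqr_ge0// mulr_ge0// tailk_ge0.
have bnd x : (\int[mu]_y (L ^+ 2 * (\1_B x * tailk x y))%:E <= (L ^+ 2 * C * \1_B x)%:E)%E.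
  under eq_integral do rewrite mulrA.
  rewrite ge0_intRZ ?mulr_ge0 ?sqr_ge0//; last 2 first.
  - exact: measurable_tailk.
  - by move=> y; exact: tailk_ge0.
  apply: (@le_trans _ _ ((L ^+ 2 * \1_B x)%:E * C%:E)%E).
    by apply: lee_wpmul2l; rewrite ?HC// lee_fin mulr_ge0 ?sqr_ge0.
  by rewrite -EFinM lee_fin mulrAC.
have fin : (\int[mu]_x (L ^+ 2 * C * \1_B x)%:E < +oo)%E.
  rewrite ge0_intRZ ?mulr_ge0 ?sqr_ge0// integral_indic// setIT [X in (_ * X)%E]muB.
  by rewrite -EFinM ltry.
apply: (@le_lt_trans _ _ (\int[(mu \x mu)%E]_z (L ^+ 2 * (\1_B z.1 * tailk z.1 z.2) +
    L ^+ 2 * (\1_B z.2 * tailk z.1 z.2))%:E)%E).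
  apply: le_intR => //.
  - exact: measurable_gag.
  - exact: measurable_funD.
  - by move=> z; exact: gag_ge0.
rewrite (ge0_intRD _ mt1 mt2 t10 t20) lte_add_pinfty//.
  rewrite fubini_tonelli1//; last exact/measurable_EFinP.
  apply: le_lt_trans fin; apply: ge0_le_integral => //.
  - by move=> x _; apply: integral_ge0 => y _; rewrite lee_fin (t10 (x, y)).
  - apply: (@measurable_fun_fubini_tonelli_F _ _ V V R mu
      (fun z => (L ^+ 2 * (\1_B z.1 * tailk z.1 z.2))%:E)); first exact/measurable_EFinP.
    by move=> z; rewrite lee_fin.
  - by apply/measurable_EFinP; exact: measurable_funM.
  - by move=> x _; exact: bnd.
rewrite fubini_tonelli2//; last exact/measurable_EFinP.
apply: le_lt_trans fin; apply: ge0_le_integral => //.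
- by move=> x _; apply: integral_ge0 => y _; rewrite lee_fin (t20 (y, x)).
- apply: (@measurable_fun_fubini_tonelli_G _ _ V V R mu
    (fun z => (L ^+ 2 * (\1_B z.2 * tailk z.1 z.2))%:E)); first exact/measurable_EFinP.
  by move=> z; rewrite lee_fin.
- by apply/measurable_EFinP; exact: measurable_funM.
- move=> x _; apply: le_trans (bnd x); rewrite le_eqVlt; apply/orP; left; apply/eqP.
  by apply: eq_integral => y _ /=; rewrite tailkC.
Qed.

End lipschitz.

Section hat.
Context (R : realType) (N : nat) (s : R).
Local Notation V := 'rV[R]_N.
Local Notation mu := (lebesgue_rV R N).

(** Radial, Lipschitz, of bounded support, positive exactly where |x| < r: it seeds the maximisation
    and is the barrier in the positivity argument. *)
Definition hat (r : R) (x : V) : R := Num.max 0 (r - enorm x).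

Lemma measurable_hat r : measurable_fun setT (hat r).
Proof.
apply: measurable_maxr => //; apply: measurable_funB => //.
by apply: (@measurable_enorm R _ V N id); exact: measurable_id.
Qed.

Lemma hat_ge0 r x : 0 <= hat r x.
Proof. by rewrite le_max lexx. Qed.

Lemma hat_gt0 r x : enorm x < r -> 0 < hat r x.
Proof. by move=> xr; rewrite lt_max subr_gt0 xr orbT. Qed.

Lemma hat_in_hs r : (2 <= N)%N -> 0 < s < 1 -> 0 <= r -> in_hs s (hat r).
Proof.
move=> N2 s01 r0; apply: (lipschitz_in_hs N2 s01 (measurable_hat r)
  (L := 1 + r) (r := r)) => //; first by rewrite addr_ge0.
- move=> x y; have h1 : `|hat r x - hat r y| <= enorm (x - y).
    rewrite (le_trans _ (enorm_dist x y))// /hat.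
    have := ler_norm (enorm x - enorm y); have := ler_norm (- (enorm x - enorm y)).
    rewrite normrN; set e := `|_| => e1 e2; rewrite ler_norml.
    by case: (leP 0 (r - enorm x)); case: (leP 0 (r - enorm y)) => *; apply/andP; split; lra.
  have h2 : `|hat r x - hat r y| <= r.
    have hr z : 0 <= hat r z <= r.
      by rewrite hat_ge0 ge_max r0/= gerBl enorm_ge0.
    by have := hr x; have := hr y; rewrite ler_norml => /andP[? ?] /andP[? ?];
      apply/andP; split; lra.
  have e0 := enorm_ge0 (x - y).
  by case: (leP 1 (enorm (x - y))) => e1; [apply: (le_trans h2); lra|apply: (le_trans h1); nra].
- move=> x xr; rewrite /hat; apply/max_idPl; rewrite subr_le0 leNgt; apply/negP => h.
  by apply: xr => i; rewrite mxE subr0; exact: le_lt_trans (normr_le_enorm x i) h.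
Qed.

Lemma hat_rot_inv r : rot_inv (hat r).
Proof. by move=> T [_ _ iT]; apply: aeW => x; rewrite /hat iT. Qed.

Lemma hat_Lq_gt0 (q c : R) : (2 <= N)%N -> 0 < q -> 0 < c ->
  (0 < \int[mu]_x (`|c * hat 1 x| `^ q)%:E)%E.
Proof.
move=> N2 q0 c0; have N0 : 0 < Num.sqrt N%:R :> R.
  by rewrite sqrtr_gt0 ltr0n (leq_trans _ N2).
(* In the cube of this radius |x| <= 1/2, so the hat is at least 1/2. *)
pose r : R := (2 * Num.sqrt N%:R)^-1.
have r0 : 0 < r by rewrite invr_gt0 mulr_gt0.
pose B := cube (0 : V) r; have mB : measurable B by exact: measurable_cube.
apply: (@lt_le_trans _ _ (\int[mu]_x ((c / 2) `^ q * \1_B x)%:E)%E).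
  have mI : measurable_fun setT (\1_B : V -> R) by exact: measurable_indic.
  rewrite (ge0_intRZ mu mI (fun x => ler0n _ _) (powR_ge0 _ _)).
  rewrite integral_indic// setIT [X in (_ * X)%E](_ : _ = ((2 * r) ^+ N)%:E); last first.
    by apply: lebesgue_rV_cube; exact: ltW.
  by rewrite -EFinM lte_fin mulr_gt0 ?powR_gt0 ?divr_gt0 ?exprn_gt0 ?mulr_gt0.
apply: le_intR.
- by apply: measurable_funM => //; exact: measurable_indic.
- by apply: measurable_norm_powR; apply: measurable_funM => //; exact: measurable_hat.
- by move=> x; rewrite mulr_ge0 ?powR_ge0.
- move=> x; have [Bx|Bx] := pselect (B x); last by rewrite indicE memNset// mulr0 powR_ge0.
  have c20 : 0 <= c / 2 by rewrite divr_ge0// ltW.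
  rewrite indicE mem_set// mulr1; apply: (ler_powR2r (ltW q0) c20).
  rewrite ger0_norm ?mulr_ge0 ?hat_ge0 ?(ltW c0)//.
  rewrite ler_pM2l// le_max; apply/orP; right.
  have : enorm x <= Num.sqrt N%:R * r.
    apply: enorm_le; first exact: ltW.
    by move=> i; have := Bx i; rewrite mxE subr0 => /ltW.
  rewrite /r invfM mulrCA divff ?gt_eqF// mulr1 => h.
  by lra.
Qed.

End hat.

Section test_functions.
Context (R : realType) (N : nat) (s : R).
Local Notation V := 'rV[R]_N.

(** The values at the corners of the dyadic cubes define measurable step functions that converge
    pointwise to [f]. *)
Lemma continuous_measurable_rV (f : V -> R) : continuous f -> measurable_fun setT f.
Proof.
move=> cf; pose c j (z : 'rV[int]_N) : V := \row_i ((z ord0 i)%:~R / 2 ^+ j).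
apply: (@measurable_fun_cvg _ _ _ setT (fun j x => f (c j (dindex j x)))).
  by move=> j; exact: (measurable_dindex j (fun z => f (c j z))).
move=> x _; apply: (cvg_comp (fun j => c j (dindex j x)) f _ (cf x)).
apply/cvg_ballP => e e0; exists (Num.bound e^-1) => // j /= je.
split => // i0 i; rewrite ord1 /ball /= !mxE.
have p2 : 0 < 2 ^+ j :> R by rewrite exprn_gt0.
have /andP[f1 f2] := floor_itv (2 ^+ j * x ord0 i).
rewrite intrD in f2.
have -> : x ord0 i - (Num.floor (2 ^+ j * x ord0 i))%:~R / 2 ^+ j =
    (2 ^+ j * x ord0 i - (Num.floor (2 ^+ j * x ord0 i))%:~R) / 2 ^+ j.
  by field; rewrite gt_eqF.
rewrite normrM [X in _ * X]ger0_norm ?invr_ge0 ?(ltW p2)// ltr_pdivrMr//.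
rewrite ger0_norm ?subr_ge0//.
apply: (@le_lt_trans _ _ 1); first by rewrite lerBlDl ltW.
rewrite -ltr_pdivrMl// mulr1.
have e1 : 0 <= e^-1 by rewrite invr_ge0 ltW.
apply: lt_le_trans (archi_boundP e1) _.
by rewrite -natrX ler_nat (leq_trans je)// ltnW// ltn_expl.
Qed.

Lemma continuous_bounded_compact (g : V -> R) (K : set V) : continuous g -> compact K ->
  exists C : R, forall x, K x -> `|g x| <= C.
Proof.
move=> cg cK.
have : compact (g @` K) by apply: continuous_compact => //; exact: continuous_subspaceT.
move=> /compact_bounded [M [_ MP]]; exists (M + 1) => x Kx.
by apply: (MP (M + 1)); [rewrite ltrDl|exists x].
Qed.

Lemma C1_in_hs (phi : V -> R) : (2 <= N)%N -> 0 < s < 1 ->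
  C1_compact_support phi -> in_hs s phi.
Proof.
move=> N2 s01 [dphi cphi]; set K := closure _ => cK.
have cont : continuous phi by move=> x; exact: differentiable_continuous.
have K0 x : ~ K x -> phi x = 0.
  move=> Kx; apply: contrapT => /eqP px; apply: Kx.
  exact: subset_closure.
(* [K] is closed, so off [K] the function vanishes in a neighbourhood; the bound for the derivatives
   on [K] is then global. *)
have D0 x v : ~ K x -> 'D_v phi x = 0.
  move=> Kx; have : \near x, phi x = (cst 0 : V -> R) x.
    have oK : open (~` K) by apply: closed_openC; exact: closed_closure.
    apply: filterS (open_nbhs_nbhs (conj oK Kx)) => y; exact: K0.
  by move=> /near_eq_derive => ->; rewrite derive_cst.
have [B BP] := continuous_bounded_compact cont cK.
have Bphi x : `|phi x| <= `|B|.
  have [Kx|Kx] := pselect (K x); first by rewrite (le_trans (BP x Kx))// ler_norm.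
  by rewrite K0// normr0.
have Dbnd (i : 'I_N) : exists C : R, 0 <= C /\ forall x, `|'D_(delta_mx ord0 i) phi x| <= C.
  have [C CP] := continuous_bounded_compact (cphi (delta_mx ord0 i)) cK.
  exists `|C|; split => // x; have [Kx|Kx] := pselect (K x).
    by rewrite (le_trans (CP x Kx))// ler_norm.
  by rewrite D0// normr0.
have [C CP] := choice Dbnd.
have Dv v x : `|'D_v phi x| <= (\sum_i C i) * enorm v.
  rewrite deriveE// {1}(row_sum_delta v) linear_sum/= mulr_suml.
  apply: (le_trans (ler_norm_sum _ _ _)); apply: ler_sum => i _.
  rewrite linearZ/= -deriveE// normrM mulrC; apply: ler_pM => //; first by case: (CP i).
  exact: normr_le_enorm.
have lip x y : `|phi x - phi y| <= (\sum_i C i) * enorm (x - y).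
  (* Mean value theorem along the segment from [y] to [x]. *)
  pose f (t : R) := phi (y + t *: (x - y)).
  have df (t : R) : is_derive t (1 : R) f ('D_(x - y) phi (y + t *: (x - y))).
    have E : (fun h : R => h^-1 *: ((f \o shift t) (h *: (1 : R)) - f t)) =
        (fun h : R => h^-1 *: ((phi \o shift (y + t *: (x - y))) (h *: (x - y)) -
           phi (y + t *: (x - y)))).
      apply/funext => h; rewrite /f /=; congr (_ *: (phi _ - _)).
      by rewrite [h *: 1](mulr1 h) scalerDl addrCA.
    have dv : derivable phi (y + t *: (x - y)) (x - y) by exact: diff_derivable.
    by split; [rewrite /derivable E|rewrite /derive E].
  have [|t _] := @MVT_segment R f (fun t => 'D_(x - y) phi (y + t *: (x - y))) 0 1 ler01 (fun t _ => df t).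
    apply: derivable_within_continuous => t _; exact: (@ex_derive _ _ _ _ _ _ _ (df t)).
  rewrite /f scale1r scale0r addr0 subr0 mulr1 (addrC y) subrK => ->.
  exact: Dv.
have [M MP] : exists M : R, forall x, K x -> `|x| <= M.
  move: cK => /compact_bounded [M [_ MP]]; exists (M + 1) => x Kx.
  by apply: (MP (M + 1)) => //; rewrite ltrDl.
have C0 : 0 <= \sum_i C i by apply: sumr_ge0 => i _; case: (CP i).
apply: (lipschitz_in_hs N2 s01 (continuous_measurable_rV cont)
  (L := \sum_i C i + 2 * `|B|) (r := `|M| + 1)).
- by rewrite addr_ge0// mulr_ge0.
- by rewrite addr_ge0.
- move=> x y; have h1 := lip x y; have e0 := enorm_ge0 (x - y).
  have h2 : `|phi x - phi y| <= 2 * `|B|.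
    rewrite (le_trans (ler_normB _ _))// mulr_natl mulr2n lerD//.
  have B0 := normr_ge0 B.
  by case: (leP 1 (enorm (x - y))) => e1; [apply: (le_trans h2)|apply: (le_trans h1)]; nra.
- move=> x xM; apply: K0 => Kx; apply: xM => i; rewrite mxE subr0.
  have := MP x Kx; rewrite {1}/Num.norm/= mx_normrE => h.
  apply: (@le_lt_trans _ _ M); last by rewrite (le_lt_trans (ler_norm _))// ltrDl.
  by apply: le_trans h; apply: (le_bigmax _ (fun ij => `|x ij.1 ij.2|) (ord0, i)).
Qed.

End test_functions.

Lemma ge0_integral_eq0_ae d (T : measurableType d) (R : realType)
    (mu : {measure set T -> \bar R}) (f : T -> \bar R) :
  measurable_fun setT f -> (forall x, 0 <= f x)%E -> (\int[mu]_x f x = 0)%E ->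
  {ae mu, forall x, f x = 0%E}.
Proof.
move=> mf f0 if0; have := (ae_eq_integral_abs mu measurableT mf).1.
under eq_integral do rewrite gee0_abs//.
by move=> /(_ if0); apply: filterS => x /(_ I).
Qed.

(** * Positivity *)

Section positivity.
Context (R : realType) (N : nat) (s : R).
Local Notation V := 'rV[R]_N.
Local Notation mu := (lebesgue_rV R N).
Local Notation alpha := (N%:R + 2 * s).
Context (N2 : (2 <= N)%N) (s01 : 0 < s < 1).
Implicit Types (u w psi : V -> R).

(** Interaction of the positive and the negative part of [g]; for g = u - w it measures the energy
    saved by passing to the maximum and the minimum. *)
Definition cross (g : V -> R) (z : V * V) : R :=
  (Num.max (g z.1) 0 * Num.max (- g z.2) 0 + Num.max (- g z.1) 0 * Num.max (g z.2) 0) /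
  enorm (z.1 - z.2) `^ alpha.

Lemma cross_ge0 g z : 0 <= cross g z.
Proof.
by rewrite divr_ge0 ?powR_ge0// addr_ge0// mulr_ge0// le_max lexx orbT.
Qed.

Lemma measurable_cross g : measurable_fun setT g -> measurable_fun setT (cross g).
Proof.
move=> mg; have m1 : measurable_fun setT (fun z : V * V => g z.1).
  exact: (measurableT_comp mg measurable_fst).
have m2 : measurable_fun setT (fun z : V * V => g z.2).
  exact: (measurableT_comp mg measurable_snd).
apply: measurable_funM; last first.
  by apply: measurable_enorm_powR; [exact: measurable_fst|exact: measurable_snd].
by apply: measurable_funD; apply: measurable_funM; apply: measurable_maxr => //;
  exact: measurableT_comp.
Qed.

(* Quantitative submodularity of the Gagliardo energy under max and min. *)
Lemma hs2_max_min u w : measurable_fun setT u -> measurable_fun setT w ->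
  (hs2 s (fun x => Num.max (u x) (w x)) + hs2 s (fun x => Num.min (u x) (w x)) +
    \int[(mu \x mu)%E]_z (2 * cross (fun x => (u x - w x)%R) z)%:E =
  hs2 s u + hs2 s w)%E.
Proof.
move=> m_u mw; set g := fun x => u x - w x.
have mmax : measurable_fun setT (fun x => Num.max (u x) (w x)) by exact: measurable_maxr.
have mmin : measurable_fun setT (fun x => Num.min (u x) (w x)) by exact: measurable_minr.
have mc : measurable_fun setT (fun z => 2 * cross g z).
  by apply: measurable_funM => //; apply: measurable_cross; exact: measurable_funB.
have c0 z : 0 <= 2 * cross g z by rewrite mulr_ge0// cross_ge0.
have mgag v : measurable_fun setT v -> measurable_fun setT (fun z : V * V => gag s v z.1 z.2).
  exact: measurable_gag.
have E : (energy s (fun x => Num.max (u x) (w x)) + energy s (fun x => Num.min (u x) (w x)) +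
    \int[(mu \x mu)%E]_z (2 * cross g z)%:E = energy s u + energy s w)%E.
  have g0 v (z : V * V) : 0 <= gag s v z.1 z.2 by exact: gag_ge0.
  rewrite /energy -(ge0_intRD _ (mgag _ mmax) (mgag _ mmin) (g0 _) (g0 _)).
  rewrite -(ge0_intRD _ (mgag _ m_u) (mgag _ mw) (g0 _) (g0 _)) -ge0_intRD//.
  - apply: eq_integral => z _; congr EFin.
    rewrite /gag /cross mulrA -!mulrDl; congr (_ / _); rewrite /g.
    move: (u z.1) (u z.2) (w z.1) (w z.2) => a b c d.
    have pos (e : R) : 0 <= e -> Num.max e 0 = e /\ Num.max (- e) 0 = 0.
      by move=> e0; rewrite (max_idPl e0) (max_idPr _)// oppr_le0.
    have neg (e : R) : e <= 0 -> Num.max e 0 = 0 /\ Num.max (- e) 0 = - e.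
      by move=> e0; rewrite (max_idPr e0) (max_idPl _)// oppr_ge0.
    have ca : Num.max a c = a /\ Num.min a c = c /\ 0 <= a - c \/
        Num.max a c = c /\ Num.min a c = a /\ a - c <= 0.
      by case: (leP a c) => h; [right|left]; rewrite ?subr_le0 ?subr_ge0 ?(ltW h).
    have cb : Num.max b d = b /\ Num.min b d = d /\ 0 <= b - d \/
        Num.max b d = d /\ Num.min b d = b /\ b - d <= 0.
      by case: (leP b d) => h; [right|left]; rewrite ?subr_le0 ?subr_ge0 ?(ltW h).
    case: ca => [[-> [-> /pos[-> ->]]]|[-> [-> /neg[-> ->]]]];
      case: cb => [[-> [-> /pos[-> ->]]]|[-> [-> /neg[-> ->]]]]; ring.
  - by apply: measurable_funD; exact: mgag.
  - by move=> z; rewrite addr_ge0.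
have S : (sqn (fun x => Num.max (u x) (w x)) + sqn (fun x => Num.min (u x) (w x)) =
    sqn u + sqn w)%E.
  have m2 (v : V -> R) : measurable_fun setT v -> measurable_fun setT (fun x => v x ^+ 2).
    by move=> mv; exact: measurable_funX.
  have p2 (v : V -> R) x : 0 <= v x ^+ 2 by exact: sqr_ge0.
  rewrite /sqn -(ge0_intRD _ (m2 _ mmax) (m2 _ mmin) (p2 _) (p2 _)).
  rewrite -(ge0_intRD _ (m2 _ m_u) (m2 _ mw) (p2 _) (p2 _)).
  apply: eq_integral => x _; congr EFin.
  by case: (leP (u x) (w x)) => _; rewrite // addrC.
rewrite /hs2 [Y in (Y + _)%E]addeACA S [LHS]addeAC.
by rewrite E addeACA.
Qed.

(** max(u, w) = u + (w - u)^+, and the supersolution property gives Q(max(u, w)) >= Q(u). In the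
    identity for max and min, Q(u) cancels, Q(min) is dropped, and Q(w) = delta^2 Q(psi) remains. *)
Lemma cross_integral_le u psi (delta : R) : in_hs s u ->
  (forall phi, in_hs s phi -> (forall x, 0 <= phi x) -> 0 <= bf s u phi) ->
  in_hs s psi -> 0 <= delta ->
  (\int[(mu \x mu)%E]_z (2 * cross (fun x => (u x - delta * psi x)%R) z)%:E <=
    (delta ^+ 2 * qf s psi)%:E)%E.
Proof.
move=> hu super hpsi d0; pose w x := delta * psi x.
have hw : in_hs s w by exact: in_hsZ.
pose phi x := Num.max 0 (w x - u x).
have hphi : in_hs s phi.
  have h := in_hsB hw hu; split.
    by apply: measurable_maxr => //; exact: h.1.
  apply: le_lt_trans h.2; apply: (@hs2_contraction R N s (Num.max 0)).
  - exact: h.1.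
  - exact: measurable_maxr.
  - move=> a b; have := ler_norm (a - b); have := ler_norm (- (a - b)).
    rewrite normrN; set e := `|a - b| => e1 e2; rewrite ler_norml.
    by case: (leP 0 a); case: (leP 0 b) => *; apply/andP; split; lra.
  - by rewrite maxxx.
have phi0 x : 0 <= phi x by rewrite le_max lexx.
have mE : (fun x => Num.max (u x) (w x)) = (fun x => u x + 1 * phi x).
  apply/funext => x; rewrite mul1r /phi.
  by case: (leP (u x) (w x)); case: (leP 0 (w x - u x)) => *; lra.
have := hs2_max_min hu.1 hw.1; rewrite mE.
rewrite hs2_expand// (hs2E hu) (hs2E hw) -EFinD.
set X := (\int[(mu \x mu)%E]_z _)%E; set n := hs2 s _ => eqX.
have X0 : (0 <= X)%E by apply: integral_ge0 => z _; rewrite lee_fin mulr_ge0// cross_ge0.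
have n0 : (0 <= n)%E by exact: hs2_ge0.
have qw : qf s w = delta ^+ 2 * qf s psi by exact: qfZ.
have b0 := super phi hphi phi0; have q0 := qf_ge0 s phi.
move: eqX X0 n0; rewrite qw expr1n mul1r mulr1.
case: X => [a| |]; case: n => [b| |]//=.
by rewrite -!EFinD => -[eqX]; rewrite !lee_fin => a0 bb0; lra.
Qed.

(** Nonlocal strong maximum principle: on the zero set the negative part of u - c psi is c psi, so
    the interaction is linear in c while its bound is quadratic. *)
Lemma supersolution_positive u : in_hs s u -> (forall x, 0 <= u x) ->
  (forall phi, in_hs s phi -> (forall x, 0 <= phi x) -> 0 <= bf s u phi) ->
  ~ {ae mu, forall x, u x = 0} -> {ae mu, forall x, 0 < u x}.
Proof.
move=> hu u0 super nu; have m_u := hu.1.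
pose Z := [set x | u x = 0].
have mZ : measurable Z.
  have -> : Z = u @^-1` [set 0] by [].
  by rewrite -[X in measurable X]setTI; exact: m_u.
have mIZ : measurable_fun setT (\1_Z : V -> R) by exact: measurable_indic.
have key r : (0 <= r)%R -> {ae mu, forall y, ~ (Z y /\ 0 < hat r y)}.
  move=> r0; pose psi : V -> R := hat r.
  have hpsi : in_hs s psi by exact: hat_in_hs.
  have mpsi : measurable_fun setT psi by exact: measurable_hat.
  (* A lower bound for [cross] of u - c psi, divided by c, with the second point restricted to the
     zero set. *)
  pose H (c : R) (z : V * V) := Num.max (u z.1 - c * psi z.1) 0 *
    (psi z.2 * \1_Z z.2) / enorm (z.1 - z.2) `^ alpha.
  have mH c : measurable_fun setT (H c).
    apply: measurable_funM; last first.
      by apply: measurable_enorm_powR; [exact: measurable_fst|exact: measurable_snd].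
    apply: measurable_funM.
      apply: measurable_maxr => //; apply: measurable_funB.
        exact: (measurableT_comp m_u measurable_fst).
      by apply: measurable_funM => //; exact: (measurableT_comp mpsi measurable_fst).
    apply: measurable_funM; first exact: (measurableT_comp mpsi measurable_snd).
    exact: (measurableT_comp mIZ measurable_snd).
  have H0 c z : 0 <= H c z.
    rewrite divr_ge0 ?powR_ge0// mulr_ge0//; first by rewrite le_max lexx orbT.
    by rewrite mulr_ge0// /psi hat_ge0.
  have Hle c : 0 < c -> (\int[(mu \x mu)%E]_z (H c z)%:E <= (c * qf s psi)%:E)%E.
    move=> c0; have h := cross_integral_le hu super hpsi (ltW c0).
    have : ((2 * c)%:E * \int[(mu \x mu)%E]_z (H c z)%:E <= (c ^+ 2 * qf s psi)%:E)%E.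
      have k0 : 0 <= 2 * c by rewrite mulr_ge0// ltW.
      rewrite -(ge0_intRZ _ (mH c) (H0 c) k0); apply: le_trans h.
      apply: le_intR.
      - exact: measurable_funM.
      - apply: measurable_funM => //; apply: measurable_cross.
        by apply: measurable_funB => //; exact: measurable_funM.
      - by move=> z; apply: mulr_ge0.
      - move=> z; rewrite -mulrA ler_wpM2l// /H /cross !mulrA.
        apply: ler_wpM2r; first by rewrite invr_ge0 powR_ge0.
        set A := Num.max _ 0; have A0 : 0 <= A by rewrite le_max lexx orbT.
        apply: (@le_trans _ _ (A * Num.max (- (u z.2 - c * psi z.2)) 0)); last first.
          by rewrite lerDl mulr_ge0// le_max lexx orbT.
        rewrite -mulrA -mulrA mulrCA; apply: ler_wpM2l => //.
        have [Zz|Zz] := pselect (Z z.2); last first.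
          by rewrite indicE memNset// !mulr0 le_max lexx orbT.
        rewrite indicE mem_set// mulr1 le_max; apply/orP; left.
        by rewrite opprB Zz subr0.
    rewrite muleC -lee_pdivlMr ?mulr_gt0// => /le_trans; apply.
    rewrite -EFinM lee_fin ler_pdivrMr ?mulr_gt0//.
    by have := qf_ge0 s (psi); nra.
  have HI : (\int[(mu \x mu)%E]_z (H 0 z)%:E = 0)%E.
    apply/eqP; rewrite eq_le; apply/andP; split; last first.
      by apply: integral_ge0 => z _; rewrite lee_fin.
    apply/lee_addgt0Pr => e e0; rewrite add0e.
    apply: (@fatou_le _ _ _ _ (fun n z => H (n.+1%:R^-1) z)) => //.
      apply: aeW => z; rewrite /H; apply: cvgMl; apply: cvgMl.
      have h0 : (fun n : nat => u z.1 - n.+1%:R^-1 * psi z.1) @ \oo --> u z.1 - 0 * psi z.1.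
        by apply: cvgB; [exact: cvg_cst|apply: cvgMl; exact: cvg_harmonic].
      have hm : (fun x : R => Num.max x 0) @ (u z.1 - 0 * psi z.1) -->
          Num.max (u z.1 - 0 * psi z.1) 0.
        have cm : continuous ((fun x : R => x) \max (fun _ : R => 0 : R)).
          apply: max_fun_continuous; first by move=> x; exact: cvg_id.
          exact: cst_continuous.
        exact: cm.
      exact: (cvg_comp _ _ h0 hm).
    have q1 : 0 < qf s psi + 1 by rewrite ltr_wpDl ?qf_ge0.
    have b0 : 0 <= (qf s psi + 1) / e by rewrite divr_ge0 ?ltW.
    exists (Num.bound ((qf s psi + 1) / e)) => // n /= Kn.
    have n0 : 0 < n.+1%:R^-1 :> R by rewrite invr_gt0.
    apply: (le_trans (Hle _ n0)); rewrite lee_fin mulrC ler_pdivrMr//.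
    have : (qf s psi + 1) / e <= n.+1%:R.
      by rewrite (le_trans (ltW (archi_boundP b0)))// ler_nat ltnW.
    by rewrite ler_pdivrMr// => h; rewrite mulrC; lra.
  have mHE : measurable_fun setT (fun z => (H 0 z)%:E) by exact/measurable_EFinP.
  have H0E z : (0 <= (H 0 z)%:E)%E by rewrite lee_fin.
  have HI2 : (\int[mu]_y \int[mu]_x (H 0 (x, y))%:E = 0)%E.
    by rewrite -HI [RHS]fubini_tonelli2.
  have mG := @measurable_fun_fubini_tonelli_G _ _ V V R mu _ mHE H0E.
  have G0 y : (0 <= \int[mu]_x (H 0 (x, y))%:E)%E by apply: integral_ge0.
  (* One such [y] is enough: the kernel is positive off x = y and psi y > 0, so u x = 0 for almost
     every [x]. *)
  apply: filterS (ge0_integral_eq0_ae mG G0 HI2) => y Gy [Zy hy]; apply: nu.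
  have mHy : measurable_fun setT (fun x => (H 0 (x, y))%:E).
    exact: (measurableT_comp mHE (pair2_measurable y)).
  have xy : {ae mu, forall x, x <> y}.
    exists [set y]; split; [exact: measurable_rV_set1| |].
      by apply: lebesgue_rV_set1; exact: leq_trans N2.
    by move=> x /= /contrapT.
  apply: filterS2 xy (ge0_integral_eq0_ae mHy (fun x => H0E (x, y)) Gy).
  move=> x nxy [] /eqP; rewrite /H /= mul0r subr0 (max_idPl (u0 x)).
  rewrite indicE mem_set// mulr1 mulf_eq0 mulf_eq0 (gt_eqF hy) orbF invr_eq0.
  have e0 : 0 < enorm (x - y) by rewrite enorm_gt0// subr_eq0; apply/eqP.
  by rewrite (gt_eqF (powR_gt0 _ e0)) orbF => /eqP.
(* Hats of integer radius exhaust the space. *)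
have : {ae mu, forall y, forall n : nat, ~ (Z y /\ 0 < hat n%:R y)}.
  by apply/ae_foralln => n; exact: key.
apply: filterS => y yP; rewrite lt_neqAle u0 andbT eq_sym; apply/eqP => uy.
apply: (yP (Num.bound (enorm y))); split => //.
by apply: hat_gt0; apply: archi_boundP; exact: enorm_ge0.
Qed.

End positivity.

(** * The radial representative *)

Section radial_representative.
Context (R : realType) (N : nat) (s : R).
Local Notation V := 'rV[R]_N.
Local Notation mu := (lebesgue_rV R N).
Local Notation alpha := (N%:R + 2 * s).
Context (N2 : (2 <= N)%N) (s01 : 0 < s < 1).
Implicit Types (u : V -> R).

Let s0 : 0 < s. Proof. by case/andP: s01. Qed.
Let alpha0 : 0 <= alpha. Proof. by rewrite addr_ge0// mulr_ge0// ltW. Qed.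
Let sN0 : 0 < Num.sqrt N%:R :> R.
Proof. by rewrite sqrtr_gt0 ltr0n (leq_trans _ N2). Qed.

Lemma mem_eball_isometry (T : V -> V) x y r : euclidean_isometry T ->
  (T y \in eball (T x) r) = (y \in eball x r).
Proof. by move=> [_ dT _]; apply/idP/idP; rewrite !inE /eball /= dT. Qed.

Lemma avg_eball_isometry u (T : V -> V) x r : measurable_fun setT u -> rot_inv u ->
  euclidean_isometry T -> avg mu (eball (T x) r) u = avg mu (eball x r) u.
Proof.
move=> m_u ru iT; have [mT dT _] := iT.
have mE z := @measurable_eball R N z r.
have mI z : measurable_fun setT (\1_(eball z r) : V -> R) by exact: measurable_indic.
have mIu z : measurable_fun setT (fun y => (\1_(eball z r) y * u y)%:E).
  by apply/measurable_EFinP; exact: measurable_funM.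
have E z : (\int[mu]_(y in eball z r) (u y)%:E = \int[mu]_y (\1_(eball z r) y * u y)%:E)%E.
  rewrite integral_mkcond; apply: eq_integral => y _; rewrite patchE indicE.
  by case: (y \in eball z r); rewrite ?mul1r ?mul0r.
have E1 : (\int[mu]_(y in eball (T x) r) (u y)%:E = \int[mu]_(y in eball x r) (u y)%:E)%E.
  rewrite (E (T x)) (E x) -(measure_preserving_integral_signed mT (mIu (T x))).
  apply: ae_eq_integral => //; first exact: (measurableT_comp (mIu _) mT.1).
  apply: filterS (ru T iT) => y uTy _.
  by rewrite uTy !indicE (mem_eball_isometry _ _ _ iT).
have sE : T @^-1` eball (T x) r = eball x r.
  by apply/funext => y; rewrite /eball /preimage /= dT.
have E2 : mu (eball (T x) r) = mu (eball x r).
  by rewrite -[in RHS]sE; exact/esym/(mT.2 _ (mE (T x))).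
exact: (f_equal2 (fun a b => fine a / fine b) E1 E2).
Qed.

(** An inscribed cube of half side r / (2 sqrt N) gives the right power of [r]; the exact volume is
    immaterial. *)
Lemma eball_measure x (r : R) : 0 < r ->
  exists m : R, [/\ mu (eball x r) = m%:E & (r / Num.sqrt N%:R) ^+ N <= m].
Proof.
move=> r0; have mE := @measurable_eball R N x r.
pose c := r / (2 * Num.sqrt N%:R).
have c0 : 0 < c by rewrite divr_gt0// mulr_gt0.
have sub1 : cube x c `<=` eball x r.
  move=> y xy; rewrite /eball /= enorm_subC.
  apply: (@le_lt_trans _ _ (Num.sqrt N%:R * c)).
    by apply: enorm_le; [exact: ltW|move=> i; rewrite !mxE; exact/ltW/xy].
  rewrite /c (_ : Num.sqrt N%:R * _ = r / 2); last by field; rewrite gt_eqF.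
  by rewrite ltr_pdivrMr// ltr_pMr// ltr1n.
have sub2 : eball x r `<=` cube x r by move=> y; exact: sub_enorm_cube.
have h2 : (mu (eball x r) <= ((2 * r) ^+ N)%:E)%E.
  rewrite -(lebesgue_rV_cube x (ltW r0)); apply: le_measure => //; rewrite inE//.
  exact: measurable_cube.
have h1 : (((2 * c) ^+ N)%:E <= mu (eball x r))%E.
  rewrite -(lebesgue_rV_cube x (ltW c0)); apply: le_measure => //; rewrite inE//.
  exact: measurable_cube.
exists (fine (mu (eball x r))); have fm : mu (eball x r) \is a fin_num.
  by rewrite ge0_fin_numE ?measure_ge0//; apply: le_lt_trans h2 _; rewrite ltry.
split; first by rewrite fineK.
rewrite -lee_fin fineK//; apply: le_trans h1; rewrite lee_fin le_eqVlt.
by apply/orP; left; apply/eqP; congr (_ ^+ N); rewrite /c; field; rewrite gt_eqF.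
Qed.

(** The null set where invariance of [u] fails depends on the isometry, so [u] cannot be compared
    pointwise along a sphere. Its ball averages are invariant at every point, hence functions of
    |x|. *)
Lemma rot_inv_spherically_symmetric u : in_hs s u -> rot_inv u ->
  spherically_symmetric u.
Proof.
move=> hu ru; have m_u := hu.1; have [e1 e2] := in_hs_lty hu.
pose r k : R := (2 ^+ k)^-1.
have r0 k : 0 < r k by rewrite invr_gt0 exprn_gt0.
pose h (x : V) (k : nat) : R := avg mu (eball x (r k)) u.
have hT T : euclidean_isometry T -> forall x, h (T x) = h x.
  by move=> iT x; apply/funext => k; exact: avg_eball_isometry.
have hrad := isometry_invariant_radial N2 hT.
(* [xget] picks a point of the sphere of radius t, with default 0 for negative t, where the sphere
   is empty. *)
exists (fun t => limn (h (xget 0 [set x : V | enorm x = t]))).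
have ig : mu.-integrable setT (gagx s u).
  apply/integrableP; split; first exact: measurable_gagx.
  under eq_integral do rewrite gee0_abs ?gagx_ge0//.
  by rewrite -energyE.
apply: filterS (integrable_ae measurableT ig) => x /(_ I) gx.
have ex : [set y : V | enorm y = enorm x] (xget 0 [set y : V | enorm y = enorm x]).
  by apply: (@xgetPex _ 0 [set y : V | enorm y = enorm x]); exists x.
rewrite (hrad _ _ ex); apply/esym/cvg_lim => //.
set D := fine (gagx s u x).
have D0 : 0 <= D by rewrite fine_ge0// gagx_ge0.
pose C : R := Num.sqrt N%:R ^+ N * D.
have C0 : 0 <= C by rewrite mulr_ge0// exprn_ge0// ltW.
have bnd k : (u x - h x k) ^+ 2 <= C * (2 `^ (- (2 * s))) ^+ k.
  have [m [mE mm]] := eball_measure x (r0 k).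
  have m0 : 0 < m by apply: lt_le_trans mm; rewrite exprn_gt0// divr_gt0.
  have := @sub_avg_le R N s alpha0 u (r k) m x (eball x (r k)) m_u e2
    (measurable_eball _ _) mE m0 (fun y xy => ltW xy).
  rewrite -(fineK gx) -EFinM lee_fin -/D => /le_trans; apply.
  rewrite [leRHS](_ : _ = Num.sqrt N%:R ^+ N * (2 `^ (- (2 * s))) ^+ k * D); last first.
    by rewrite /C mulrAC.
  apply: ler_wpM2r => //.
  rewrite ler_pdivrMr//.
  have p2 : 0 < 2 ^+ k :> R by rewrite exprn_gt0.
  apply: (@le_trans _ _ (Num.sqrt N%:R ^+ N * (2 `^ (- (2 * s))) ^+ k *
      (r k / Num.sqrt N%:R) ^+ N)); last first.
    by apply: ler_wpM2l => //; rewrite mulr_ge0 ?exprn_ge0 ?powR_ge0// ltW.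
  rewrite expr_div_n mulrA mulrAC [X in _ <= X * _]mulrC -mulrA.
  rewrite [X in _ <= X](_ : _ = (2 `^ (- (2 * s))) ^+ k * r k ^+ N); last first.
    by field; rewrite expf_neq0// gt_eqF.
  rewrite -(powR_mulrn N (ltW (r0 k))) /r -powR_inv1 ?(ltW p2)// -!powRrM.
  rewrite -powR_exprn// -powRD; last by rewrite (gt_eqF p2) implybT.
  by rewrite le_eqVlt; apply/orP; left; apply/eqP; congr powR; ring.
have k1 : `|2 `^ (- (2 * s))| < 1 :> R.
  rewrite ger0_norm ?powR_ge0// -[ltRHS](powRr0 2).
  by apply: gt1_ltr_powR; [rewrite ltr1n|rewrite oppr_lt0 mulr_gt0].
have cg := @cvg_geometric R C _ k1.
apply/cvgrPdist_le => e e0.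
move/cvgrPdist_le : cg => /(_ _ (exprn_gt0 2 e0)); apply: filterS => k.
rewrite /= sub0r normrN => ck.
rewrite -(@ler_pXn2r _ 2)// ?nnegrE ?(ltW e0)// real_normK ?num_real//.
by rewrite (le_trans (bnd k))// (le_trans (ler_norm _)).
Qed.

End radial_representative.

(** * Membership in the Sobolev space and conclusion *)

Lemma mem_Lfun2 d (T : measurableType d) (R : realType)
    (mu : {measure set T -> \bar R}) (f : T -> R) : measurable_fun setT f ->
  (\int[mu]_x (f x ^+ 2)%:E < +oo)%E -> f \in Lfun mu 2%:E.
Proof.
move=> mf f2; rewrite inE; apply/andP; split; rewrite inE//=.
rewrite /finite_norm unlock /=; apply: poweR_lty.
under eq_integral do rewrite powR_mulrn// real_normK ?num_real//.
exact: f2.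
Qed.

Lemma in_hs_fractional_sobolev (R : realType) N (s : R) (u : 'rV[R]_N -> R) :
  in_hs s u -> fractional_sobolev s u.
Proof.
move=> hu; have [eu nu] := in_hs_lty hu; have mq := measurable_quot s hu.1.
split; first by apply: mem_Lfun2 => //; exact: hu.1.
have -> : (fun z : 'rV[R]_N * 'rV[R]_N =>
    `|u z.1 - u z.2| / enorm (z.1 - z.2) `^ (N%:R / 2 + s)) = (fun z => `|quot s u z|).
  by apply/funext => z; rewrite /quot normrM normfV [in RHS](ger0_norm (powR_ge0 _ _)).
apply: mem_Lfun2; first exact: measurableT_comp.
under eq_integral do rewrite real_normK ?num_real//.
by rewrite -energy_quot.
Qed.

Theorem theorem1p1 (R : realType) (N : nat) (s p : R) :
  (2 <= N)%N ->
  0 < s < 1 ->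
  1 < p < (N%:R + 2 * s) / (N%:R - 2 * s) ->
  exists u : 'rV[R]_N -> R,
    [/\ variational_solution s p u,
        ~ {ae lebesgue_rV R N, forall x, u x = 0},
        {ae lebesgue_rV R N, forall x, 0 < u x}
      & spherically_symmetric u].
Proof.
move=> N2 s01 /andP[p1 pN].
have Nge2 : 2 <= N%:R :> R by rewrite ler_nat.
have /andP[s0 s1] := s01.
pose q := p + 1; have q2 : 2 < q by rewrite /q; lra.
have q0 : 0 < q by lra.
have N2s : 0 < N%:R - 2 * s by lra.
(* The upper bound on [p] reads p (N - 2s) < N + 2s; add N - 2s to both sides. *)
have qN : q * (N%:R - 2 * s) < 2 * N%:R.
  by move: pN; rewrite ltr_pdivlMr// /q; lra.
have hh : in_hs s (hat 1 : 'rV[R]_N -> R) by exact: hat_in_hs.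
(* Scales the hat into the ball Q <= 1; the added 1 keeps the denominator positive. *)
pose c := (Num.sqrt (qf s (hat 1 : 'rV[R]_N -> R)) + 1)^-1.
have c0 : 0 < c by rewrite invr_gt0 ltr_wpDl// sqrtr_ge0.
have hc := in_hsZ c hh.
have hc1 : (hs2 s (fun x : 'rV[R]_N => c * hat 1 x)%R <= 1)%E.
  rewrite hs2E// qfZ// lee_fin /c exprVn mulrC ler_pdivrMr; last first.
    by rewrite exprn_gt0// ltr_wpDl// sqrtr_ge0.
  rewrite mul1r sqrrD expr1n mulr1 sqr_sqrtr ?qf_ge0// -addrA lerDl.
  by rewrite addr_ge0// mulrn_wge0 ?sqrtr_ge0.
have rc : rot_inv (fun x : 'rV[R]_N => c * hat 1 x).
  by move=> T iT; apply: filterS (hat_rot_inv 1 iT) => x ->.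
have [v [Lam [Lam0 [mv rv hv v0] vLam vmax]]] :=
  maximiser_exists N2 s01 q2 qN hc.1 rc hc1 (hat_Lq_gt0 N2 q0 c0).
have [u [hu ru u0 nu Eu]] := ground_state_exists N2 s01 q2 qN Lam0 mv rv hv v0 vLam vmax.
have uq x : `|u x| `^ (p - 1) * u x = u x `^ (q - 1).
  rewrite ger0_norm// mulrC mulr_powRB1//; last by lra.
  by congr powR; rewrite /q; ring.
have iuf phi : in_hs s phi ->
    (\int[lebesgue_rV R N]_x (u x `^ (q - 1) * phi x)%:E = (bf s u phi)%:E)%E.
  move=> hp; rewrite Eu// fineK//; apply: integrable_fin_num => //.
  exact: (integrable_powR_mul N2 s01 q2 qN hu u0 hp).
exists u; split => //; last exact: (rot_inv_spherically_symmetric N2 s01 hu ru).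
- split; first exact: in_hs_fractional_sobolev.
  move=> phi cphi; have hp := C1_in_hs N2 s01 cphi.
  under [RHS]eq_integral do rewrite uq.
  rewrite iuf// /bf EFinD.
  have [eu nu2] := in_hs_lty hu; have [ep np] := in_hs_lty hp.
  rewrite energy_quot in eu; rewrite energy_quot in ep.
  have [iq _] := sq_expand 0 (measurable_quot s hu.1) (measurable_quot s hp.1) eu ep.
  have [i2 _] := sq_expand 0 hu.1 hp.1 nu2 np.
  (* Both integrals are finite, so the identity between reals becomes the one between extended
     reals. *)
  rewrite !fineK; [|exact: integrable_fin_num i2|exact: integrable_fin_num iq].
  congr (_ + _)%E; apply: eq_integral => z _; congr EFin.
  by rewrite -enorm_powR_half /quot; set e := _ `^ _; rewrite -mulf_div.
(* The right-hand side of the equation is nonnegative for phi >= 0, so [u] is a supersolution. *)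
- apply: (supersolution_positive N2 s01 hu u0) => // phi hp phi0.
  rewrite -lee_fin -iuf//; apply: integral_ge0 => x _.
  by rewrite lee_fin mulr_ge0 ?powR_ge0.
Qed.
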